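(* Let $\mu\in(0,1)$ and the integer $\nu\ge0$ be fixed; write $\alpha=\frac{1+\mu}{2\mu}$, $\delta=\frac{1-\mu}{2\mu}$, and let $K_N(x,y)$ be the correlation kernel defined in the context. For $x$ and $y$ in a compact subset of the positive real axis, $$\lim_{N\to\infty}\left\{\frac{1}{N(\alpha^2-\delta^2)}K_N\left(\frac{x}{N(\alpha^2-\delta^2)},\frac{y}{N(\alpha^2-\delta^2)}\right)\right\}=K_\nu(x,y),$$ where the limiting kernel is $$K_\nu(x,y)=\int_0^1G^{1,0}_{0,3}\left(\begin{array}{c}-\\0,\,-\nu,\,0\end{array}\Big|\,ux\right)G^{2,0}_{0,3}\left(\begin{array}{c}-\\\nu,\,0,\,0\end{array}\Big|\,uy\right)du.$$
   Context: $I_\kappa$ and $K_\kappa$ (one index) are the modified Bessel functions of the first and second kind; $(a)_k=a(a+1)\cdots(a+k-1)$ is the Pochhammer symbol. For $n=0,1,\ldots$, $$P_n(x)=(-1)^n(\nu+n)!\,n!\sum_{k=0}^n\frac{(\alpha^2-\delta^2)^{k+\frac12}}{\delta^k}\frac{(-n)_k}{(\nu+k)!\,k!}\,x^{\frac k2}I_k(2\delta\sqrt x),$$ $$Q_n(y)=(-1)^n\frac{2}{(n!)^2}\sum_{l=0}^n\frac{(\alpha^2-\delta^2)^{l+\nu+\frac12}}{\alpha^{l+\nu}}\frac{(-n)_l}{(\nu+l)!\,l!}\,y^{\frac{l+\nu}2}K_{l+\nu}(2\alpha\sqrt y),$$ and $K_N(x,y)=\sum_{n=0}^{N-1}P_n(x)Q_n(y)$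 (the correlation kernel of the squared singular values of $X_1X_2$, where $X_1$, $X_2$ are $N\times M$ and $M\times N$ random matrices, $M=N+\nu$, with joint density $(\pi^2\mu)^{-NM}\exp[-\alpha\operatorname{Tr}(X_1X_1^*+X_2^*X_2)+\delta\operatorname{Tr}(X_1X_2+X_2^*X_1^* )]$). The Meijer G-functions are, for $z>0$, $$G^{1,0}_{0,3}\left(\begin{array}{c}-\\0,-\nu,0\end{array}\Big|\,z\right)=\frac{1}{2\pi i}\int_C\frac{\Gamma(-t)}{\Gamma(1+t)\Gamma(1+\nu+t)}z^t\,dt=\sum_{k=0}^\infty\frac{(-1)^kz^k}{(k!)^2(\nu+k)!},$$ with $C$ a loop starting and ending at $+\infty$ and encircling the poles $0,1,2,\ldots$ of $\Gamma(-t)$ once in the negative direction, and $$G^{2,0}_{0,3}\left(\begin{array}{c}-\\\nu,0,0\end{array}\Big|\,z\right)=\frac{1}{2\pi i}\int_{c-i\infty}^{c+i\infty}\frac{\Gamma(s)\Gamma(s+\nu)}{\Gamma(1-s)}z^{-s}ds,\qquad c>0.$$ *)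

(* Defs.v *)
From HB Require Import structures.
From mathcomp Require Import all_boot all_order all_algebra.
From mathcomp Require Import all_classical all_reals all_analysis.
From mathcomp Require Import complex.

Set Implicit Arguments.
Unset Strict Implicit.
Unset Printing Implicit Defensive.

Import Order.TTheory GRing.Theory Num.Theory.
Import numFieldNormedType.Exports.

Local Open Scope classical_set_scope.
Local Open Scope ring_scope.
Local Open Scope complex_scope.

Definition pochhammer (A : pzRingType) (a : A) (k : nat) : A :=
  \prod_(i < k) (a + i%:R).

Definition besselI (R : realType) (k : nat) (z : R) : R :=
  limn (series (fun m : nat =>
    (z / 2) ^+ (2 * m + k) / (m`!%:R * (m + k)`!%:R))).

Definition coshR (R : realType) (t : R) : R := (expR t + expR (- t)) / 2.

(* Schlaefli's integral representation, valid for every order and z > 0. *)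
Definition besselK (R : realType) (kappa z : R) : R :=
  \int[lebesgue_measure]_(t in `[0, +oo[)
    (expR (- z * coshR t) * coshR (kappa * t)).

Definition cintegral (R : realType) (D : set R) (f : R -> R[i]) : R[i] :=
  (\int[lebesgue_measure]_(t in D) complex.Re (f t))
  +i* (\int[lebesgue_measure]_(t in D) complex.Im (f t)).

(* Integral of f over the line Re s = c, oriented upwards: s = c + it and
   ds = i dt. *)
Definition vline_integral (R : realType) (c : R) (f : R[i] -> R[i]) : R[i] :=
  'i * cintegral [set: R] (fun t => f (c +i* t)).

(* t ^ s = exp (s ln t); only meaningful for t > 0. *)
Definition cpow (R : realType) (t : R) (s : R[i]) : R[i] :=
  (t `^ complex.Re s)%:C
  * (cos (complex.Im s * ln t) +i* sin (complex.Im s * ln t)).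

Definition euler_gamma (R : realType) (s : R[i]) : R[i] :=
  cintegral `]0, +oo[ (fun t : R => cpow t (s - 1) * (expR (- t))%:C).

(* Continuation of Euler's integral by
     Gamma s = Gamma (s + m) / (s (s + 1) ... (s + m - 1)),
   with m the least natural number such that 0 < Re (s + m).  At the poles
   0, -1, -2, ... the denominator is 0, so that cgamma s = 0 and
   (cgamma s)^-1 = 0, which is the value there of the entire function
   1 / Gamma. *)
Definition cgamma (R : realType) (s : R[i]) : R[i] :=
  if 0 < complex.Re s then euler_gamma s
  else let m := (Num.truncn (- complex.Re s)).+1 in
       euler_gamma (s + m%:R) / pochhammer s m.

(* G^{1,0}_{0,3} (- ; 0, -nu, 0 | z), by its residue series. *)
Definition meijerG10 (R : realType) (nu : nat) (z : R) : R :=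
  limn (series (fun k : nat =>
    (-1) ^+ k * z ^+ k / (k`!%:R ^+ 2 * (nu + k)`!%:R))).

(* G^{2,0}_{0,3} (- ; nu, 0, 0 | z), by its Mellin-Barnes integral over the
   line Re s = c. *)
Definition meijerG20 (R : realType) (nu : nat) (c z : R) : R[i] :=
  (2 * pi%:C * 'i)^-1 * vline_integral c (fun s =>
    cgamma s * cgamma (s + nu%:R) / cgamma (1 - s) * cpow z (- s)).

Definition alpha (R : realType) (mu : R) : R := (1 + mu) / (2 * mu).

Definition delta (R : realType) (mu : R) : R := (1 - mu) / (2 * mu).

Definition P (R : realType) (mu : R) (nu n : nat) (x : R) : R :=
  let a := alpha mu in let d := delta mu in
  (-1) ^+ n * (nu + n)`!%:R * n`!%:R *
  \sum_(k < n.+1)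
    (a ^+ 2 - d ^+ 2) `^ (k%:R + 2^-1) / d ^+ k
    * (pochhammer (- n%:R) k / ((nu + k)`!%:R * k`!%:R))
    * x `^ (k%:R / 2) * besselI k (2 * d * Num.sqrt x).

Definition Q (R : realType) (mu : R) (nu n : nat) (y : R) : R :=
  let a := alpha mu in let d := delta mu in
  (-1) ^+ n * (2 / n`!%:R ^+ 2) *
  \sum_(l < n.+1)
    (a ^+ 2 - d ^+ 2) `^ (l%:R + nu%:R + 2^-1) / a ^+ (l + nu)
    * (pochhammer (- n%:R) l / ((nu + l)`!%:R * l`!%:R))
    * y `^ ((l + nu)%:R / 2) * besselK (l + nu)%:R (2 * a * Num.sqrt y).

Definition kernel_N (R : realType) (mu : R) (nu N : nat) (x y : R) : R :=
  \sum_(n < N) P mu nu n x * Q mu nu n y.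

Definition limit_kernel (R : realType) (nu : nat) (c x y : R) : R[i] :=
  cintegral `[0, 1] (fun u =>
    (meijerG10 nu (u * x))%:C * meijerG20 nu c (u * y)).

(* Main.v *)
(* With D = alpha^2 - delta^2 and b = N D, rescaling gives
     b^-1 K_N(x/b, y/b) = (1/N) sum_(n < N) p_n(x) S_n(y/N).
   The Bessel I series shows p_n(x) = G10((n+1) x / N) + O(1/N).  Mellin
   inversion of the Gamma integral gives a Mellin-Barnes integral for Bessel K,
   and a Vandermonde convolution turns the alternating sum S_n into
     S_n(q) = (1 / 2 pi) int Gamma(s) W_n(s) q^-s dt,   s = c + i t,
     W_n(s) = sum_(j <= n) (1-s)_(n-j)/(n-j)! * r^j/j! * (1-r)^(s+nu) Gamma(s+nu+j),
   with r = delta^2 / alpha^2 < 1.  By Gauss's limit formula and Tannery's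
   theorem (n+1)^s W_n(s) --> Gamma(s+nu) / Gamma(1-s), and
   Gamma(s) (n+1)^s W_n(s) is bounded by a multiple of |s|^-3 uniformly in n, so
   by dominated convergence S_n(q) - G20((n+1) q) = o(((n+1) q)^-c) uniformly in
   q.  In particular G20 does not depend on c; for c = 1/4 the sum is, up to a
   weighted Cesaro mean of a null sequence, a Riemann sum of the integrand of
   the limiting kernel, whose singularity at 0 is integrable. *)
Require Import Defs.
From HB Require Import structures.
From mathcomp Require Import all_boot all_order all_algebra.
From mathcomp Require Import all_classical all_reals all_analysis.
From mathcomp Require Import measurable_realfun.
From mathcomp Require Import complex ring lra.
Set Implicit Arguments.
Unset Strict Implicit.
Unset Printing Implicit Defensive.

Import Order.TTheory GRing.Theory Num.Theory.
Import numFieldNormedType.Exports.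

Local Open Scope classical_set_scope.
Local Open Scope ring_scope.
Local Open Scope complex_scope.

(** The obstacle is cancellation: the terms of the alternating sum S_n are of binomial size, so it
    can neither be passed to the limit termwise nor be bounded by absolute values. The weights W_n
    trade it for a sum with geometrically small terms, since r < 1; the limits of these terms sum to
    a power of 1 - r that the prefactor removes, which is why the limit does not depend on mu. On
    the line Re s = c everything rests on t = e^x, which makes Gamma the Fourier transform of e^(c x
    - e^x) and Mellin inversion a case of Fourier inversion. The exponent 3 arises as follows:
    (1-s)_k / k! costs a fixed power of |s|, Gamma (s + nu + j) decays faster than any power, and of
    the three powers kept two make the integral converge and one pays for a Lipschitz estimate in ln
    q, needed by the Riemann sum. With c = 1/4 the oscillation of the integrand on a cell of length
    1/N is of order u^(-1/4) min (1, 1/(N u)), hence at most N^(-1/4) u^(-1/2), small in N and still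
    integrable at 0. *)

Lemma eq_ler (R : numDomainType) (x y : R) : x = y -> x <= y.
Proof. by move=> ->. Qed.

(** * Lebesgue integrals over the real line *)

Section RealIntegrals.
Context {R : realType}.
Notation mu := (@lebesgue_measure R).
Implicit Types (f g F : R -> R) (a b : R).

Definition integrableT (f : R -> R) := mu.-integrable setT (EFin \o f).

Lemma integrableT_le g f : integrableT g -> measurable_fun setT f ->
  (forall x, `|f x| <= g x) -> integrableT f.
Proof.
move=> ig mf fg; apply: (le_integrable measurableT _ _ ig).
  exact/measurable_EFinP.
by move=> x _ /=; rewrite lee_fin (le_trans (fg x))// ler_norm.
Qed.

Lemma integrableT_measurable f : integrableT f -> measurable_fun setT f.
Proof. by move=> /measurable_int /measurable_EFinP. Qed.

Lemma integrableT_scale (k : R) f : integrableT f -> integrableT (fun x => k * f x).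
Proof. exact: (@integrableZl _ _ _ mu _ measurableT k (EFin \o f)). Qed.

Lemma integrableT_add f g : integrableT f -> integrableT g ->
  integrableT (fun x => f x + g x).
Proof. exact: (@integrableD _ _ _ mu _ measurableT (EFin \o f) (EFin \o g)). Qed.

Lemma integrableT_sub f g : integrableT f -> integrableT g ->
  integrableT (fun x => f x - g x).
Proof. exact: (@integrableB _ _ _ mu _ measurableT (EFin \o f) (EFin \o g)). Qed.

Lemma integrableT_norm f : integrableT f -> integrableT (fun x => `|f x|).
Proof. exact: (@integrable_norm _ _ _ mu). Qed.

Lemma dominated_cvg_Rintegral d (T : measurableType d)
  (m : {measure set T -> \bar R}) (D : set T) (f_ : nat -> T -> R) (f g : T -> R) :
  measurable D ->
  (forall n, measurable_fun D (f_ n)) -> m.-integrable D (EFin \o g) ->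
  (forall n x, D x -> `|f_ n x| <= g x) ->
  (forall x, D x -> f_ ^~ x @ \oo --> f x) ->
  m.-integrable D (EFin \o f) /\
  (\int[m]_(x in D) f_ n x)%R @[n --> \oo] --> (\int[m]_(x in D) f x)%R.
Proof.
move=> mD mf ig fg ff.
have mfl : measurable_fun D f by apply: (measurable_fun_cvg mf).
have H1 n : measurable_fun D (EFin \o f_ n) by apply/measurable_EFinP.
have H2 : {ae m, forall x, D x -> (fun n => (EFin \o f_ n) x) @ \oo --> (EFin \o f) x}.
  by apply: aeW => x Dx; apply: cvg_EFin (ff x Dx); apply: nearW.
have H3 : {ae m, forall x n, D x -> (`|(EFin \o f_ n) x| <= (EFin \o g) x)%E}.
  by apply: aeW => x n Dx /=; rewrite lee_fin fg.
have [I1 _ I2] := dominated_convergence mD H1 ((measurable_EFinP _ _).2 mfl) H2 ig H3.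
split => //.
apply: fine_cvg.
by rewrite fineK ?(integrable_fin_num _ I1)//; exact: I2.
Qed.

Lemma integrableT_itv_cvg f : integrableT f ->
  (\int[mu]_(x in `[(- n%:R), n%:R]) f x)%R @[n --> \oo] --> (\int[mu]_x f x)%R.
Proof.
move=> intf.
under eq_fun do rewrite Rintegral_mkcond.
have [] := @dominated_cvg_Rintegral _ _ mu setT (fun n => f \_ `[(- n%:R), n%:R]) f (fun x => `|f x|) => //.
- move=> n; apply/(measurable_restrictT _ _).1 => //.
  by apply: measurable_funTS; exact: integrableT_measurable.
- exact: integrableT_norm.
- move=> n x _; rewrite patchE; case: ifP => //; by rewrite normr0.
- move=> x _; apply: cvg_near_cst.
  near=> n; rewrite patchE mem_set//= in_itv/=.
  rewrite -ler_norml; near: n; exact: nbhs_infty_ger.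
Unshelve. all: by end_near. Qed.

Lemma Rintegral_FTC F f a b : a <= b ->
  (forall x : R, is_derive x 1 F (f x)) -> continuous f ->
  \int[mu]_(x in `[a, b]) f x = F b - F a.
Proof.
rewrite le_eqVlt => /predU1P[<-|ab] dF cf.
  by rewrite set_itv1 Rintegral_set1 subrr.
have cF : continuous F.
  by move=> x; apply/differentiable_continuous/derivable1_diffP; apply: ex_derive.
rewrite /Rintegral (@continuous_FTC2 _ f F)//.
- exact: continuous_subspaceT.
- split; first by move=> x _; exact: ex_derive.
    by apply: cvg_at_right_filter; exact: cF.
  by apply: cvg_at_left_filter; exact: cF.
- by move=> x _; rewrite derive1E derive_val.
Qed.

(** Integrability is a hypothesis, so the integral is already the limit over the intervals [-n, n],
    and the primitive has to be controlled only along the integers. *)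
Lemma Rintegral_FTCT F f (l l' : R) : integrableT f ->
  (forall x : R, is_derive x 1 F (f x)) -> continuous f ->
  F n%:R @[n --> \oo] --> l -> F (- n%:R) @[n --> \oo] --> l' ->
  \int[mu]_x f x = l - l'.
Proof.
move=> intf dF cf Fl Fl'; rewrite -(cvg_lim _ (integrableT_itv_cvg intf))//; apply/cvg_lim => //.
under eq_fun => n.
  rewrite (@Rintegral_FTC F)//; last by rewrite (@le_trans _ _ 0)// oppr_le0.
  over.
exact: cvgB.
Qed.

Lemma continuous_measurableT f : continuous f -> measurable_fun setT f.
Proof. exact: continuous_measurable_fun. Qed.

(** The reference majorant: Poisson kernels and two-sided exponentials are bounded by multiples of
    it. *)
Definition inv_one_sqr (x : R) : R := (1 + x ^+ 2)^-1.

Lemma one_sqr_gt0 (x : R) : 0 < 1 + x ^+ 2.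
Proof. by rewrite ltr_pwDl// sqr_ge0. Qed.

Lemma continuous_inv_one_sqr : continuous inv_one_sqr.
Proof. exact: continuous_oneDsqrV. Qed.

Lemma integrableT_inv_one_sqr : integrableT inv_one_sqr.
Proof.
have mo : measurable_fun setT inv_one_sqr := continuous_measurableT continuous_inv_one_sqr.
apply/integrableP; split; first exact/measurable_EFinP.
apply/abse_integralP => //=; first exact/measurable_EFinP.
rewrite ge0_symfun_integralT//=.
- rewrite (_ : [set x | _] = `[0, +oo[%classic); last first.
    by apply/seteqP; split => x/=; rewrite in_itv/= andbT.
  by rewrite integral0y_oneDsqr -EFinM/= ltry.
- by move=> x; rewrite /inv_one_sqr invr_ge0 ltW// one_sqr_gt0.
- exact: continuous_inv_one_sqr.
- by move=> x/=; rewrite /inv_one_sqr sqrrN.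
Qed.

Lemma cvg_atan_scale (eta a : R) : 0 < eta ->
  atan ((n%:R - a) / eta) @[n --> \oo] --> pi / 2 /\
  atan ((- n%:R - a) / eta) @[n --> \oo] --> - (pi / 2).
Proof.
move=> eta0.
have H (k : R) : (n%:R + k) / eta @[n --> \oo] --> +oo.
  apply/cvgryPge => A; near=> n.
  rewrite ler_pdivlMr// -lerBlDr; near: n; exact: nbhs_infty_ger.
have H2 (k : R) : atan ((n%:R + k) / eta) @[n --> \oo] --> pi / 2.
  by apply: (cvg_comp _ _ (H k)); exact: cvgy_atan.
split; first exact: H2.
have -> : (fun n => atan ((- n%:R - a) / eta)) = (fun n => - atan ((n%:R + a) / eta)).
  by apply/funext => n; rewrite -atanN -mulNr opprD.
by apply: cvgN; exact: H2.
Unshelve. all: by end_near. Qed.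

Lemma poisson_continuous (eta a : R) : 0 < eta ->
  continuous (fun x : R => eta / (eta ^+ 2 + (x - a) ^+ 2)).
Proof.
move=> eta0 x; apply: cvgM; [exact: cvg_cst|apply: cvgV].
  by rewrite gt_eqF// ltr_pwDl ?sqr_ge0// exprn_gt0.
apply: cvgD; first exact: cvg_cst.
apply: (@cvg_comp _ _ _ (fun x => x - a) (fun y : R => y ^+ 2) _ (nbhs (x - a))).
  by apply: cvgB; [exact: cvg_id|exact: cvg_cst].
exact: exprn_continuous.
Qed.

Lemma integrableT_poisson (eta a : R) : 0 < eta ->
  integrableT (fun x : R => eta / (eta ^+ 2 + (x - a) ^+ 2)).
Proof.
move=> eta0; pose C := (1 + 2 * a ^+ 2) / eta + 2 * eta.
(* (x - 2 a)^2 >= 0 gives 1 + x^2 <= 2 (1 + a^2) + 2 (x - a)^2; the two parts of the constant cover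
   the two terms on the right. *)
have iT := integrableT_scale (2 * (1 + a ^+ 2) / eta + 2 * eta) integrableT_inv_one_sqr.
apply: (integrableT_le iT); first by apply: continuous_measurableT; exact: poisson_continuous.
move=> x; have e2 : 0 < eta ^+ 2 by rewrite exprn_gt0.
have H : 0 < eta ^+ 2 + (x - a) ^+ 2 by rewrite ltr_pwDl ?sqr_ge0.
rewrite ger0_norm ?divr_ge0 ?(ltW H) ?(ltW eta0)// /inv_one_sqr.
rewrite ler_pdivlMr ?one_sqr_gt0// mulrAC ler_pdivrMr//.
have -> : 2 * (1 + a ^+ 2) / eta = 2 * (1 + a ^+ 2) / eta ^+ 2 * eta.
  by field; rewrite gt_eqF.
set q := 2 * (1 + a ^+ 2) / eta ^+ 2.
have -> : (q * eta + 2 * eta) * (eta ^+ 2 + (x - a) ^+ 2) = eta * ((q + 2) * (eta ^+ 2 + (x - a) ^+ 2)) by ring.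
rewrite ler_pM2l//.
have q0 : 0 <= q by rewrite /q divr_ge0 ?(ltW e2)// mulr_ge0// ltW// one_sqr_gt0.
have -> : (q + 2) * (eta ^+ 2 + (x - a) ^+ 2) =
  q * eta ^+ 2 + q * (x - a) ^+ 2 + 2 * eta ^+ 2 + 2 * (x - a) ^+ 2 by ring.
have -> : q * eta ^+ 2 = 2 * (1 + a ^+ 2) by rewrite /q mulfVK ?gt_eqF.
have h1 : 0 <= q * (x - a) ^+ 2 by rewrite mulr_ge0 ?sqr_ge0.
have h2 : 0 <= (x - 2 * a) ^+ 2 by exact: sqr_ge0.
nra.
Qed.

Lemma Rintegral_poisson (eta a : R) : 0 < eta ->
  \int[mu]_x (eta / (eta ^+ 2 + (x - a) ^+ 2)) = pi.
Proof.
move=> eta0; have [l l'] := cvg_atan_scale a eta0.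
rewrite (@Rintegral_FTCT (fun x => atan ((x - a) / eta)) _ _ _ _ _ _ l l').
- by lra.
- exact: integrableT_poisson.
- move=> x; apply: is_derive_eq.
  rewrite scaler0 add0r subr0 /GRing.scale /= mulr1.
  have ? : eta != 0 by rewrite gt_eqF.
  have ? : eta ^+ 2 + (x - a) ^+ 2 != 0 by rewrite gt_eqF// ltr_pwDl ?sqr_ge0// exprn_gt0.
  have -> : 1 + ((x - a) / eta) ^+ 2 = (eta ^+ 2 + (x - a) ^+ 2) / eta ^+ 2 by field.
  by field; apply/andP.
- exact: poisson_continuous.
Qed.

End RealIntegrals.

(** * Two-sided exponentials, translations and the substitution t = e^x *)

Section ExpKernel.
Context {R : realType}.
Notation mu := (@lebesgue_measure R).
Implicit Types (f g F : R -> R) (a b : R).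

(** Monotone convergence along an increasing exhaustion: it transfers a substitution known on
    compact intervals to an open or unbounded domain. *)
Lemma nonneg_integrable_cvg_itv f (D : nat -> set R) (E : set R) (l : R) :
  measurable E ->
  measurable_fun E f -> (forall x, 0 <= f x) ->
  (forall n, measurable (D n)) -> (forall n, D n `<=` D n.+1) ->
  (forall n, D n `<=` E) -> E `<=` \bigcup_n D n ->
  ((\int[mu]_(x in D n) (f x)%:E) @[n --> \oo] --> l%:E)%E ->
  (\int[mu]_(x in E) (f x)%:E = l%:E)%E.
Proof.
move=> mE mf f0 mD ndD DE ED h.
have ndD' : {homo D : n m / (n <= m)%N >-> n `<=` m}.
  move=> n m /subnK <-; elim: (m - n)%N => [//|k ih].
  by rewrite addSn; apply: subset_trans ih _; exact: ndD.
rewrite -(cvg_lim _ h)//.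
have -> : (fun n => \int[mu]_(x in D n) (f x)%:E)%E =
    (fun n => \int[mu]_x ((fun x => (f x)%:E) \_ (D n)) x)%E.
  by apply/funext => n; rewrite integral_mkcond.
rewrite integral_mkcond; apply/esym/cvg_lim => //.
set G := fun (n : nat) => ((fun x : R => (f x)%:E) \_ (D n)).
have Gl : (fun x : R => (f x)%:E) \_ E = (fun x => limn (fun n => G n x)).
  apply/funext => x; apply/esym/cvg_lim => //; apply: cvg_near_cst.
  have [xE|xE] := pselect (E x).
    have [N _ DN] := ED _ xE.
    near=> n; rewrite /G !patchE (mem_set xE) mem_set//.
    by apply: (ndD' N) => //; near: n; exact: nbhs_infty_ge.
  near=> n; rewrite /G !patchE !memNset//.
  by apply: contra_not xE => /DE.
rewrite Gl.
apply: cvg_monotone_convergence => //.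
- move=> n; apply/(measurable_restrictT _ _).1 => //.
    exact: mD.
  have mf' : measurable_fun (D n) f by apply: measurable_funS mf.
  exact/measurable_EFinP.
- by move=> n x _; rewrite /G patchE; case: ifP => // _; rewrite lee_fin.
- move=> x _ n m nm; rewrite /G !patchE; case: ifPn => [|_]; last first.
    by case: ifP => // _; rewrite lee_fin.
  by rewrite inE => /(ndD' _ _ nm) Dm; rewrite mem_set.
Unshelve. all: by end_near. Qed.

Lemma integrableT_exp_abs (eta : R) : 0 < eta -> integrableT (fun t : R => expR (- (eta * `|t|))).
Proof.
(* From e^y >= (1 + y / 2)^2 with y = eta |x|: the constant term asks for C >= 1, the quadratic one
   for C eta^2 / 4 >= 1. *)
move=> eta0; set C := Num.max 1 (4 / eta ^+ 2).
apply: (integrableT_le (integrableT_scale C integrableT_inv_one_sqr)).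
  apply: continuous_measurableT => x.
  apply: (@cvg_comp _ _ _ (fun x : R => - (eta * `|x|)) expR _ (nbhs (- (eta * `|x|)))).
    apply: cvgN; apply: cvgM; [exact: cvg_cst|exact: norm_continuous].
  exact: continuous_expR.
move=> x; rewrite ger0_norm ?expR_ge0// /inv_one_sqr expRN.
rewrite ler_pdivlMr ?one_sqr_gt0// mulrC ler_pdivrMr ?expR_gt0//.
set y := `|x|; have y0 : 0 <= y by exact: normr_ge0.
have -> : x ^+ 2 = y ^+ 2 by rewrite /y real_normK// num_real.
have C1 : 1 <= C by rewrite le_max lexx.
have C2 : 4 <= C * eta ^+ 2 by rewrite -ler_pdivrMr ?exprn_gt0// le_max lexx orbT.
have he : expR (eta * y) = expR (eta * y / 2) ^+ 2.
  by rewrite -expRM_natl; congr expR; field.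
have h1 : 1 + eta * y / 2 <= expR (eta * y / 2) by exact: expR_ge1Dx.
have ey : 0 <= eta * y / 2 by rewrite divr_ge0// mulr_ge0// ltW.
have h2 : (1 + eta * y / 2) ^+ 2 <= expR (eta * y).
  by rewrite he ler_sqr ?nnegrE ?expR_ge0// addr_ge0.
apply: (@le_trans _ _ (C * (1 + eta * y / 2) ^+ 2)).
  2: by rewrite ler_wpM2l// (le_trans _ C1).
have -> : C * (1 + eta * y / 2) ^+ 2 = C + 2 * C * (eta * y / 2) + (C * eta ^+ 2) * y ^+ 2 / 4 by field.
have hy : 4 * y ^+ 2 <= C * eta ^+ 2 * y ^+ 2 by rewrite ler_wpM2r ?sqr_ge0.
have : 0 <= 2 * C * (eta * y / 2) by rewrite mulr_ge0// mulr_ge0// (le_trans _ C1).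
lra.
Qed.

(** The primitive of the damped cosine that tends to 0 at infinity, so that the integral over the
    half-line is minus its value at 0. *)
Definition laplace_primitive (eta u t : R) : R :=
  expR (- eta * t) * (u * sin (u * t) - eta * cos (u * t)) / (eta ^+ 2 + u ^+ 2).

Lemma is_derive_laplace_prim (eta u x : R) : 0 < eta ->
  is_derive x (1 : R) (laplace_primitive eta u) (expR (- eta * x) * cos (u * x)).
Proof.
move=> eta0; rewrite /laplace_primitive; apply: is_derive_eq.
have h : eta ^+ 2 + u ^+ 2 != 0 by rewrite gt_eqF// ltr_pwDl ?sqr_ge0// exprn_gt0.
rewrite /GRing.scale /=; field.
done.
Qed.

Lemma continuous_expM_cos (eta u : R) : continuous (fun t : R => expR (eta * t) * cos (u * t)).
Proof.
move=> x; apply: cvgM.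
  apply: (@cvg_comp _ _ _ (fun t : R => eta * t) expR _ (nbhs (eta * x))); last exact: continuous_expR.
  by apply: cvgM; [exact: cvg_cst|exact: cvg_id].
apply: (@cvg_comp _ _ _ (fun t : R => u * t) cos _ (nbhs (u * x))); last exact: continuous_cos.
by apply: cvgM; [exact: cvg_cst|exact: cvg_id].
Qed.

Lemma continuous_cosM (u : R) : continuous (fun t : R => cos (u * t)).
Proof.
move=> x; apply: (@cvg_comp _ _ _ (fun t : R => u * t) cos _ (nbhs (u * x))); last exact: continuous_cos.
by apply: cvgM; [exact: cvg_cst|exact: cvg_id].
Qed.

Lemma continuous_sinM (u : R) : continuous (fun t : R => sin (u * t)).
Proof.
move=> x; apply: (@cvg_comp _ _ _ (fun t : R => u * t) sin _ (nbhs (u * x))); last exact: continuous_sin.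
by apply: cvgM; [exact: cvg_cst|exact: cvg_id].
Qed.

Lemma norm_cos_le1 (x : R) : `|cos x| <= 1.
Proof. by rewrite ler_norml cos_geN1 cos_le1. Qed.

Lemma norm_sin_le1 (x : R) : `|sin x| <= 1.
Proof. by rewrite ler_norml sin_geN1 sin_le1. Qed.

Lemma integrableT_exp_abs_cos (eta u : R) : 0 < eta ->
  integrableT (fun t : R => expR (- (eta * `|t|)) * cos (u * t)).
Proof.
move=> eta0; apply: (integrableT_le (integrableT_exp_abs eta0)).
  apply: measurable_funM; first exact: (integrableT_measurable (integrableT_exp_abs eta0)).
  by apply: continuous_measurableT; exact: continuous_cosM.
move=> x; rewrite normrM ger0_norm ?expR_ge0// ler_piMr ?expR_ge0//.
exact: norm_cos_le1.
Qed.

Lemma cvg_laplace_prim (eta u : R) : 0 < eta -> laplace_primitive eta u n%:R @[n --> \oo] --> (0 : R).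
Proof.
move=> eta0; have h : 0 < eta ^+ 2 + u ^+ 2 by rewrite ltr_pwDl ?sqr_ge0// exprn_gt0.
set C := (`|u| + eta) / (eta ^+ 2 + u ^+ 2).
have en : (expR (- eta * n%:R) * C) @[n --> \oo] --> (0 : R).
  rewrite -[X in _ --> X](mul0r C); apply: cvgM; last exact: cvg_cst.
  have -> : (fun n : nat => expR (- eta * n%:R)) = (fun n => expR (- eta) ^+ n).
    by apply/funext => n; rewrite expRM_natr.
  by apply: cvg_expr; rewrite ger0_norm ?expR_ge0// expR_lt1 oppr_lt0.
apply/norm_cvg0P; apply: (@squeeze_cvgr _ _ _ _ (fun=> 0) (fun n : nat => expR (- eta * n%:R) * C)) => //; last exact: cvg_cst.
apply: nearW => n; rewrite normr_ge0/= /laplace_primitive /C normrM normfV (gtr0_norm h) mulrA.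
rewrite ler_wpM2r ?invr_ge0 ?(ltW h)// normrM ger0_norm ?expR_ge0//.
rewrite ler_wpM2l ?expR_ge0// (le_trans (ler_normB _ _))// !normrM (gtr0_norm eta0).
rewrite lerD// ler_piMr ?(ltW eta0)//; [exact: norm_sin_le1|exact: norm_cos_le1].
Qed.

(** The Fourier transform of the two-sided exponential is twice a Poisson kernel; this makes the
    exponential a usable damping factor in Fourier inversion. *)
Lemma Rintegral_exp_abs_cos (eta u : R) : 0 < eta ->
  \int[mu]_t (expR (- (eta * `|t|)) * cos (u * t)) = 2 * (eta / (eta ^+ 2 + u ^+ 2)).
Proof.
move=> eta0; have ie := integrableT_exp_abs_cos u eta0.
rewrite -(cvg_lim _ (integrableT_itv_cvg ie))//; apply/cvg_lim => //.
have h : eta ^+ 2 + u ^+ 2 != 0 by rewrite gt_eqF// ltr_pwDl ?sqr_ge0// exprn_gt0.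
have -> : (fun n : nat => (\int[mu]_(x in `[(- n%:R), n%:R]) (expR (- (eta * `|x|)) * cos (u * x)))%R)
  = (fun n : nat => 2 * (laplace_primitive eta u n%:R - laplace_primitive eta u 0)).
  apply/funext => n.
  have n0 : 0 <= n%:R :> R by [].
  have Nn0 : - n%:R <= 0 :> R by rewrite oppr_le0.
  have isub (D : set R) : measurable D -> mu.-integrable D (EFin \o (fun x => expR (- (eta * `|x|)) * cos (u * x))).
    by move=> mD; apply: integrableS ie.
  have := @Rintegral_itvB R (fun x => expR (- (eta * `|x|)) * cos (u * x)) (BLeft (- n%:R)) (BRight n%:R) 0 (isub _ (measurable_itv _)).
  rewrite !bnd_simp => /(_ Nn0 n0) /eqP; rewrite subr_eq => /eqP ->.
  rewrite Rintegral_itv_obnd_cbnd; last exact: isub.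
  rewrite (@eq_Rintegral _ _ _ mu `[0, n%:R] (fun x => expR (- eta * x) * cos (u * x))); last first.
    by move=> x; rewrite inE/= in_itv/= => /andP[x0 _]; rewrite ger0_norm// mulNr.
  rewrite (@eq_Rintegral _ _ _ mu `[(- n%:R), 0] (fun x => expR (eta * x) * cos (u * x))); last first.
    by move=> x; rewrite inE/= in_itv/= => /andP[_ x0]; rewrite ler0_norm// mulrN opprK.
  rewrite (Rintegral_FTC n0 (fun x => is_derive_laplace_prim u x eta0)); last first.
    exact: continuous_expM_cos.
  have d2 (x : R) : is_derive x (1:R) (fun x => - laplace_primitive eta u (- x)) (expR (eta * x) * cos (u * x)).
    have H := is_derive_laplace_prim u (- x) eta0.
    apply: is_derive_eq.
    by rewrite /GRing.scale/= !mulrN !mulNr cosN !opprK mulr1.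
  rewrite (Rintegral_FTC Nn0 d2); last exact: continuous_expM_cos.
  rewrite !opprK oppr0; ring.
have -> : 2 * (eta / (eta ^+ 2 + u ^+ 2)) = 2 * (0 - laplace_primitive eta u 0).
  rewrite /laplace_primitive !mulr0 expR0 sin0 cos0 mulr0 mulr1 mul1r; field; exact: h.
apply: cvgM; first exact: cvg_cst.
apply: cvgB; [exact: cvg_laplace_prim|exact: cvg_cst].
Qed.

Lemma Rintegral_shift_ge0 (g : R -> R) (a : R) : continuous g -> (forall x, 0 <= g x) ->
  (\int[mu]_x (g (x + a))%:E = \int[mu]_x (g x)%:E)%E.
Proof.
move=> cg g0.
have dF (x : R) : is_derive x (1:R) (fun x : R => x + a) 1.
  by apply: is_derive_eq; rewrite addr0.
have F' : derive1 (fun x : R => x + a) = cst 1.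
  by apply/funext => x; rewrite derive1E derive_val.
rewrite (@increasing_ge0_integration_by_substitutionT _ (fun x => x + a) g)//.
- apply: eq_integral => x _; rewrite F' /= fctE /=; congr EFin.
  by rewrite mulr1.
- by move=> x y; rewrite ltrD2r.
- by rewrite F'; exact: cst_continuous.
- by rewrite F'; exact: is_cvg_cst.
- by rewrite F'; exact: is_cvg_cst.
- apply/cvgrNyPle => A; near=> x; rewrite -lerBrDr; near: x; apply: nbhs_ninfty_le; exact: num_real.
- apply/cvgryPge => A; near=> x; rewrite -lerBlDr; near: x; apply: nbhs_pinfty_ge; exact: num_real.
Unshelve. all: by end_near. Qed.

Lemma continuous_comp_shift (g : R -> R) (a : R) : continuous g -> continuous (fun x => g (x + a)).
Proof.
move=> cg x; apply: (@cvg_comp _ _ _ (fun x : R => x + a) g _ (nbhs (x + a))); last exact: cg.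
by apply: cvgD; [exact: cvg_id|exact: cvg_cst].
Qed.

Lemma continuous_norm (g : R -> R) : continuous g -> continuous (fun x => `|g x|).
Proof. by move=> cg x; apply: cvg_norm; exact: cg. Qed.

Lemma integrableT_shift (g : R -> R) (a : R) : continuous g -> integrableT g ->
  integrableT (fun x => g (x + a)).
Proof.
move=> cg ig; apply/integrableP; split.
  by apply/measurable_EFinP; apply: continuous_measurableT; exact: continuous_comp_shift.
rewrite (Rintegral_shift_ge0 (g := fun x => `|g x|))//; last exact: continuous_norm.
by case/integrableP : ig.
Qed.

(** The change of variables is available for continuous nonnegative functions; the splitting g = (g
    + |g|) - |g| extends it to signed ones. *)
Lemma Rintegral_shift (g : R -> R) (a : R) : continuous g -> integrableT g ->
  \int[mu]_x (g (x + a)) = \int[mu]_x (g x).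
Proof.
move=> cg ig.
have H (h : R -> R) : continuous h -> (forall x, 0 <= h x) ->
   \int[mu]_x (h (x + a)) = \int[mu]_x (h x).
  by move=> ch h0; rewrite /Rintegral Rintegral_shift_ge0.
have ign := integrableT_norm ig.
have e (h : R -> R) : integrableT h -> \int[mu]_x (h x) = \int[mu]_x (h x + `|h x|) - \int[mu]_x `|h x|.
  by move=> ih; rewrite RintegralD ?addrK//; exact: integrableT_norm.
rewrite e; last exact: integrableT_shift.
rewrite (e g)// (H (fun x => g x + `|g x|)) ?(H (fun x => `|g x|))//.
- exact: continuous_norm.
- by move=> x; apply: cvgD; [exact: cg|apply: cvg_norm; exact: cg].
- by move=> x; rewrite -lerBlDl sub0r -normrN ler_norm.
Qed.

Lemma derive1_expR : derive1 (@expR R) = expR.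
Proof. by apply/funext => y; rewrite derive1E derive_val. Qed.

(** On [e^-n, e^n] this is the substitution rule for an increasing function; integrability of the
    transformed function gives the limit, and the intervals exhaust the half-line. *)
Lemma integral_expR_subst_ge0 (g : R -> R) : {in `]0, +oo[, continuous g} -> (forall x, 0 <= g x) ->
  integrableT (fun x => g (expR x) * expR x) ->
  (\int[mu]_(x in `]0%R, +oo[) (g x)%:E = \int[mu]_x (g (expR x) * expR x)%:E)%E.
Proof.
move=> cg g0 ig.
have mg : measurable_fun (`]0, +oo[%classic : set R) g.
  by apply: open_continuous_measurable_fun => //; move=> x; rewrite inE; exact: cg.
have -> : (\int[mu]_x (g (expR x) * expR x)%:E = (\int[mu]_x (g (expR x) * expR x))%R%:E)%E.
  by rewrite /Rintegral fineK//; exact: integrable_fin_num.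
pose D (n : nat) : set R := [set` `[expR (- n%:R), expR n%:R] ].
apply: (@nonneg_integrable_cvg_itv g D (`]0, +oo[%classic : set R)) => //.
- by move=> n; exact: measurable_itv.
- move=> n x/=; rewrite /D/= !in_itv/= => /andP[h1 h2]; apply/andP; split.
    by apply: le_trans h1; rewrite ler_expR lerN2 ler_nat.
  by apply: (le_trans h2); rewrite ler_expR ler_nat.
- by move=> n x/=; rewrite /D/= !in_itv/= => /andP[h1 h2]; rewrite andbT (lt_le_trans _ h1)// expR_gt0.
- move=> x/=; rewrite in_itv/= andbT => x0.
  exists (Num.truncn `|ln x|).+1 => //=; rewrite /D/= in_itv/=.
  have hx : `|ln x| <= (Num.truncn `|ln x|).+1%:R by rewrite ltW// truncnS_gt.
  have e : x = expR (ln x) by rewrite lnK ?posrE.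
  move: hx; set K := (_.+1)%:R => hx.
  have : expR (- K) <= expR (ln x) <= expR K by rewrite !ler_expR -ler_norml.
  by rewrite -e.
- have -> : (fun n => \int[mu]_(x in `[(expR (- n%:R))%R, (expR n%:R)%R]) (g x)%:E)%E =
    (EFin \o (fun n => (\int[mu]_(x in `[(- n%:R), n%:R]) (g (expR x) * expR x))%R)).
    apply/funext => n /=.
    rewrite (@integration_by_substitution_increasing _ expR g)//.
    + rewrite /Rintegral fineK.
        by apply: eq_integral => x _; rewrite derive1_expR.
      by apply: integrable_fin_num => //; apply: integrableS ig.
    + by rewrite (@le_trans _ _ 0)// oppr_le0.
    + by move=> x y _ _; rewrite ltr_expR.
    + by move=> x _; rewrite derive1_expR; exact: continuous_expR.
    + rewrite derive1_expR.
      by apply/cvg_ex; exists (expR (- n%:R)); apply: cvg_at_right_filter; exact: continuous_expR.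
    + rewrite derive1_expR.
      by apply/cvg_ex; exists (expR (n%:R)); apply: cvg_at_left_filter; exact: continuous_expR.
    + split; first by move=> x _; exact: derivable_expR.
        by apply: cvg_at_right_filter; exact: continuous_expR.
      by apply: cvg_at_left_filter; exact: continuous_expR.
    + apply: continuous_in_subspaceT => x; rewrite inE/= in_itv/= => /andP[h1 h2]; apply: cg.
      by rewrite in_itv/= andbT (lt_le_trans _ h1)// expR_gt0.
  apply: cvg_EFin; first exact: nearW.
  exact: integrableT_itv_cvg.
Qed.

(** Signed version, by the same splitting as in [Rintegral_shift]. Integrability on the half-line is
    deduced, not assumed: it is read off the substituted function. *)
Lemma Rintegral_expR_subst (g : R -> R) : {in `]0, +oo[, continuous g} ->
  integrableT (fun x => g (expR x) * expR x) ->
  mu.-integrable `]0, +oo[ (EFin \o g) /\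
  \int[mu]_(x in `]0, +oo[) g x = \int[mu]_x (g (expR x) * expR x).
Proof.
move=> cg ig.
have cn : {in `]0, +oo[, continuous (fun x => `|g x|)} by move=> x x0; apply: cvg_norm; exact: cg.
have cp : {in `]0, +oo[, continuous (fun x => g x + `|g x|)}.
  by move=> x x0; apply: cvgD; [exact: cg|exact: cn].
have ign : integrableT (fun x => `|g (expR x)| * expR x).
  have := integrableT_norm ig; rewrite /integrableT.
  by under eq_fun do rewrite normrM (ger0_norm (expR_ge0 _)).
have igp : integrableT (fun x => (g (expR x) + `|g (expR x)|) * expR x).
  by have := integrableT_add ig ign; rewrite /integrableT; under eq_fun do rewrite -mulrDl.
have mg : measurable_fun (`]0, +oo[%classic : set R) g.
  by apply: open_continuous_measurable_fun => //; move=> x; rewrite inE; exact: cg.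
have i0 : mu.-integrable `]0, +oo[ (EFin \o g).
  apply/integrableP; split; first exact/measurable_EFinP.
  rewrite (integral_expR_subst_ge0 cn)//.
  rewrite -ge0_fin_numE; first exact: integrable_fin_num.
  by apply: integral_ge0 => x _; rewrite lee_fin mulr_ge0 ?expR_ge0.
split => //.
have e : \int[mu]_(x in `]0, +oo[) g x = \int[mu]_(x in `]0, +oo[) (g x + `|g x|) - \int[mu]_(x in `]0, +oo[) `|g x|.
  by rewrite RintegralD ?addrK//; exact: integrable_norm.
rewrite e {1 2}/Rintegral (integral_expR_subst_ge0 cp)//; last first.
  by move=> x; rewrite -lerBlDl sub0r -normrN ler_norm.
rewrite (integral_expR_subst_ge0 cn)// -!/(Rintegral _ _ _) -RintegralB//.
by apply: eq_Rintegral => x _; rewrite mulrDl addrK.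
Qed.

End ExpKernel.

(** * Complex-valued sequences and integrals *)

Section ComplexBasics.
Context {R : realType}.
Notation mu := (@lebesgue_measure R).
Notation Re := (@complex.Re R).
Notation Im := (@complex.Im R).
Notation cintegral := (@cintegral R).
Implicit Types (z w s : R[i]) (D : set (measurableTypeR R)).

(** The norm of [R[i]] takes its values in [R[i]]; a real-valued modulus can be integrated, squeezed
    and compared with real majorants. *)
Definition cabs z : R := Num.sqrt (Re z ^+ 2 + Im z ^+ 2).

Lemma normC_cabs z : `|z| = (cabs z)%:C.
Proof. by rewrite normc_def. Qed.

Lemma cabs_ge0 z : 0 <= cabs z.
Proof. exact: sqrtr_ge0. Qed.

Lemma cabsM z w : cabs (z * w) = cabs z * cabs w.
Proof. by apply: (@complexI R); rewrite -normC_cabs normrM !normC_cabs rmorphM. Qed.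

Lemma cabsD z w : cabs (z + w) <= cabs z + cabs w.
Proof. by rewrite -lecR rmorphD /= -!normC_cabs ler_normD. Qed.

Lemma cabsN z : cabs (- z) = cabs z.
Proof. by apply: (@complexI R); rewrite -!normC_cabs normrN. Qed.

Lemma cabs_sub z w : cabs (z - w) = cabs (w - z).
Proof. by rewrite -cabsN opprB. Qed.

Lemma cabs_real (x : R) : cabs x%:C = `|x|.
Proof. by rewrite /cabs /= expr0n /= addr0 sqrtr_sqr. Qed.

Lemma cabs0 : cabs 0 = 0.
Proof. by rewrite -[0]/(0%:C) cabs_real normr0. Qed.

Lemma cabs1 : cabs 1 = 1.
Proof. by rewrite -[1]/(1%:C) cabs_real normr1. Qed.

Lemma cabs_eq0 z : cabs z = 0 -> z = 0.
Proof. by move=> h; apply/eqP; rewrite -normr_eq0 normC_cabs h. Qed.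

Lemma cabs_Re z : `|Re z| <= cabs z.
Proof. by rewrite -sqrtr_sqr ler_wsqrtr// lerDl sqr_ge0. Qed.

Lemma cabs_Im z : `|Im z| <= cabs z.
Proof. by rewrite -sqrtr_sqr ler_wsqrtr// lerDr sqr_ge0. Qed.

Lemma cabs_le_ReIm z : cabs z <= `|Re z| + `|Im z|.
Proof.
rewrite -[leRHS]ger0_norm ?addr_ge0// -sqrtr_sqr ler_wsqrtr//.
rewrite sqrrD !real_normK ?num_real// lerD2r lerDl.
by rewrite mulrn_wge0// mulr_ge0.
Qed.

Lemma cabs_sum (I : Type) (r : seq I) (F : I -> R[i]) :
  cabs (\sum_(i <- r) F i) <= \sum_(i <- r) cabs (F i).
Proof.
elim/big_ind2 : _ => //; first by rewrite cabs0.
by move=> x1 x2 y1 y2 h1 h2; rewrite (le_trans (cabsD _ _))// lerD.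
Qed.

Lemma cabs_prod (I : Type) (r : seq I) (F : I -> R[i]) :
  cabs (\prod_(i <- r) F i) = \prod_(i <- r) cabs (F i).
Proof. by elim/big_ind2 : _ => [|x1 x2 y1 y2 <- <-|//]; rewrite ?cabs1 ?cabsM. Qed.

Lemma cReD z w : Re (z + w) = Re z + Re w. Proof. by case: z; case: w. Qed.
Lemma cImD z w : Im (z + w) = Im z + Im w. Proof. by case: z; case: w. Qed.
Lemma cReN z : Re (- z) = - Re z. Proof. by case: z. Qed.
Lemma cImN z : Im (- z) = - Im z. Proof. by case: z. Qed.
Lemma cReB z w : Re (z - w) = Re z - Re w. Proof. by rewrite cReD cReN. Qed.
Lemma cImB z w : Im (z - w) = Im z - Im w. Proof. by rewrite cImD cImN. Qed.
Lemma cReM z w : Re (z * w) = Re z * Re w - Im z * Im w. Proof. by case: z; case: w. Qed.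
Lemma cImM z w : Im (z * w) = Re z * Im w + Im z * Re w.
Proof. by case: z; case: w => a b c d /=; rewrite addrC. Qed.
Lemma cRe_nat (n : nat) : Re n%:R = n%:R.
Proof. by rewrite -(rmorph_nat (real_complex R)). Qed.
Lemma cIm_nat (n : nat) : Im n%:R = 0.
Proof. by rewrite -(rmorph_nat (real_complex R)). Qed.
Lemma complexP z w : Re z = Re w -> Im z = Im w -> z = w.
Proof. by case: z; case: w => a b c d /= -> ->. Qed.

Fact cexp_key : unit. Proof. by []. Qed.

(** Locked, so that simplification and unification do not break exponentials into real and imaginary
    parts. *)
Definition cexp z : R[i] :=
  locked_with cexp_key ((expR (Re z))%:C * (cos (Im z) +i* sin (Im z))).

Lemma cexpE z : cexp z = (expR (Re z))%:C * (cos (Im z) +i* sin (Im z)).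
Proof. by rewrite /cexp locked_withE. Qed.

Lemma Re_cexp z : Re (cexp z) = expR (Re z) * cos (Im z).
Proof. by rewrite cexpE cReM /= mul0r subr0. Qed.

Lemma Im_cexp z : Im (cexp z) = expR (Re z) * sin (Im z).
Proof. by rewrite cexpE cImM /= mul0r addr0. Qed.

Lemma cexpD z w : cexp (z + w) = cexp z * cexp w.
Proof.
apply: complexP.
  by rewrite Re_cexp cReD cImD cReM !Re_cexp !Im_cexp expRD cosD; ring.
by rewrite Im_cexp cReD cImD cImM !Re_cexp !Im_cexp expRD sinD; ring.
Qed.

Lemma cexp_real (x : R) : cexp x%:C = (expR x)%:C.
Proof. by apply: complexP; rewrite ?Re_cexp ?Im_cexp /= ?cos0 ?sin0 ?mulr1 ?mulr0. Qed.

Lemma cexp0 : cexp 0 = 1.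
Proof. by rewrite -[0]/(0%:C) cexp_real expR0. Qed.

Lemma cabs_cexp z : cabs (cexp z) = expR (Re z).
Proof.
rewrite cexpE cabsM cabs_real ger0_norm ?expR_ge0// /cabs /=.
by rewrite cos2Dsin2 sqrtr1 mulr1.
Qed.

Lemma cexp_neq0 z : cexp z != 0.
Proof.
apply/eqP => h; have := expR_gt0 (Re z).
by rewrite -cabs_cexp h cabs0 ltxx.
Qed.

Lemma cexpN z : cexp (- z) = (cexp z)^-1.
Proof.
apply: (mulfI (cexp_neq0 z)); rewrite -cexpD subrr cexp0 mulfV//; exact: cexp_neq0.
Qed.

Lemma cpowE (t : R) s : 0 < t -> cpow t s = cexp (s * (ln t)%:C).
Proof.
move=> t0; rewrite /cpow /powR gt_eqF// cexpE.
by rewrite cReM cImM /= !mulr0 subr0 add0r.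
Qed.

(** Expressed through a real null sequence, so that real squeeze arguments apply directly. *)
Definition ccvg (u : nat -> R[i]) (l : R[i]) := cabs (u n - l) @[n --> \oo] --> (0 : R).

Lemma ccvg_le (u : nat -> R[i]) l (v : nat -> R) : v @ \oo --> (0 : R) ->
  (\forall n \near \oo, cabs (u n - l) <= v n) -> ccvg u l.
Proof.
move=> v0 h; apply: (@squeeze_cvgr _ _ _ _ (fun=> 0) v) => //; last exact: cvg_cst.
by near=> n; rewrite cabs_ge0/=; near: n.
Unshelve. all: by end_near. Qed.

Lemma ccvg_cst l : ccvg (fun=> l) l.
Proof. by rewrite /ccvg; under eq_fun do rewrite subrr cabs0; exact: cvg_cst. Qed.

Lemma ccvgD u v l m : ccvg u l -> ccvg v m -> ccvg (fun n => u n + v n) (l + m).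
Proof.
move=> hu hv; apply: (ccvg_le (v := fun n => cabs (u n - l) + cabs (v n - m))).
  by rewrite -[0](addr0 0); exact: cvgD.
by apply: nearW => n; rewrite opprD addrACA cabsD.
Qed.

Lemma ccvg_bounded u l : ccvg u l -> exists M : R, 0 <= M /\ forall n, cabs (u n) <= M.
Proof.
move=> h; have /cvg_seq_bounded[M [_ HM]] : cvgn (fun n => cabs (u n - l)) by apply/cvg_ex; exists 0.
exists (`|M| + 1 + cabs l); split; first by rewrite !addr_ge0// cabs_ge0.
move=> n; rewrite -[u n](subrK l) (le_trans (cabsD _ _))// lerD2r.
have := HM (`|M| + 1); rewrite (le_lt_trans (ler_norm M)) ?ltrDl// => /(_ isT n I).
by rewrite /= ger0_norm// cabs_ge0.
Qed.

Lemma ccvgM u v l m : ccvg u l -> ccvg v m -> ccvg (fun n => u n * v n) (l * m).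
Proof.
move=> hu hv; have [M [M0 HM]] := ccvg_bounded hv.
apply: (ccvg_le (v := fun n => cabs (u n - l) * M + cabs l * cabs (v n - m))).
  rewrite -[0](addr0 0); apply: cvgD.
    by rewrite -[X in _ --> X](mul0r M); apply: cvgM => //; exact: cvg_cst.
  by rewrite -[X in _ --> X](mulr0 (cabs l)); apply: cvgM => //; exact: cvg_cst.
apply: nearW => n.
have -> : u n * v n - l * m = (u n - l) * v n + l * (v n - m) by ring.
by rewrite (le_trans (cabsD _ _))// !cabsM lerD2r ler_wpM2l// cabs_ge0.
Qed.

Lemma ccvg_unique u l m : ccvg u l -> ccvg u m -> l = m.
Proof.
move=> hu hv; apply/eqP; rewrite -subr_eq0; apply/eqP/cabs_eq0/eqP.
rewrite eq_le cabs_ge0 andbT.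
have h : (cabs (u n - l) + cabs (u n - m)) @[n --> \oo] --> (0 : R).
  by rewrite -[0](addr0 0); exact: cvgD.
rewrite -(cvg_lim _ h)//; apply: limr_ge; first by apply/cvg_ex; exists 0.
by apply: nearW => n; rewrite (cabs_sub _ l) (_ : l - m = l - u n + (u n - m)) ?cabsD//; ring.
Qed.

Lemma ccvg_Re u l : ccvg u l -> Re (u n) @[n --> \oo] --> Re l.
Proof.
move=> h; apply/subr_cvg0/norm_cvg0P.
apply: (@squeeze_cvgr _ _ _ _ (fun=> 0) (fun n => cabs (u n - l))) => //; last exact: cvg_cst.
by apply: nearW => n; rewrite normr_ge0/= -cReB cabs_Re.
Qed.

Lemma ccvg_Im u l : ccvg u l -> Im (u n) @[n --> \oo] --> Im l.
Proof.
move=> h; apply/subr_cvg0/norm_cvg0P.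
apply: (@squeeze_cvgr _ _ _ _ (fun=> 0) (fun n => cabs (u n - l))) => //; last exact: cvg_cst.
by apply: nearW => n; rewrite normr_ge0/= -cImB cabs_Im.
Qed.

Lemma ccvg_ext u v l : (forall n, u n = v n) -> ccvg u l -> ccvg v l.
Proof. by move=> /funext ->. Qed.

Lemma ccvg_shift u l (k : nat) : ccvg (fun n => u (n + k)%N) l -> ccvg u l.
Proof. by move=> h; rewrite /ccvg -(@cvg_shiftn k); exact: h. Qed.

Lemma ccvg_shift' u l (k : nat) : ccvg u l -> ccvg (fun n => u (n + k)%N) l.
Proof. by move=> h; rewrite /ccvg (@cvg_shiftn k _ (fun n => cabs (u n - l))); exact: h. Qed.

End ComplexBasics.

(** * Measurability of complex-valued functions *)

Section ComplexMeasurable.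
Context {R : realType} d (T : measurableType d).
Notation Re := (@complex.Re R).
Notation Im := (@complex.Im R).
Implicit Types (D : set T) (f g : T -> R[i]).

Definition cmeasurable (D : set T) (f : T -> R[i]) :=
  measurable_fun D (fun x => Re (f x)) /\ measurable_fun D (fun x => Im (f x)).

Lemma cmeasurable_cst D z : cmeasurable D (fun=> z).
Proof. by split; exact: measurable_cst. Qed.

Lemma cmeasurableD D f g : cmeasurable D f -> cmeasurable D g -> cmeasurable D (fun x => f x + g x).
Proof.
move=> [f1 f2] [g1 g2]; split.
  by under eq_fun do rewrite cReD; exact: measurable_funD.
by under eq_fun do rewrite cImD; exact: measurable_funD.
Qed.

Lemma cmeasurableM D f g : cmeasurable D f -> cmeasurable D g -> cmeasurable D (fun x => f x * g x).
Proof.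
move=> [f1 f2] [g1 g2]; split.
  by under eq_fun do rewrite cReM; apply: measurable_funB; exact: measurable_funM.
by under eq_fun do rewrite cImM; apply: measurable_funD; exact: measurable_funM.
Qed.

Lemma cmeasurable_prod D (I : Type) (r : seq I) (F : I -> T -> R[i]) :
  (forall i, cmeasurable D (F i)) -> cmeasurable D (fun x => \prod_(i <- r) F i x).
Proof.
move=> h; elim: r => [|i r ih].
  by under eq_fun do rewrite big_nil; exact: cmeasurable_cst.
by under eq_fun do rewrite big_cons; exact: cmeasurableM.
Qed.

Lemma cmeasurable_sum D (I : Type) (r : seq I) (F : I -> T -> R[i]) :
  (forall i, cmeasurable D (F i)) -> cmeasurable D (fun x => \sum_(i <- r) F i x).
Proof.
move=> h; elim: r => [|i r ih].
  by under eq_fun do rewrite big_nil; exact: cmeasurable_cst.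
by under eq_fun do rewrite big_cons; exact: cmeasurableD.
Qed.

Lemma cmeasurable_cexp D f : cmeasurable D f -> cmeasurable D (fun x => cexp (f x)).
Proof.
move=> [f1 f2]; split.
  under eq_fun do rewrite Re_cexp; apply: measurable_funM.
    by apply: (measurableT_comp (f := expR)) => //; apply: continuous_measurableT; exact: continuous_expR.
  by apply: (measurableT_comp (f := cos)) => //; apply: continuous_measurableT; exact: continuous_cos.
under eq_fun do rewrite Im_cexp; apply: measurable_funM.
  by apply: (measurableT_comp (f := expR)) => //; apply: continuous_measurableT; exact: continuous_expR.
by apply: (measurableT_comp (f := sin)) => //; apply: continuous_measurableT; exact: continuous_sin.
Qed.

Lemma cmeasurable_abs D f : cmeasurable D f -> measurable_fun D (fun x => cabs (f x)).
Proof.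
move=> [f1 f2]; apply: (measurableT_comp (f := @Num.sqrt R)).
  by apply: continuous_measurableT; exact: sqrt_continuous.
by apply: measurable_funD; apply: measurable_funX.
Qed.

Lemma cmeasurable_real D (f : T -> R) : measurable_fun D f -> cmeasurable D (fun x => (f x)%:C).
Proof. by move=> h; split => //=; exact: measurable_cst. Qed.

Lemma cmeasurable_lim D (f : nat -> T -> R[i]) (g : T -> R[i]) : measurable D ->
  (forall n, cmeasurable D (f n)) -> (forall x, D x -> ccvg (fun n => f n x) (g x)) ->
  cmeasurable D g.
Proof.
move=> mD mf h; split.
  apply: (measurable_fun_cvg (fun n => (mf n).1)) => // x Dx; exact: ccvg_Re (h x Dx).
apply: (measurable_fun_cvg (fun n => (mf n).2)) => // x Dx; exact: ccvg_Im (h x Dx).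
Qed.

End ComplexMeasurable.

(** * Integration of complex-valued functions *)

Section ComplexIntegral.
Context {R : realType}.
Notation mu := (@lebesgue_measure R).
Notation Re := (@complex.Re R).
Notation Im := (@complex.Im R).
Notation cintegral := (@cintegral R).
Implicit Types (z w s : R[i]) (D : set (measurableTypeR R)) (f g : R -> R[i]).

Definition cintegrable (D : set (measurableTypeR R)) (f : R -> R[i]) :=
  mu.-integrable D (EFin \o (fun x => Re (f x))) /\
  mu.-integrable D (EFin \o (fun x => Im (f x))).

Lemma cintegrable_measurable D f : cintegrable D f -> cmeasurable D f.
Proof. by move=> [/measurable_int/measurable_EFinP ? /measurable_int/measurable_EFinP ?]. Qed.

Lemma cintegrable_le D f (g : R -> R) : measurable D -> cmeasurable D f ->
  mu.-integrable D (EFin \o g) -> (forall x, D x -> cabs (f x) <= g x) -> cintegrable D f.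
Proof.
move=> mD [f1 f2] ig fg; split.
  apply: (le_integrable mD _ _ ig); first exact/measurable_EFinP.
  by move=> x Dx /=; rewrite lee_fin (le_trans (cabs_Re _))// (le_trans (fg x Dx))// ler_norm.
apply: (le_integrable mD _ _ ig); first exact/measurable_EFinP.
by move=> x Dx /=; rewrite lee_fin (le_trans (cabs_Im _))// (le_trans (fg x Dx))// ler_norm.
Qed.

Lemma cintegrable_abs D f : measurable D -> cintegrable D f ->
  mu.-integrable D (EFin \o (fun x => cabs (f x))).
Proof.
move=> mD [f1 f2].
have := @integrableD _ _ _ mu D mD _ _ (integrable_norm f1) (integrable_norm f2).
move=> ig; apply: (le_integrable mD _ _ ig).
  apply/measurable_EFinP; apply: cmeasurable_abs; exact: cintegrable_measurable.
move=> x Dx /=; rewrite lee_fin (ger0_norm (cabs_ge0 _)) (le_trans (cabs_le_ReIm _))//.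
by rewrite ler_norm.
Qed.

Lemma Re_cintegral D f : Re (cintegral D f) = \int[mu]_(x in D) Re (f x).
Proof. by []. Qed.

Lemma Im_cintegral D f : Im (cintegral D f) = \int[mu]_(x in D) Im (f x).
Proof. by []. Qed.

Lemma eq_cintegral D f g : (forall x, D x -> f x = g x) -> cintegral D f = cintegral D g.
Proof.
move=> fg; rewrite /cintegral; congr (_ +i* _); apply: eq_Rintegral => x; rewrite inE => Dx;
  by rewrite fg.
Qed.

Lemma eq_cintegrable D f g : (forall x, f x = g x) -> cintegrable D f -> cintegrable D g.
Proof. by move=> /funext ->. Qed.

(** The factor 2 comes from bounding the real and imaginary parts separately. It is harmless: in
    [scaled_Q_approx] the factor 1 / (2 pi) absorbs it, elsewhere it enters a constant. *)
Lemma cabs_cintegral D f (g : R -> R) : measurable D -> cintegrable D f ->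
  mu.-integrable D (EFin \o g) -> (forall x, D x -> cabs (f x) <= g x) ->
  cabs (cintegral D f) <= 2 * \int[mu]_(x in D) g x.
Proof.
move=> mD [f1 f2] ig fg; rewrite (le_trans (cabs_le_ReIm _))//.
rewrite mulr_natl mulr2n lerD//=.
  rewrite (le_trans (le_normr_Rintegral mD f1))// le_Rintegral//; first exact: integrable_norm.
  by move=> x Dx; rewrite (le_trans (cabs_Re _))// fg.
rewrite (le_trans (le_normr_Rintegral mD f2))// le_Rintegral//; first exact: integrable_norm.
by move=> x Dx; rewrite (le_trans (cabs_Im _))// fg.
Qed.

Lemma cintegrableD D f g : measurable D -> cintegrable D f -> cintegrable D g ->
  cintegrable D (fun x => f x + g x).
Proof.
move=> mD [f1 f2] [g1 g2]; split.
  by under eq_fun do rewrite cReD; exact: (integrableD mD f1 g1).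
by under eq_fun do rewrite cImD; exact: (integrableD mD f2 g2).
Qed.

Lemma cintegralD D f g : measurable D -> cintegrable D f -> cintegrable D g ->
  cintegral D (fun x => f x + g x) = cintegral D f + cintegral D g.
Proof.
move=> mD [f1 f2] [g1 g2]; apply: complexP; rewrite ?cReD ?cImD /=.
  by under eq_Rintegral do rewrite cReD; rewrite RintegralD.
by under eq_Rintegral do rewrite cImD; rewrite RintegralD.
Qed.

Lemma cintegrableZ D z f : measurable D -> cintegrable D f -> cintegrable D (fun x => z * f x).
Proof.
move=> mD cf; have mf := cintegrable_measurable cf.
apply: (@cintegrable_le D _ (fun x => cabs z * cabs (f x))) => //.
- by apply: cmeasurableM => //; exact: cmeasurable_cst.
- exact: (integrableZl mD (cabs z) (cintegrable_abs mD cf)).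
- by move=> x _; rewrite cabsM.
Qed.

Lemma cintegralZ D z f : measurable D -> cintegrable D f ->
  cintegral D (fun x => z * f x) = z * cintegral D f.
Proof.
move=> mD [f1 f2]; have hz (k : R) h : mu.-integrable D (EFin \o h) -> mu.-integrable D (EFin \o (fun x => k * h x)).
  exact: (@integrableZl _ _ _ mu D mD k).
apply: complexP; rewrite ?cReM ?cImM /=.
  under eq_Rintegral do rewrite cReM.
  by rewrite RintegralB ?RintegralZl//; exact: hz.
under eq_Rintegral do rewrite cImM.
by rewrite RintegralD ?RintegralZl//; exact: hz.
Qed.

Lemma cintegrable0 D : measurable D -> cintegrable D (fun=> 0).
Proof. by move=> mD; split; exact: integrable0. Qed.

Lemma cintegral0 D : measurable D -> cintegral D (fun=> 0) = 0.
Proof.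
move=> mD; apply: complexP => /=; by rewrite Rintegral_cst// mul0r.
Qed.

Lemma cintegrable_sum D (I : Type) (r : seq I) (F : I -> R -> R[i]) : measurable D ->
  (forall i, cintegrable D (F i)) -> cintegrable D (fun x => \sum_(i <- r) F i x).
Proof.
move=> mD h; elim: r => [|i r ih].
  by under eq_fun do rewrite big_nil; exact: cintegrable0.
by under eq_fun do rewrite big_cons; exact: cintegrableD.
Qed.

Lemma cintegral_sum D (I : Type) (r : seq I) (F : I -> R -> R[i]) : measurable D ->
  (forall i, cintegrable D (F i)) ->
  cintegral D (fun x => \sum_(i <- r) F i x) = \sum_(i <- r) cintegral D (F i).
Proof.
move=> mD h; elim: r => [|i r ih].
  by under eq_fun do rewrite big_nil; rewrite big_nil cintegral0.
under eq_fun do rewrite big_cons.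
by rewrite cintegralD// ?ih ?big_cons//; exact: cintegrable_sum.
Qed.

Lemma cintegralB D f g : measurable D -> cintegrable D f -> cintegrable D g ->
  cintegral D (fun x => f x - g x) = cintegral D f - cintegral D g.
Proof.
move=> mD cf cg.
have h x : f x - g x = f x + (-1) * g x by rewrite mulN1r.
under eq_fun do rewrite h.
by rewrite cintegralD// ?cintegralZ ?mulN1r//; exact: cintegrableZ.
Qed.

Lemma cintegral_real D (f : R -> R) : measurable D -> cintegral D (fun x => (f x)%:C) = (\int[mu]_(x in D) f x)%:C.
Proof. by move=> mD; apply: complexP => //=; rewrite Rintegral_cst// mul0r. Qed.

Lemma cintegrable_real D (f : R -> R) : measurable D -> mu.-integrable D (EFin \o f) ->
  cintegrable D (fun x => (f x)%:C).
Proof. by move=> mD h; split => //; exact: integrable0. Qed.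

Lemma ccvg_dominated D (f : nat -> R -> R[i]) (g : R -> R[i]) (h : R -> R) :
  measurable D -> (forall n, cmeasurable D (f n)) -> mu.-integrable D (EFin \o h) ->
  (forall n x, D x -> cabs (f n x) <= h x) ->
  (forall x, D x -> ccvg (fun n => f n x) (g x)) ->
  cintegrable D g /\ ccvg (fun n => cintegral D (f n)) (cintegral D g).
Proof.
move=> mD mf ih fh fg.
have [i1 c1] := @dominated_cvg_Rintegral _ _ _ mu D (fun n x => Re (f n x)) (fun x => Re (g x)) h mD
  (fun n => (mf n).1) ih (fun n x Dx => le_trans (cabs_Re _) (fh n x Dx)) (fun x Dx => ccvg_Re (fg x Dx)).
have [i2 c2] := @dominated_cvg_Rintegral _ _ _ mu D (fun n x => Im (f n x)) (fun x => Im (g x)) h mD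
  (fun n => (mf n).2) ih (fun n x Dx => le_trans (cabs_Im _) (fh n x Dx)) (fun x Dx => ccvg_Im (fg x Dx)).
split => //.
apply: (ccvg_le (v := fun n => `|Re (cintegral D (f n)) - Re (cintegral D g)| + `|Im (cintegral D (f n)) - Im (cintegral D g)|)).
  by rewrite -[0](addr0 0); apply: cvgD; apply/norm_cvg0P/subr_cvg0.
by apply: nearW => n; rewrite -cReB -cImB cabs_le_ReIm.
Qed.

Lemma cintegral_shift (f : R -> R[i]) (a : R) :
  continuous (fun x => Re (f x)) -> continuous (fun x => Im (f x)) ->
  cintegrable setT f ->
  cintegrable setT (fun x => f (x + a)) /\
  cintegral setT (fun x => f (x + a)) = cintegral setT f.
Proof.
move=> c1 c2 [i1 i2]; split.
  by split; [exact: (integrableT_shift a c1 i1)|exact: (integrableT_shift a c2 i2)].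
have e1 := Rintegral_shift a c1 i1; have e2 := Rintegral_shift a c2 i2.
by rewrite /Defs.cintegral e1 e2.
Qed.

End ComplexIntegral.

(** * The Gamma function *)

Section Gamma.
Context {R : realType}.
Notation mu := (@lebesgue_measure R).
Notation Re := (@complex.Re R).
Notation Im := (@complex.Im R).
Notation cintegral := (@cintegral R).
Implicit Types (z w s : R[i]) (c t x : R).

Lemma expR_ge_sqr (x : R) : 0 <= x -> x ^+ 2 / 2 <= expR x.
Proof.
by move=> x0; apply: le_trans (expR_ge1Dxn 1 x0); rewrite lerDr.
Qed.

(** For x >= 0, e^x >= x^2 / 2 and 2 c x - x^2 / 2 <= 2 c^2, because (x - 2 c)^2 >= 0; for x < 0 the
    term - e^x is simply dropped. *)
Lemma gam_kernel_le c x : 0 < c ->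
  expR (c * x - expR x) <= expR (2 * c ^+ 2) * expR (- (c * `|x|)).
Proof.
move=> c0; rewrite -expRD ler_expR.
have [x0|x0] := leP 0 x.
  have := expR_ge_sqr x0; rewrite ger0_norm//.
  have := sqr_ge0 (x - 2 * c); nra.
rewrite ltr0_norm//; have := expR_gt0 x; nra.
Qed.

Lemma continuous_gam_kernel c : continuous (fun x : R => expR (c * x - expR x)).
Proof.
move=> x; apply: (@cvg_comp _ _ _ (fun x : R => c * x - expR x) expR _ (nbhs (c * x - expR x))); last exact: continuous_expR.
apply: cvgB; last exact: continuous_expR.
by apply: cvgM; [exact: cvg_cst|exact: cvg_id].
Qed.

Lemma integrableT_gam_kernel c : 0 < c -> integrableT (fun x : R => expR (c * x - expR x)).
Proof.
move=> c0; apply: (integrableT_le (integrableT_scale (expR (2 * c ^+ 2)) (integrableT_exp_abs c0))).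
  by apply: continuous_measurableT; exact: continuous_gam_kernel.
by move=> x; rewrite ger0_norm ?expR_ge0//; exact: gam_kernel_le.
Qed.

(* Euler's integral after the substitution t = e^x; it converges only for
   Re s > 0. *)
Definition gamr c : R := \int[mu]_x expR (c * x - expR x).

Definition Gam s : R[i] := cintegral setT (fun x => cexp (s * x%:C - (expR x)%:C)).

Lemma GamE s : Gam s = cintegral setT (fun x => cexp (s * x%:C - (expR x)%:C)).
Proof. by []. Qed.

Lemma gamrE c : gamr c = \int[mu]_x expR (c * x - expR x).
Proof. by []. Qed.

Lemma Re_gam_arg s x : Re (s * x%:C - (expR x)%:C) = Re s * x - expR x.
Proof. by rewrite cReB cReM /= mulr0 subr0. Qed.

Lemma Im_gam_arg s x : Im (s * x%:C - (expR x)%:C) = Im s * x.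
Proof. by rewrite cImB cImM /= mulr0 add0r subr0. Qed.

Lemma cabs_gam_kernel s x : cabs (cexp (s * x%:C - (expR x)%:C)) = expR (Re s * x - expR x).
Proof. by rewrite cabs_cexp Re_gam_arg. Qed.

Lemma cmeasurable_id_real : cmeasurable (setT : set (measurableTypeR R)) (fun x => x%:C).
Proof. by apply: cmeasurable_real; exact: measurable_id. Qed.

Lemma cmeasurable_gam_kernel s :
  cmeasurable (setT : set (measurableTypeR R)) (fun x => cexp (s * x%:C - (expR x)%:C)).
Proof.
apply: cmeasurable_cexp; apply: cmeasurableD.
  by apply: cmeasurableM; [exact: cmeasurable_cst|exact: cmeasurable_id_real].
have h x : - (expR x)%:C = (- expR x)%:C by rewrite rmorphN.
under eq_fun do rewrite h.
by apply: cmeasurable_real; apply: measurable_funN; exact: measurable_expR.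
Qed.

Lemma cintegrable_gam_kernel s : 0 < Re s ->
  cintegrable setT (fun x => cexp (s * x%:C - (expR x)%:C)).
Proof.
move=> s0; apply: (cintegrable_le _ (cmeasurable_gam_kernel s) (integrableT_gam_kernel s0)) => //.
by move=> x _; rewrite cabs_gam_kernel.
Qed.

Lemma cabs_Gam s : 0 < Re s -> cabs (Gam s) <= 2 * gamr (Re s).
Proof.
move=> s0; apply: (cabs_cintegral _ (cintegrable_gam_kernel s0) (integrableT_gam_kernel s0)) => //.
by move=> x _; rewrite cabs_gam_kernel.
Qed.

Lemma gamr_ge0 c : 0 <= gamr c.
Proof. by apply: Rintegral_ge0 => x _; exact: expR_ge0. Qed.

Lemma Gam_real c : Gam c%:C = (gamr c)%:C.
Proof.
rewrite /Gam /gamr -cintegral_real//; apply: eq_cintegral => x _.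
by rewrite -rmorphM -rmorphB /= cexp_real.
Qed.

Lemma cvg_exp_abs_nat (c : R) : 0 < c -> expR (- (c * n%:R)) @[n --> \oo] --> (0 : R).
Proof.
move=> c0; have -> : (fun n : nat => expR (- (c * n%:R))) = (fun n => expR (- c) ^+ n).
  by apply/funext => n; rewrite -mulNr expRM_natr.
by apply: cvg_expr; rewrite ger0_norm ?expR_ge0// expR_lt1 oppr_lt0.
Qed.

Lemma cvg0_of_exp_abs (F : R -> R) (C c : R) : 0 < c -> (forall x, `|F x| <= C * expR (- (c * `|x|))) ->
  F n%:R @[n --> \oo] --> (0 : R) /\ F (- n%:R) @[n --> \oo] --> (0 : R).
Proof.
move=> c0 h; have z : C * expR (- (c * n%:R)) @[n --> \oo] --> (0 : R).
  by rewrite -[X in _ --> X](mulr0 C); apply: cvgM; [exact: cvg_cst|exact: cvg_exp_abs_nat].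
split; apply/norm_cvg0P.
  apply: (@squeeze_cvgr _ _ _ _ (fun=> 0) (fun n => C * expR (- (c * n%:R)))) => //; last exact: cvg_cst.
  by apply: nearW => n; rewrite normr_ge0/= (le_trans (h _))// ger0_norm.
apply: (@squeeze_cvgr _ _ _ _ (fun=> 0) (fun n => C * expR (- (c * n%:R)))) => //; last exact: cvg_cst.
by apply: nearW => n; rewrite normr_ge0/= (le_trans (h _))// normrN ger0_norm.
Qed.

(** Integration by parts: the derivative of e^(s x - e^x) is s times the kernel of [Gam s] minus the
    kernel of [Gam (s + 1)], and it integrates to 0 because the kernel vanishes at both ends. The
    argument is run on the real part (cosine) and on the imaginary part (sine). *)
Lemma GamS s : 0 < Re s -> Gam (s + 1) = s * Gam s.
Proof.
case: s => a b /= a0.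
have a1 : 0 < a + 1 by rewrite addr_gt0.
pose k := fun x : R => expR (a * x - expR x).
have ik := integrableT_gam_kernel a0; have ik1 := integrableT_gam_kernel a1.
have k1 x : expR ((a + 1) * x - expR x) = k x * expR x.
  by rewrite /k -expRD; congr expR; ring.
have i1 (h : R -> R) : continuous h -> (forall x, `|h x| <= 1) -> integrableT (fun x => k x * h x).
  move=> ch h1; apply: (integrableT_le ik).
    apply: measurable_funM; [exact: integrableT_measurable|exact: continuous_measurableT].
  by move=> x; rewrite normrM ger0_norm ?expR_ge0// ler_piMr ?expR_ge0.
have i2 (h : R -> R) : continuous h -> (forall x, `|h x| <= 1) -> integrableT (fun x => k x * expR x * h x).
  move=> ch h1; apply: (integrableT_le ik1).
    apply: measurable_funM; last exact: continuous_measurableT.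
    by apply: measurable_funM; [exact: integrableT_measurable|exact: measurable_expR].
  by move=> x; rewrite k1 normrM ger0_norm ?mulr_ge0 ?expR_ge0// ler_piMr ?mulr_ge0 ?expR_ge0.
have cc := @continuous_cosM R b; have cs := @continuous_sinM R b.
have bc x := @norm_cos_le1 R (b * x); have bs x := @norm_sin_le1 R (b * x).
have ce : Re (Gam (a +i* b)) = \int[mu]_x (k x * cos (b * x)).
  by apply: eq_Rintegral => x _; rewrite Re_cexp Re_gam_arg Im_gam_arg.
have se : Im (Gam (a +i* b)) = \int[mu]_x (k x * sin (b * x)).
  by apply: eq_Rintegral => x _; rewrite Im_cexp Re_gam_arg Im_gam_arg.
have ce1 : Re (Gam (a +i* b + 1)) = \int[mu]_x (k x * expR x * cos (b * x)).
  apply: eq_Rintegral => x _; rewrite Re_cexp Re_gam_arg Im_gam_arg cReD cImD /= addr0.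
  by rewrite k1.
have se1 : Im (Gam (a +i* b + 1)) = \int[mu]_x (k x * expR x * sin (b * x)).
  apply: eq_Rintegral => x _; rewrite Im_cexp Re_gam_arg Im_gam_arg cReD cImD /= addr0.
  by rewrite k1.
have kb x : `|k x| <= expR (2 * a ^+ 2) * expR (- (a * `|x|)).
  by rewrite ger0_norm ?expR_ge0//; exact: gam_kernel_le.
have khb (h : R -> R) x : (forall x, `|h x| <= 1) -> `|k x * h x| <= expR (2 * a ^+ 2) * expR (- (a * `|x|)).
  move=> h1; apply: le_trans (kb x).
  by rewrite normrM ler_piMr.
have ck : continuous k by exact: continuous_gam_kernel.
have ckx : continuous (fun x => k x * expR x).
  by move=> x; apply: cvgM; [exact: ck|exact: continuous_expR].
have isc (z : R) f : integrableT f -> integrableT (fun x => z * f x) by exact: integrableT_scale.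
apply: complexP.
- rewrite cReM ce1 /= -/(Gam _) -[X in _ - _ * X]/(Im (Gam (a +i* b))) -[X in a * X - _]/(Re (Gam (a +i* b))) ce se.
  have [l l'] := cvg0_of_exp_abs a0 (fun x => khb _ x bc).
  have := @Rintegral_FTCT R (fun x => k x * cos (b * x))
    (fun x => a * (k x * cos (b * x)) - b * (k x * sin (b * x)) - k x * expR x * cos (b * x)) 0 0.
  have I1 : integrableT (fun x => k x * cos (b * x)) by apply: i1.
  have I2 : integrableT (fun x => k x * sin (b * x)) by apply: i1.
  have I3 : integrableT (fun x => k x * expR x * cos (b * x)) by apply: i2.
  rewrite subr0 (RintegralB measurableT (integrableT_sub (isc a _ I1) (isc b _ I2)) I3).
  rewrite (RintegralB measurableT (isc a _ I1) (isc b _ I2)).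
  rewrite (RintegralZl a measurableT I1) (RintegralZl b measurableT I2).
  move=> /(_ _ _ _ l l') h; apply/esym/eqP; rewrite -subr_eq0; apply/eqP; apply: h.
  + by apply: integrableT_sub; [apply: integrableT_sub; apply: isc; apply: i1|apply: i2].
  + move=> x; rewrite /k; apply: is_derive_eq.
    rewrite /GRing.scale /=; ring.
  + move=> x; apply: cvgB; first apply: cvgB.
    * by apply: cvgM; [exact: cvg_cst|apply: cvgM; [exact: ck|exact: cc]].
    * by apply: cvgM; [exact: cvg_cst|apply: cvgM; [exact: ck|exact: cs]].
    * by apply: cvgM; [exact: ckx|exact: cc].
- rewrite cImM se1 /= -[X in a * X + _]/(Im (Gam (a +i* b))) -[X in _ + b * X]/(Re (Gam (a +i* b))) ce se.
  have [l l'] := cvg0_of_exp_abs a0 (fun x => khb _ x bs).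
  have := @Rintegral_FTCT R (fun x => k x * sin (b * x))
    (fun x => a * (k x * sin (b * x)) + b * (k x * cos (b * x)) - k x * expR x * sin (b * x)) 0 0.
  have I1 : integrableT (fun x => k x * sin (b * x)) by apply: i1.
  have I2 : integrableT (fun x => k x * cos (b * x)) by apply: i1.
  have I3 : integrableT (fun x => k x * expR x * sin (b * x)) by apply: i2.
  rewrite subr0 (RintegralB measurableT (integrableT_add (isc a _ I1) (isc b _ I2)) I3).
  rewrite (RintegralD measurableT (isc a _ I1) (isc b _ I2)).
  rewrite (RintegralZl a measurableT I1) (RintegralZl b measurableT I2).
  move=> /(_ _ _ _ l l') h; apply/esym/eqP; rewrite -subr_eq0; apply/eqP; apply: h.
  + by apply: integrableT_sub; [apply: integrableT_add; apply: isc; apply: i1|apply: i2].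
  + move=> x; rewrite /k; apply: is_derive_eq.
    rewrite /GRing.scale /=; ring.
  + move=> x; apply: cvgB; first apply: cvgD.
    * by apply: cvgM; [exact: cvg_cst|apply: cvgM; [exact: ck|exact: cs]].
    * by apply: cvgM; [exact: cvg_cst|apply: cvgM; [exact: ck|exact: cc]].
    * by apply: cvgM; [exact: ckx|exact: cs].
Qed.

Lemma gamrS c : 0 < c -> gamr (c + 1) = c * gamr c.
Proof.
move=> c0; apply: (@complexI R).
by rewrite -Gam_real rmorphD GamS//= Gam_real rmorphM.
Qed.

Lemma gamr1 : gamr 1 = 1.
Proof.
have dF (x : R) : is_derive x (1 : R) (fun x => - expR (- expR x)) (expR (1 * x - expR x)).
  apply: is_derive_eq.
  by rewrite /GRing.scale /= mul1r expRD mulrN opprK mulrC.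
have := Rintegral_FTCT (integrableT_gam_kernel ltr01) dF.
rewrite -/(gamr 1) => /(_ 0 (-1)); rewrite sub0r opprK; apply.
- exact: continuous_gam_kernel.
- rewrite -[X in _ --> X]oppr0; apply: cvgN.
  apply: (@squeeze_cvgr _ _ _ _ (fun=> 0) (fun n => expR (- (1 * n%:R)))); first 1 last.
  + exact: cvg_cst.
  + exact: cvg_exp_abs_nat.
  apply: nearW => n; rewrite expR_ge0/= ler_expR lerN2 mul1r.
  by apply: le_trans (expR_ge1Dx _); rewrite lerDr.
- apply: cvgN; rewrite -[X in _ --> X](@expR0 R).
  apply: (@cvg_comp _ _ _ (fun n : nat => - expR (- n%:R)) expR _ (nbhs (0 : R))); last exact: continuous_expR.
  have h : - expR (- (1 * n%:R)) @[n --> \oo] --> (- 0 : R) by apply: cvgN; exact: cvg_exp_abs_nat.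
  by move: h; rewrite oppr0; under eq_fun do rewrite mul1r.
Qed.

Lemma gamr_nat (n : nat) : gamr n.+1%:R = n`!%:R.
Proof.
elim: n => [|n ih]; first by rewrite gamr1 fact0.
by rewrite -natr1 gamrS// ih factS natrM.
Qed.

Lemma pochhammerS (A : pzRingType) (a : A) n : pochhammer a n.+1 = pochhammer a n * (a + n%:R).
Proof. by rewrite /pochhammer big_ord_recr. Qed.

Lemma pochhammer0 (A : pzRingType) (a : A) : pochhammer a 0 = 1.
Proof. by rewrite /pochhammer big_ord0. Qed.

Lemma Re_gt0_addn s (n : nat) : 0 < Re s -> 0 < Re (s + n%:R).
Proof. by move=> s0; rewrite cReD cRe_nat ltr_wpDr. Qed.

Lemma Gam_addn s n : 0 < Re s -> Gam (s + n%:R) = pochhammer s n * Gam s.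
Proof.
move=> s0; elim: n => [|n ih]; first by rewrite addr0 pochhammer0 mul1r.
rewrite -natr1 addrA GamS; last exact: Re_gt0_addn.
by rewrite ih pochhammerS mulrCA mulrA.
Qed.

Lemma euler_gammaE s : 0 < Re s -> euler_gamma s = Gam s.
Proof.
move=> s0; rewrite /euler_gamma.
have e (x : R) : cpow (expR x) (s - 1) * (expR (- expR x))%:C * (expR x)%:C = cexp (s * x%:C - (expR x)%:C).
  rewrite cpowE ?expR_gt0// expRK -(cexp_real (- expR x)) -cexpD.
  have -> : s * x%:C - (expR x)%:C = (s - 1) * x%:C + (- expR x)%:C + x%:C.
    by rewrite rmorphN /=; ring.
  by rewrite (cexpD _ x%:C) cexp_real.
have eL (x : R) : `]0, +oo[%classic x -> cpow x (s - 1) * (expR (- x))%:C =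
    cexp ((s - 1) * (ln x)%:C - x%:C).
  rewrite /= in_itv/= andbT => x0.
  by rewrite cpowE// -cexp_real -cexpD rmorphN.
rewrite (eq_cintegral eL).
(* Real and imaginary parts are treated together, h being [cos] or [sin]. *)
pose G (h : R -> R) (x : R) : R := expR ((Re s - 1) * ln x - x) * h (Im s * ln x).
have cG h : continuous h -> {in `]0, +oo[, continuous (G h)}.
  move=> ch x; rewrite in_itv/= andbT => x0; apply: cvgM.
    apply: (@cvg_comp _ _ _ (fun x : R => (Re s - 1) * ln x - x) expR _ (nbhs ((Re s - 1) * ln x - x))); last exact: continuous_expR.
    by apply: cvgB; [apply: cvgM; [exact: cvg_cst|exact: continuous_ln]|exact: cvg_id].
  apply: (@cvg_comp _ _ _ (fun x : R => Im s * ln x) h _ (nbhs (Im s * ln x))); last exact: ch.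
  by apply: cvgM; [exact: cvg_cst|exact: continuous_ln].
have GE h x : G h (expR x) * expR x = expR (Re s * x - expR x) * h (Im s * x).
  rewrite /G expRK mulrAC -expRD; congr (expR _ * _); ring.
have iG h : continuous h -> (forall x, `|h x| <= 1) -> integrableT (fun x => G h (expR x) * expR x).
  move=> ch h1; under eq_fun do rewrite GE.
  apply: (integrableT_le (integrableT_gam_kernel s0)).
    apply: measurable_funM; first by apply: continuous_measurableT; exact: continuous_gam_kernel.
    apply: continuous_measurableT => x.
    apply: (@cvg_comp _ _ _ (fun x : R => Im s * x) h _ (nbhs (Im s * x))); last exact: ch.
    by apply: cvgM; [exact: cvg_cst|exact: cvg_id].
  by move=> x; rewrite normrM ger0_norm ?expR_ge0// ler_piMr ?expR_ge0.
have cc := @continuous_cos R; have cs := @continuous_sin R.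
apply: complexP.
  have [_ h] := Rintegral_expR_subst (cG _ cc) (iG _ cc (@norm_cos_le1 R)).
  transitivity (\int[mu]_(x in `]0, +oo[) G cos x).
    apply: eq_Rintegral => x _; rewrite Re_cexp cReB cImB cReM cImM /= !(mulr0, subr0, add0r).
    by rewrite cReB cImB /= subr0.
  rewrite h; apply: eq_Rintegral => x _.
  by rewrite GE Re_cexp Re_gam_arg Im_gam_arg.
have [_ h] := Rintegral_expR_subst (cG _ cs) (iG _ cs (@norm_sin_le1 R)).
transitivity (\int[mu]_(x in `]0, +oo[) G sin x).
  apply: eq_Rintegral => x _; rewrite Im_cexp cReB cImB cReM cImM /= !(mulr0, subr0, add0r).
  by rewrite cReB cImB /= subr0.
rewrite h; apply: eq_Rintegral => x _.
by rewrite GE Im_cexp Re_gam_arg Im_gam_arg.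
Qed.

(** Continuity under the integral sign. It serves for the measurability of [Gam] along a vertical
    line and for the sine transform in [Gam_mellin]. *)
Lemma continuous_fourier (f h : R -> R) : integrableT f -> continuous h ->
  (forall x, `|h x| <= 1) -> continuous (fun t => \int[mu]_x (f x * h (t * x))).
Proof.
move=> intf ch h1 a.
have ha : a \in (`]a - 1, a + 1[%classic : set R).
  by rewrite inE/= in_itv/= ltrBlDr ltrDl ltr01.
have chm (t : R) : continuous (fun x => h (t * x)).
  move=> x; apply: (@cvg_comp _ _ _ (fun x : R => t * x) h _ (nbhs (t * x))); last exact: ch.
  by apply: cvgM; [exact: cvg_cst|exact: cvg_id].
suff H : {in (`]a - 1, a + 1[%classic : set R), continuous (fun t => \int[mu]_x (f x * h (t * x)))} by exact: H.
apply: (@continuity_under_integral R _ _ mu (fun t x => f x * h (t * x)) setT _ (a - 1) (a + 1) _ _ (fun x => `|f x|)) => //.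
- move=> t _; apply: (integrableT_le (integrableT_norm intf)).
    by apply: measurable_funM; [exact: integrableT_measurable|exact: continuous_measurableT].
  by move=> x; rewrite normrM ler_piMr.
- apply: aeW => x _ t _; apply: cvgM; first exact: cvg_cst.
  apply: (@cvg_comp _ _ _ (fun t : R => t * x) h _ (nbhs (t * x))); last exact: ch.
  by apply: cvgM; [exact: cvg_id|exact: cvg_cst].
- exact: integrableT_norm.
- by move=> t _; apply: aeW => x _; rewrite normrM ler_piMr.
Qed.

Lemma cmeasurable_Gam c (k : R[i]) : 0 < c + Re k ->
  cmeasurable (setT : set (measurableTypeR R)) (fun t => Gam (c +i* t + k)).
Proof.
move=> c0; have ik := integrableT_gam_kernel c0; split.
  have h t : Re (Gam (c +i* t + k)) = \int[mu]_x (expR ((c + Re k) * x - expR x) * cos ((t + Im k) * x)).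
    by apply: eq_Rintegral => x _; rewrite Re_cexp Re_gam_arg Im_gam_arg cReD cImD.
  under eq_fun do rewrite h; apply: continuous_measurableT.
  apply: (@continuous_comp_shift R (fun t => \int[mu]_x (expR ((c + Re k) * x - expR x) * cos (t * x)))).
  by apply: continuous_fourier => //; [exact: continuous_cos|exact: norm_cos_le1].
have h t : Im (Gam (c +i* t + k)) = \int[mu]_x (expR ((c + Re k) * x - expR x) * sin ((t + Im k) * x)).
  by apply: eq_Rintegral => x _; rewrite Im_cexp Re_gam_arg Im_gam_arg cReD cImD.
under eq_fun do rewrite h; apply: continuous_measurableT.
apply: (@continuous_comp_shift R (fun t => \int[mu]_x (expR ((c + Re k) * x - expR x) * sin (t * x)))).
by apply: continuous_fourier => //; [exact: continuous_sin|exact: norm_sin_le1].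
Qed.

Lemma cabs_le_addn s (n : nat) : 0 < Re s -> cabs s <= cabs (s + n%:R).
Proof.
move=> s0; rewrite /cabs cReD cImD cRe_nat cIm_nat addr0 ler_wsqrtr// lerD2r.
by rewrite ler_sqr ?nnegrE ?addr_ge0 ?(ltW s0)// lerDl.
Qed.

Lemma cabs_ge_Re s : 0 < Re s -> Re s <= cabs s.
Proof. by move=> s0; rewrite (le_trans (ler_norm _))// cabs_Re. Qed.

(** Since |s + i| >= |s| for Re s > 0, iterating the functional equation m times turns the trivial
    bound at s + m into polynomial decay of any prescribed order on vertical lines. *)
Lemma Gam_decay s (m : nat) : 0 < Re s ->
  cabs (Gam s) <= 2 * gamr (Re s + m%:R) / cabs s ^+ m.
Proof.
move=> s0; have a0 : 0 < cabs s by apply: lt_le_trans (cabs_ge_Re s0).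
rewrite ler_pdivlMr ?exprn_gt0//.
have := cabs_Gam (Re_gt0_addn m s0).
rewrite cReD cRe_nat; apply: le_trans.
rewrite Gam_addn// cabsM mulrC ler_wpM2r ?cabs_ge0// /pochhammer cabs_prod.
rewrite -[X in _ ^+ X]card_ord -prodr_const; apply: ler_prod => i _.
by rewrite cabs_ge0 cabs_le_addn.
Qed.

End Gamma.

(** * Mellin inversion *)

Section Inversion.
Context {R : realType}.
Notation mu := (@lebesgue_measure R).
Notation Re := (@complex.Re R).
Notation Im := (@complex.Im R).
Notation cintegral := (@cintegral R).
Notation RT := (measurableTypeR R).

Lemma Rintegral_odd (g : R -> R) : continuous g -> integrableT g ->
  (forall x, g (- x) = - g x) -> \int[mu]_x g x = 0.
Proof.
move=> cg ig og.
rewrite -(cvg_lim _ (integrableT_itv_cvg ig))//.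
have -> : (fun n : nat => (\int[mu]_(x in `[(- n%:R), n%:R]) g x)%R) = (fun=> 0).
  apply/funext => n.
  have n0 : - n%:R <= n%:R :> R by rewrite (@le_trans _ _ 0)// oppr_le0.
  have := @integration_by_substitution_oppr R g (- n%:R) n%:R n0.
  rewrite opprK => /(_ (continuous_subspaceT cg)) h.
  have ih : integrable mu `[(- n%:R), n%:R] (EFin \o g) by apply: integrableS ig.
  have e : (\int[mu]_(x in `[(- n%:R), n%:R]) g x) = \int[mu]_(x in `[(- n%:R), n%:R]) (-1 * g x).
    rewrite [LHS]/Rintegral h.
    by apply: eq_Rintegral => x _; rewrite /= og mulN1r.
  move: e; rewrite RintegralZl// => e; clear -e; move: e.
  by set z := Rintegral _ _ _; lra.
exact: lim_cst.
Qed.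

Lemma Rintegral_opp (g : R -> R) : continuous g -> (forall x, 0 <= g x) -> integrableT g ->
  integrableT (fun x => g (- x)) /\ \int[mu]_x g (- x) = \int[mu]_x g x.
Proof.
move=> cg g0 ig.
have cgN : continuous (fun x => g (- x)).
  move=> x; apply: (@cvg_comp _ _ _ (fun x : R => - x) g _ (nbhs (- x))); last exact: cg.
  by apply: cvgN; exact: cvg_id.
have mgN : measurable_fun setT (fun x : R => g (- x)) by exact: continuous_measurableT.
have E : (\int[mu]_x (g (- x))%:E = (\int[mu]_x g x)%R%:E)%E.
  pose D (n : nat) : set R := [set` `[(- n%:R : R), n%:R] ].
  apply: (@nonneg_integrable_cvg_itv R (fun x => g (- x)) D setT) => //.
  - by move=> n; exact: measurable_itv.
  - move=> n x/=; rewrite /D/= !in_itv/= => /andP[h1 h2]; apply/andP; split.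
      by apply: le_trans h1; rewrite lerN2 ler_nat.
    by apply: (le_trans h2); rewrite ler_nat.
  - move=> x _; exists (Num.truncn `|x|).+1 => //=; rewrite /D/= in_itv/= -ler_norml.
    by rewrite ltW// truncnS_gt.
  - have -> : (fun n => \int[mu]_(x in D n) (g (- x))%:E)%E =
      (EFin \o (fun n => (\int[mu]_(x in `[(- n%:R), n%:R]) g x)%R)).
      apply/funext => n /=.
      have n0 : - n%:R <= n%:R :> R by rewrite (@le_trans _ _ 0)// oppr_le0.
      have := @integration_by_substitution_oppr R g (- n%:R) n%:R n0.
      rewrite opprK => /(_ (continuous_subspaceT cg)) h.
      rewrite /Rintegral fineK; first by rewrite h.
      by apply: integrable_fin_num => //; apply: integrableS ig.
    apply: cvg_EFin; first exact: nearW.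
    exact: integrableT_itv_cvg.
split; last by rewrite [LHS]/Rintegral E.
apply/integrableP; split; first exact/measurable_EFinP.
by under eq_integral do rewrite /= ger0_norm//; rewrite E ltry.
Qed.

Lemma Rintegral_even (g : R -> R) : continuous g -> (forall x, 0 <= g x) -> integrableT g ->
  (forall x, g (- x) = g x) ->
  mu.-integrable `[0, +oo[ (EFin \o g) /\ \int[mu]_x g x = 2 * \int[mu]_(x in `[0, +oo[) g x.
Proof.
move=> cg g0 ig eg.
have ig' : mu.-integrable `[0, +oo[ (EFin \o g).
  exact: (@integrableS _ _ _ mu setT `[0, +oo[%classic (EFin \o g) measurableT (measurable_itv _) (@subsetT _ _) ig).
split; first by [].
rewrite [LHS]/Rintegral (@ge0_symfun_integralT R g)//.
  rewrite -set_itvcy fineM//; exact: integrable_fin_num.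
by move=> x /=; rewrite eg.
Qed.

(** Domination by a product of integrable functions gives integrability for the product measure by
    Tonelli; the exponential kernels below provide such products. *)
Lemma Rintegral_Fubini (F : RT * RT -> R) (g h : R -> R) :
  measurable_fun setT F -> integrableT g -> integrableT h ->
  (forall t w, `|F (t, w)| <= g t * h w) ->
  \int[mu]_t (\int[mu]_w F (t, w)) = \int[mu]_w (\int[mu]_t F (t, w)) /\
  integrableT (fun t => \int[mu]_w F (t, w)).
Proof.
move=> mF ig ih Fgh.
have mFE : measurable_fun setT (EFin \o F) by exact/measurable_EFinP.
have m1 t : measurable_fun (setT : set RT) (fun w => F (t, w)) by exact: measurableT_comp.
have m2 w : measurable_fun (setT : set RT) (fun t => F (t, w)) by exact: measurableT_comp.
have i1 t : integrableT (fun w => F (t, w)).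
  exact: (integrableT_le (integrableT_scale (g t) ih) (m1 t) (Fgh t)).
have i2 w : integrableT (fun t => F (t, w)).
  by apply: (integrableT_le (integrableT_scale (h w) ig) (m2 w)) => t; rewrite mulrC.
have iF : (mu \x mu)%E.-integrable setT (EFin \o F).
  apply/integrable12ltyP => //.
  apply: (@le_lt_trans _ _ (\int[mu]_t (g t * \int[mu]_w h w)%:E)%E).
    apply: ge0_le_integral => //.
    - by move=> t _; apply: integral_ge0.
    - apply: (@measurable_fun_fubini_tonelli_F _ _ RT RT R mu (abse \o (EFin \o F))) => //.
      rewrite (_ : abse \o (EFin \o F) = EFin \o (fun p => `|F p|))//.
      have mN : measurable_fun (setT : set (RT * RT)) (fun p => `|F p|) by exact: (measurableT_comp (f := @Num.Def.normr R R)).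
      exact/measurable_EFinP.
      by move=> p; exact: abse_ge0.
    - by apply/measurable_EFinP; apply: measurable_funM; [exact: integrableT_measurable|exact: measurable_cst].
    - move=> t _; have -> : (g t * \int[mu]_w h w)%:E = (\int[mu]_w (g t * h w)%:E)%E.
        rewrite -RintegralZl// /Rintegral fineK//; apply: integrable_fin_num => //.
        exact: integrableT_scale.
      apply: ge0_le_integral => //.
      + by apply/measurable_EFinP; apply: measurableT_comp => //; exact: m1.
      + by apply/measurable_EFinP; apply: integrableT_measurable; exact: integrableT_scale.
      + by move=> w _ /=; rewrite lee_fin; exact: Fgh.
  have : integrableT (fun t => g t * \int[mu]_w h w).
    by under eq_fun do rewrite mulrC; exact: integrableT_scale.
  by move=> /integrable_fin_num-/(_ measurableT); rewrite fin_numElt => /andP[].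
have e1 t : (\int[mu]_w (EFin \o F) (t, w))%E = (\int[mu]_w F (t, w))%:E.
  by rewrite /Rintegral fineK//; apply: integrable_fin_num => //; exact: i1.
have e2 w : (\int[mu]_t (EFin \o F) (t, w))%E = (\int[mu]_t F (t, w))%:E.
  by rewrite /Rintegral fineK//; apply: integrable_fin_num => //; exact: i2.
split.
  have := Fubini iF.
  rewrite (eq_integral (fun t => (\int[mu]_w F (t, w))%:E)); last by move=> t _; exact: e1.
  rewrite [RHS](eq_integral (fun w => (\int[mu]_t F (t, w))%:E)); last by move=> t _; exact: e2.
  by rewrite /Rintegral => ->.
have := integrable_fubini_F iF.
by rewrite /fubini_F; under eq_fun do rewrite e1.
Qed.

Lemma integrableT_bounded_mul (f h : R -> R) : integrableT f -> measurable_fun setT h ->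
  (forall x, `|h x| <= 1) -> integrableT (fun x => f x * h x).
Proof.
move=> intf mh h1; apply: (integrableT_le (integrableT_norm intf)).
  by apply: measurable_funM => //; exact: integrableT_measurable.
by move=> x; rewrite normrM ler_piMr.
Qed.

(** Instead of splitting the integral at distance d from x, continuity at x and boundedness are
    packed into one inequality, |f w - f x| <= e1 + K v / (1 + v) with v = (w - x)^2. Against the
    Poisson kernel the second term is at most K eta / (1 + v), whose integral is K eta pi. *)
Lemma poisson_approx (f : R -> R) (x B : R) : continuous f -> (forall w, `|f w| <= B) ->
  integrableT f ->
  \int[mu]_w (f w * (2 * (n.+1%:R^-1 / (n.+1%:R^-1 ^+ 2 + (w - x) ^+ 2)))) @[n --> \oo] --> 2 * pi * f x.
Proof.
move=> cf fB intf.
apply/cvgrPdist_le => /= e e0.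
set e1 := e / (8 * pi).
have pi0 := @pi_gt0 R.
have e10 : 0 < e1 by rewrite divr_gt0// mulr_gt0.
have [d d0 hd] : exists2 d : R, 0 < d & forall w, `|w - x| < d -> `|f w - f x| <= e1.
  have /cvgrPdist_le/(_ _ e10)/nbhs_ballP[d /= d0 hd] := cf x.
  exists d => // w wd; rewrite distrC; apply: hd; rewrite /ball/= distrC//.
set K := 2 * B * (1 + d ^+ 2) / d ^+ 2.
have B0 : 0 <= B by apply: le_trans (fB 0).
have K0 : 0 <= K by rewrite /K !mulr_ge0// ?invr_ge0 ?sqr_ge0// ltW// one_sqr_gt0.
have key w : `|f w - f x| <= e1 + K * ((w - x) ^+ 2 / (1 + (w - x) ^+ 2)).
  have q0 : 0 <= (w - x) ^+ 2 / (1 + (w - x) ^+ 2) by rewrite divr_ge0 ?sqr_ge0// ltW// one_sqr_gt0.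
  have [wd|wd] := ltP `|w - x| d; first by rewrite (le_trans (hd w wd))// lerDl mulr_ge0.
  apply: (@le_trans _ _ (2 * B)).
    by rewrite (le_trans (ler_normB _ _))// mulr_natl mulr2n lerD.
  apply: (@le_trans _ _ (K * ((w - x) ^+ 2 / (1 + (w - x) ^+ 2)))); last by rewrite lerDr ltW.
  have dw : d ^+ 2 <= (w - x) ^+ 2.
    by rewrite -[leRHS]real_normK ?num_real// ler_sqr ?nnegrE// ltW.
  have d20 : 0 < d ^+ 2 by rewrite exprn_gt0.
  have w20 := one_sqr_gt0 (w - x).
  set u := (w - x) ^+ 2 in dw w20 *.
  have -> : K * (u / (1 + u)) = (2 * B) * ((1 + d ^+ 2) * u / (d ^+ 2 * (1 + u))).
    by rewrite /K; field; rewrite !gt_eqF.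
  rewrite ler_peMr ?mulr_ge0// ler_pdivlMr ?mulr_gt0// mul1r; lra.
near=> n.
set eta : R := n.+1%:R^-1.
have eta0 : 0 < eta by rewrite invr_gt0.
have etaK : eta * K <= e1.
  rewrite mulrC /eta ler_pdivrMr// -ler_pdivrMl//.
  rewrite (@le_trans _ _ n%:R)//; last by rewrite ler_nat.
  near: n; exact: nbhs_infty_ger.
pose p w := eta / (eta ^+ 2 + (w - x) ^+ 2).
have ip : integrableT p by exact: integrableT_poisson.
have p0 w : 0 <= p w.
  by rewrite divr_ge0 ?(ltW eta0)// addr_ge0 ?sqr_ge0// exprn_ge0// ltW.
have ifp : integrableT (fun w => f w * (2 * p w)).
  apply: (integrableT_le (integrableT_scale (2 * B) ip)).
    apply: measurable_funM; first exact: continuous_measurableT.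
    by apply: measurable_funM; [exact: measurable_cst|exact: integrableT_measurable].
  move=> w; have -> : 2 * B * p w = B * (2 * p w) by ring.
  rewrite normrM; have -> : `|2 * p w| = 2 * p w by rewrite ger0_norm// mulr_ge0.
  by apply: ler_wpM2r => //; rewrite mulr_ge0.
have i2 : integrableT (fun w => f x * (2 * p w)).
  by apply: integrableT_scale; apply: integrableT_scale.
have -> : 2 * pi * f x = \int[mu]_w (f x * (2 * p w)).
  rewrite RintegralZl//; last exact: integrableT_scale.
  by rewrite RintegralZl// Rintegral_poisson// mulrC.
rewrite -RintegralB//.
have iD : integrableT (fun w => f x * (2 * p w) - f w * (2 * p w)) by exact: integrableT_sub.
rewrite (le_trans (le_normr_Rintegral measurableT iD))//.
have i3 : integrableT (fun w => 2 * e1 * p w + 2 * K * eta * inv_one_sqr (w - x)).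
  apply: integrableT_add; first exact: integrableT_scale.
  apply: integrableT_scale; apply: (@integrableT_shift R inv_one_sqr (- x)).
    exact: continuous_inv_one_sqr.
  exact: integrableT_inv_one_sqr.
have io : integrableT (fun w => inv_one_sqr (w - x)).
  apply: (@integrableT_shift R inv_one_sqr (- x)); first exact: continuous_inv_one_sqr.
  exact: integrableT_inv_one_sqr.
have hw (w : R) : ((w - x) ^+ 2 / (1 + (w - x) ^+ 2)) * p w <= eta * inv_one_sqr (w - x).
  rewrite /inv_one_sqr /p; have w0 := one_sqr_gt0 (w - x).
  have w1 : 0 <= (w - x) ^+ 2 by exact: sqr_ge0.
  set u := (w - x) ^+ 2 in w0 w1 *.
  have e2 : 0 < eta ^+ 2 by rewrite exprn_gt0.
  have u0 : 0 < eta ^+ 2 + u by rewrite ltr_pwDl.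
  have -> : u / (1 + u) * (eta / (eta ^+ 2 + u)) = eta / (1 + u) * (u / (eta ^+ 2 + u)) by field; rewrite !gt_eqF.
  rewrite ler_piMr ?divr_ge0 ?(ltW eta0) ?(ltW w0)// ler_pdivrMr// mul1r lerDr ltW//.
apply: (@le_trans _ _ (\int[mu]_w (2 * e1 * p w + 2 * K * eta * inv_one_sqr (w - x)))).
  apply: le_Rintegral => //; first exact: (integrableT_norm iD).
  move=> w _; rewrite -mulrBl normrM distrC.
  have -> : `|2 * p w| = 2 * p w by rewrite ger0_norm// mulr_ge0.
  apply: (@le_trans _ _ ((e1 + K * ((w - x) ^+ 2 / (1 + (w - x) ^+ 2))) * (2 * p w))).
    by apply: ler_wpM2r; [by apply: mulr_ge0; [by []|exact: p0]|exact: key].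
  rewrite mulrDl mulrA [e1 * 2]mulrC lerD2l.
  have -> : 2 * K * eta * inv_one_sqr (w - x) = (2 * K) * (eta * inv_one_sqr (w - x)) by ring.
  have -> : K * ((w - x) ^+ 2 / (1 + (w - x) ^+ 2)) * (2 * p w) =
    (2 * K) * (((w - x) ^+ 2 / (1 + (w - x) ^+ 2)) * p w) by ring.
  by apply: ler_wpM2l; [by apply: mulr_ge0|exact: hw].
rewrite (RintegralD measurableT (integrableT_scale (2 * e1) ip) (integrableT_scale (2 * K * eta) io)).
rewrite (RintegralZl (2 * e1) measurableT ip) (RintegralZl (2 * K * eta) measurableT io).
rewrite Rintegral_poisson//.
have -> : \int[mu]_w inv_one_sqr (w - x) = pi.
  rewrite -(Rintegral_poisson x ltr01); apply: eq_Rintegral => w _.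
  by rewrite /inv_one_sqr expr1n mul1r.
have : 2 * K * eta * pi <= 2 * e1 * pi by rewrite ler_wpM2r ?(ltW pi0)//; lra.
have ee : e1 * (8 * pi) = e by rewrite /e1 divfK// gt_eqF// mulr_gt0.
have -> : e = 8 * (e1 * pi) by rewrite -{1}ee; ring.
have : 0 <= e1 * pi by rewrite mulr_ge0 ?ltW.
lra.
Unshelve. all: by end_near. Qed.

Lemma measurable_cos_prod (x : R) : measurable_fun (setT : set (RT * RT)) (fun p => cos (p.1 * (p.2 - x))).
Proof.
apply: (measurableT_comp (f := @cos R)); first by apply: continuous_measurableT; exact: continuous_cos.
apply: measurable_funM => //.
by apply: measurable_funB => //; exact: measurable_cst.
Qed.

(** Abel summation: the outer integral is damped by a two-sided exponential of rate 1 / (n + 1),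
    Fubini then produces a Poisson kernel centred at x, and [poisson_approx] gives the limit. The
    damping is removed by dominated convergence, for which the transform itself has to be
    integrable. *)
Theorem fourier_inversion_cos (f : R -> R) (x B : R) : continuous f -> (forall w, `|f w| <= B) ->
  integrableT f ->
  integrableT (fun t => \int[mu]_w (f w * cos (t * (w - x)))) ->
  \int[mu]_t (\int[mu]_w (f w * cos (t * (w - x)))) = 2 * pi * f x.
Proof.
move=> cf fB intf iA.
set A := fun t => \int[mu]_w (f w * cos (t * (w - x))).
have h0 (n : nat) : 0 < n.+1%:R^-1 :> R by rewrite invr_gt0.
have main (n : nat) : \int[mu]_t (expR (- (n.+1%:R^-1 * `|t|)) * A t) =
   \int[mu]_w (f w * (2 * (n.+1%:R^-1 / (n.+1%:R^-1 ^+ 2 + (w - x) ^+ 2)))).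
  set eta : R := n.+1%:R^-1.
  have ie := integrableT_exp_abs (h0 n).
  pose F (p : RT * RT) := expR (- (eta * `|p.1|)) * (f p.2 * cos (p.1 * (p.2 - x))).
  have mF : measurable_fun setT F.
    apply: measurable_funM; last apply: measurable_funM.
    - apply: (measurableT_comp (f := fun t : RT => expR (- (eta * `|t|)))) => //.
      exact: (integrableT_measurable ie).
    - by apply: (measurableT_comp (f := f)) => //; exact: continuous_measurableT.
    - exact: measurable_cos_prod.
  have [] := Rintegral_Fubini mF ie (integrableT_norm intf).
    move=> t w; rewrite /F /= normrM ger0_norm ?expR_ge0// ler_wpM2l ?expR_ge0//.
    by rewrite normrM ler_piMr//; exact: norm_cos_le1.
  rewrite /F /= => E _.
  transitivity (\int[mu]_t \int[mu]_w (expR (- (eta * `|t|)) * (f w * cos (t * (w - x))))).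
    apply: eq_Rintegral => t _; rewrite RintegralZl//.
    apply: integrableT_bounded_mul => //; last by move=> w; exact: norm_cos_le1.
    apply: continuous_measurableT.
    exact: (@continuous_comp_shift R (fun y => cos (t * y)) (- x) (@continuous_cosM R t)).
  rewrite E; apply: eq_Rintegral => w _.
  rewrite -(Rintegral_exp_abs_cos (w - x) (h0 n)) -RintegralZl//; last exact: integrableT_exp_abs_cos.
  by apply: eq_Rintegral => t _; rewrite mulrCA [(w - x) * t]mulrC.
have c1 : \int[mu]_t (expR (- (n.+1%:R^-1 * `|t|)) * A t) @[n --> \oo] --> \int[mu]_t A t.
  have [] := @dominated_cvg_Rintegral R _ _ mu setT
     (fun (n : nat) t => expR (- (n.+1%:R^-1 * `|t|)) * A t) A (fun t => `|A t|) => //.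
  - move=> n; apply: measurable_funM; last exact: (integrableT_measurable iA).
    exact: (integrableT_measurable (integrableT_exp_abs (h0 n))).
  - exact: (integrableT_norm iA).
  - move=> n t _; rewrite normrM ger0_norm ?expR_ge0// ler_piMl// expR_le1 oppr_le0 mulr_ge0//.
  - move=> t _; rewrite -[X in _ --> X]mul1r; apply: cvgM; last exact: cvg_cst.
    have h1 : - (n.+1%:R^-1 * `|t : R|) @[n --> \oo] --> - (0 * `|t : R|).
      by apply: cvgN; apply: cvgM; [exact: cvg_harmonic|exact: cvg_cst].
    rewrite mul0r oppr0 in h1.
    have h2 : expR (- (n.+1%:R^-1 * `|t : R|)) @[n --> \oo] --> expR (0 : R).
      by apply: (@cvg_comp _ _ _ (fun n : nat => - (n.+1%:R^-1 * `|t : R|)) expR _ (nbhs (0 : R))); last exact: continuous_expR.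
    by move: h2; rewrite expR0.
rewrite -(cvg_lim _ c1)//; apply/cvg_lim => //.
under eq_fun do rewrite main.
exact: poisson_approx.
Qed.

End Inversion.
#[local] Opaque Gam gamr cintegral.

(** * Mellin-Barnes integrals for the exponential and for Bessel K *)

Section Mellin.
Context {R : realType}.
Notation mu := (@lebesgue_measure R).
Notation Re := (@complex.Re R).
Notation Im := (@complex.Im R).
Notation cintegral := (@cintegral R).
Notation RT := (measurableTypeR R).
Implicit Types (c x y t w kappa q : R).

Lemma cFubini (F : RT * RT -> R[i]) (g h : R -> R) :
  cmeasurable setT F -> integrableT g -> integrableT h ->
  (forall t w, cabs (F (t, w)) <= g t * h w) ->
  cintegral setT (fun t => cintegral setT (fun w => F (t, w))) =
  cintegral setT (fun w => cintegral setT (fun t => F (t, w))).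
Proof.
move=> [m1 m2] ig ih hF.
have [e1 _] := Rintegral_Fubini m1 ig ih (fun t w => le_trans (cabs_Re _) (hF t w)).
have [e2 _] := Rintegral_Fubini m2 ig ih (fun t w => le_trans (cabs_Im _) (hF t w)).
by apply: complexP; rewrite ?Re_cintegral ?Im_cintegral; [exact: e1|exact: e2].
Qed.

Lemma cmeasurable_comp d1 (T1 : measurableType d1) d2 (T2 : measurableType d2)
  (f : T2 -> R[i]) (phi : T1 -> T2) : cmeasurable setT f -> measurable_fun setT phi ->
  cmeasurable setT (fun p => f (phi p)).
Proof.
move=> [f1 f2] mphi; split.
  exact: (measurableT_comp f1 mphi).
exact: (measurableT_comp f2 mphi).
Qed.

Lemma cabs_line_sqr c t : cabs (c +i* t) ^+ 2 = c ^+ 2 + t ^+ 2.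
Proof. by rewrite /cabs /= sqr_sqrtr// addr_ge0 ?sqr_ge0. Qed.

Lemma integrableT_line c : 0 < c -> integrableT (fun t => (cabs (c +i* t) ^+ 2)^-1).
Proof.
move=> c0; have := integrableT_scale c^-1 (@integrableT_poisson R c 0 c0).
under eq_fun do rewrite subr0 mulrA mulVf ?gt_eqF// mul1r.
by under [X in _ -> integrableT X]eq_fun do rewrite cabs_line_sqr.
Qed.

Lemma cmeasurable_line c : cmeasurable (setT : set RT) (fun t => c +i* t).
Proof. by split => /=; [exact: measurable_cst|exact: measurable_id]. Qed.

Lemma cmeasurableN d (T : measurableType d) (f : T -> R[i]) : cmeasurable setT f ->
  cmeasurable setT (fun p => - f p).
Proof.
move=> mf; have h p : - f p = (-1) * f p by rewrite mulN1r.
by under eq_fun do rewrite h; apply: cmeasurableM => //; exact: cmeasurable_cst.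
Qed.

Lemma cmeasurable_Gam0 c : 0 < c -> cmeasurable (setT : set RT) (fun t => Gam (c +i* t)).
Proof.
move=> c0; have := @cmeasurable_Gam R c 0; rewrite /= addr0 => /(_ c0).
by under eq_fun do rewrite addr0.
Qed.

Lemma cmeasurable_line_exp c x : cmeasurable (setT : set RT) (fun t => cexp (- (c +i* t) * x%:C)).
Proof.
apply: cmeasurable_cexp; apply: cmeasurableM; last exact: cmeasurable_cst.
by apply: cmeasurableN; exact: cmeasurable_line.
Qed.

Lemma cabs_line_exp c t x : cabs (cexp (- (c +i* t) * x%:C)) = expR (- (c * x)).
Proof. by rewrite cabs_cexp cReM /= mulr0 subr0 mulNr. Qed.

Lemma Gam_line_bound c t : 0 < c ->
  cabs (Gam (c +i* t)) <= 2 * gamr (c + 2) * (cabs (c +i* t) ^+ 2)^-1.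
Proof. by move=> c0; exact: (@Gam_decay R (c +i* t) 2). Qed.

Lemma cintegrable_Gam_line c x : 0 < c ->
  cintegrable setT (fun t => Gam (c +i* t) * cexp (- (c +i* t) * x%:C)).
Proof.
move=> c0.
apply: (cintegrable_le _ _ (integrableT_scale (2 * gamr (c + 2) * expR (- (c * x))) (integrableT_line c0))) => //.
  by apply: cmeasurableM; [exact: cmeasurable_Gam0|exact: cmeasurable_line_exp].
move=> t _; rewrite cabsM cabs_line_exp mulrAC ler_wpM2r ?expR_ge0//.
exact: Gam_line_bound.
Qed.

(** Fourier inversion for f w = e^(c w - e^w), whose transform is [Gam] on the line Re s = c; the
    decay of [Gam] makes this transform integrable. The real part is the cosine inversion; the
    imaginary part is the integral of an odd function of t. *)
Lemma Gam_mellin c x : 0 < c ->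
  cintegral setT (fun t => Gam (c +i* t) * cexp (- (c +i* t) * x%:C)) =
  (2 * pi * expR (- expR x))%:C.
Proof.
move=> c0; pose f w := expR (c * w - expR w).
have intf : integrableT f by exact: integrableT_gam_kernel.
have cf : continuous f by exact: continuous_gam_kernel.
have E t : Gam (c +i* t) * cexp (- (c +i* t) * x%:C) =
   cintegral setT (fun w => cexp (- (c +i* t) * x%:C) * cexp ((c +i* t) * w%:C - (expR w)%:C)).
  by rewrite cintegralZ// 1?mulrC ?GamE//; exact: cintegrable_gam_kernel.
have E2 t w : cexp (- (c +i* t) * x%:C) * cexp ((c +i* t) * w%:C - (expR w)%:C) =
  cexp ((c * (w - x) - expR w) +i* (t * (w - x))).
  rewrite -cexpD; congr cexp; apply: complexP.
    by rewrite !(cReD, cReN, cReM) /=; ring.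
  by rewrite !(cImD, cImN, cImM) /=; ring.
have ER t : Re (Gam (c +i* t) * cexp (- (c +i* t) * x%:C)) =
    expR (- (c * x)) * \int[mu]_w (f w * cos (t * (w - x))).
  rewrite E Re_cintegral -RintegralZl//.
    apply: eq_Rintegral => w _; rewrite E2 Re_cexp /= /f mulrA -expRD; congr (expR _ * _); ring.
  apply: integrableT_bounded_mul => //; last by move=> w; exact: norm_cos_le1.
  apply: continuous_measurableT.
  exact: (@continuous_comp_shift R (fun y => cos (t * y)) (- x) (@continuous_cosM R t)).
have EI t : Im (Gam (c +i* t) * cexp (- (c +i* t) * x%:C)) =
    expR (- (c * x)) * \int[mu]_w (f (w + x) * sin (t * w)).
  rewrite E Im_cintegral.
  have cs : continuous (fun w => sin (t * (w - x))).
    exact: (@continuous_comp_shift R (fun y => sin (t * y)) (- x) (@continuous_sinM R t)).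
  have ifs : integrableT (fun w => f w * sin (t * (w - x))).
    apply: integrableT_bounded_mul => //; last by move=> w; exact: norm_sin_le1.
    exact: continuous_measurableT.
  have -> : \int[mu]_w (f (w + x) * sin (t * w)) = \int[mu]_w (f w * sin (t * (w - x))).
    rewrite -(@Rintegral_shift R (fun w => f w * sin (t * (w - x))) x)//.
      by apply: eq_Rintegral => w _; rewrite addrK.
    by move=> w; apply: cvgM; [exact: cf|exact: cs].
  rewrite -RintegralZl//.
  by apply: eq_Rintegral => w _; rewrite E2 Im_cexp /= /f mulrA -expRD; congr (expR _ * _); ring.
have [i1 i2] := cintegrable_Gam_line x c0.
have iR : integrableT (fun t => \int[mu]_w (f w * cos (t * (w - x)))).
  have := integrableT_scale (expR (c * x)) i1.
  under eq_fun do rewrite /= ER mulrA -expRD subrr expR0 mul1r.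
  by [].
apply: complexP.
  rewrite Re_cintegral; under eq_Rintegral do rewrite ER.
  rewrite RintegralZl// (@fourier_inversion_cos R f x (expR (2 * c ^+ 2)))//.
    rewrite /f /= mulrCA; congr (_ * _); rewrite -expRD; congr expR; ring.
  move=> w; rewrite ger0_norm ?expR_ge0// (le_trans (gam_kernel_le _ c0))//.
  by rewrite ler_piMr ?expR_ge0// expR_le1 oppr_le0 mulr_ge0// ltW.
rewrite Im_cintegral; under eq_Rintegral do rewrite EI.
have ifx : integrableT (fun w => f (w + x)) by exact: integrableT_shift.
have iI : integrableT (fun t => \int[mu]_w (f (w + x) * sin (t * w))).
  have := integrableT_scale (expR (c * x)) i2.
  under eq_fun do rewrite /= EI mulrA -expRD subrr expR0 mul1r.
  by [].
rewrite RintegralZl// Rintegral_odd ?mulr0//.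
- apply: continuous_fourier => //; [exact: continuous_sin|exact: norm_sin_le1].
- move=> t; have i3 : integrableT (fun w => f (w + x) * sin (t * w)).
    apply: integrableT_bounded_mul => //; last by move=> w; exact: norm_sin_le1.
    by apply: continuous_measurableT; exact: continuous_sinM.
  rewrite -[RHS]mulN1r -(RintegralZl (-1) measurableT i3).
  by apply: eq_Rintegral => w _; rewrite mulNr sinN; ring.
Qed.

(* With x = ln (sqrt q) + u this is a multiple of Schlaefli's integrand for
   K_kappa (2 sqrt q), see besselK_bessel_integral. *)
Definition bessel_kernel kappa q x : R := expR (kappa * x - expR x - q * expR (- x)).

Definition bessel_integral kappa q : R := \int[mu]_x bessel_kernel kappa q x.

Lemma continuous_bessel_kernel kappa q : continuous (bessel_kernel kappa q).
Proof.
move=> x; apply: (@cvg_comp _ _ _ (fun x : R => kappa * x - expR x - q * expR (- x)) expR _ (nbhs (kappa * x - expR x - q * expR (- x)))); last exact: continuous_expR.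
apply: cvgB; first apply: cvgB; last 1 first.
- apply: cvgM; first exact: cvg_cst.
  apply: (@cvg_comp _ _ _ (fun x : R => - x) expR _ (nbhs (- x))); last exact: continuous_expR.
  by apply: cvgN; exact: cvg_id.
- by apply: cvgM; [exact: cvg_cst|exact: cvg_id].
- exact: continuous_expR.
Qed.

Lemma integrableT_bessel_kernel kappa q : 0 <= kappa -> 0 < q -> integrableT (bessel_kernel kappa q).
Proof.
move=> k0 q0; have k1 : 0 < kappa + 1 by rewrite ltr_wpDl.
apply: (integrableT_le (integrableT_scale q^-1 (integrableT_gam_kernel k1))).
  by apply: continuous_measurableT; exact: continuous_bessel_kernel.
move=> x; rewrite ger0_norm ?expR_ge0// /bessel_kernel.
have -> : expR ((kappa + 1) * x - expR x) = expR (kappa * x - expR x) * expR x.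
  by rewrite -expRD; congr expR; ring.
rewrite expRD mulrCA ler_wpM2l ?expR_ge0//.
rewrite expRN [leRHS]mulrC -ler_pdivrMr ?invr_gt0 ?q0 // invrK.
have h : q * expR (- x) <= expR (q * expR (- x)) by apply: le_trans (expR_ge1Dx _); rewrite lerDr.
set E := expR (q * expR (- x)) in h *.
rewrite mulrC ler_pdivrMr ?expR_gt0//.
by move: h; rewrite expRN ler_pdivrMr ?expR_gt0// mulrC.
Qed.

(** Only [Gam (s + kappa)] is expanded into Euler's integral. After Fubini the inner integral over
    the line is [Gam_mellin] at y - w, and its value e^(-e^(y - w)) supplies the second exponential
    of [bessel_kernel]. *)
Lemma bessel_integral_mellin kappa c y : 0 <= kappa -> 0 < c ->
  cintegral setT (fun t => Gam (c +i* t) * Gam (c +i* t + kappa%:C) * cexp (- (c +i* t) * y%:C)) =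
  (2 * pi * bessel_integral kappa (expR y))%:C.
Proof.
move=> k0 c0; have ck0 : 0 < kappa + c by rewrite ltr_wpDl.
pose F (p : RT * RT) : R[i] := (expR (kappa * p.2 - expR p.2))%:C *
  (Gam (c +i* p.1) * cexp (- (c +i* p.1) * (y - p.2)%:C)).
have mG := cmeasurable_Gam0 c0.
have mk : measurable_fun (setT : set RT) (fun w => expR (kappa * w - expR w)).
  by apply: continuous_measurableT; exact: continuous_gam_kernel.
have mF : cmeasurable setT F.
  apply: cmeasurableM.
    by apply: cmeasurable_real; exact: (measurableT_comp mk).
  apply: cmeasurableM; first exact: (cmeasurable_comp mG).
  apply: cmeasurable_cexp; apply: cmeasurableM.
    by apply: cmeasurableN; exact: (cmeasurable_comp (cmeasurable_line c)).
  by apply: cmeasurable_real; apply: measurable_funB => //; exact: measurable_cst.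
pose g t := 2 * gamr (c + 2) * expR (- (c * y)) * (cabs (c +i* t) ^+ 2)^-1.
pose h w := expR ((kappa + c) * w - expR w).
have ig : integrableT g by apply: integrableT_scale; exact: integrableT_line.
have ih : integrableT h by exact: integrableT_gam_kernel.
have hF t w : cabs (F (t, w)) <= g t * h w.
  rewrite /F /= !cabsM cabs_line_exp cabs_real ger0_norm ?expR_ge0//.
  have -> : h w = expR (kappa * w - expR w) * expR (c * w).
    by rewrite /h -expRD; congr expR; ring.
  have -> : expR (- (c * (y - w))) = expR (- (c * y)) * expR (c * w).
    by rewrite -expRD; congr expR; ring.
  have -> : g t * (expR (kappa * w - expR w) * expR (c * w)) =
    expR (kappa * w - expR w) * ((2 * gamr (c + 2) * (cabs (c +i* t) ^+ 2)^-1) * (expR (- (c * y)) * expR (c * w))).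
    by rewrite /g; ring.
  rewrite ler_wpM2l ?expR_ge0// ler_wpM2r ?mulr_ge0 ?expR_ge0//.
  exact: Gam_line_bound.
have Fub := cFubini mF ig ih hF.
have E1 : cintegral setT (fun t => cintegral setT (fun w => F (t, w))) =
  cintegral setT (fun t => Gam (c +i* t) * Gam (c +i* t + kappa%:C) * cexp (- (c +i* t) * y%:C)).
  apply: eq_cintegral => t _.
  have -> : Gam (c +i* t) * Gam (c +i* t + kappa%:C) * cexp (- (c +i* t) * y%:C) =
     (Gam (c +i* t) * cexp (- (c +i* t) * y%:C)) * Gam (c +i* t + kappa%:C) by ring.
  have H : 0 < Re (c +i* t + kappa%:C) by rewrite cReD /= addrC.
  rewrite [X in _ * X]GamE; apply: etrans (cintegralZ _ measurableT (cintegrable_gam_kernel H)).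
  apply: eq_cintegral => w _; rewrite /F /= -cexp_real mulrCA -!mulrA; congr (_ * _).
  rewrite -!cexpD; congr cexp; apply: complexP.
    by rewrite !(cReD, cReN, cReM) /=; ring.
  by rewrite !(cImD, cImN, cImM) /=; ring.
apply: (etrans (esym E1)); apply: (etrans Fub).
rewrite /bessel_integral -(RintegralZl (2 * pi) measurableT (integrableT_bessel_kernel k0 (expR_gt0 y))).
apply: etrans (cintegral_real (fun w => 2 * pi * bessel_kernel kappa (expR y) w) measurableT).
apply: eq_cintegral => w _.
have -> : (2 * pi * bessel_kernel kappa (expR y) w)%:C = (expR (kappa * w - expR w))%:C *
    cintegral setT (fun t => Gam (c +i* t) * cexp (- (c +i* t) * (y - w)%:C)).
  rewrite Gam_mellin; last by [].
  rewrite -rmorphM; congr (_%:C).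
  have -> : bessel_kernel kappa (expR y) w = expR (kappa * w - expR w) * expR (- expR (y - w)).
    by rewrite -expRD /bessel_kernel [expR (y - w)]expRD.
  ring.
exact: (cintegralZ (expR (kappa * w - expR w))%:C measurableT (cintegrable_Gam_line (y - w) c0)).
Qed.

(** Translating by ln r, with r the square root of q, symmetrises the exponent to kappa x - r (e^x +
    e^-x). Adding the reflected function turns e^(kappa x) into 2 cosh (kappa x), and evenness
    reduces the line to the half-line of the definition of [besselK]. *)
Lemma besselK_bessel_integral kappa q : 0 <= kappa -> 0 < q ->
  bessel_integral kappa q = 2 * (Num.sqrt q `^ kappa) * besselK kappa (2 * Num.sqrt q).
Proof.
move=> k0 q0; set r := Num.sqrt q; have r0 : 0 < r by rewrite sqrtr_gt0.
have rq : r * r = q by rewrite -expr2 sqr_sqrtr// ltW.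
pose G t := expR (kappa * t - r * (expR t + expR (- t))).
have iH := integrableT_bessel_kernel k0 q0.
have cH := @continuous_bessel_kernel kappa q.
have HG x : bessel_kernel kappa q (x + ln r) = r `^ kappa * G x.
  rewrite /bessel_kernel /G /powR gt_eqF// -expRD; congr expR.
  have -> : expR (- (x + ln r)) = expR (- x) / r by rewrite opprD expRD [expR (- ln r)]expRN lnK ?posrE.
  rewrite expRD lnK ?posrE//; have -> : q * (expR (- x) / r) = r * expR (- x).
    by rewrite -rq; field; exact: lt0r_neq0.
  ring.
have rk0 : r `^ kappa != 0 by rewrite gt_eqF// powR_gt0.
have GE x : G x = (r `^ kappa)^-1 * bessel_kernel kappa q (x + ln r).
  by rewrite HG mulKf.
have iG : integrableT G.
  have := integrableT_scale (r `^ kappa)^-1 (integrableT_shift (ln r) cH iH).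
  by under eq_fun do rewrite -GE.
have cG : continuous G.
  have -> : G = (fun x => (r `^ kappa)^-1 * bessel_kernel kappa q (x + ln r)) by apply/funext.
  move=> x; apply: cvgM; first exact: cvg_cst.
  exact: (@continuous_comp_shift R _ (ln r) cH x).
have -> : bessel_integral kappa q = r `^ kappa * \int[mu]_x G x.
  rewrite /bessel_integral -(Rintegral_shift (ln r) cH iH) -RintegralZl//.
  by apply: eq_Rintegral => x _; rewrite HG.
set B := besselK _ _; have -> : 2 * r `^ kappa * B = r `^ kappa * (2 * B) by ring.
rewrite /B; congr (_ * _).
have cGN : continuous (fun x => G (- x)).
  move=> x; apply: (@cvg_comp _ _ _ (fun x : R => - x) G _ (nbhs (- x))); last exact: cG.
  by apply: cvgN; exact: cvg_id.
pose E x := 2 * (expR (- (2 * r) * coshR x) * coshR (kappa * x)).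
have EE x : E x = G x + G (- x).
  rewrite /E /G /coshR opprK !mulrN.
  have -> : - (2 * r) * ((expR x + expR (- x)) / 2) = - (r * (expR x + expR (- x))) by field.
  rewrite !expRD [expR (- x) + _]addrC; field.
  by [].
have G0 x : 0 <= G x by exact: expR_ge0.
have [iGN eGN] := Rintegral_opp cG G0 iG.
have iE : integrableT E.
  by have := integrableT_add iG iGN; under eq_fun do rewrite -EE.
have E2 : \int[mu]_x E x = 2 * \int[mu]_x G x.
  under eq_Rintegral do rewrite EE.
  by rewrite (RintegralD measurableT iG iGN) eGN mulr_natl mulr2n.
have E0 x : 0 <= E x by rewrite EE addr_ge0.
have cE : continuous E.
  have -> : E = (fun x => G x + G (- x)) by apply/funext.
  by move=> x; apply: cvgD; [exact: cG|exact: cGN].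
have EN x : E (- x) = E x by rewrite !EE opprK addrC.
have [iE' E3] := Rintegral_even cE E0 iE EN.
have E4 : \int[mu]_(x in `[0, +oo[) E x = 2 * besselK kappa (2 * r).
  have -> : besselK kappa (2 * r) = \int[mu]_(x in `[0, +oo[) (2^-1 * E x).
    by apply: eq_Rintegral => x _; rewrite /E mulKf.
  by rewrite (@RintegralZl _ RT R mu _ _ 2^-1 (measurable_itv _) iE') mulVKf.
have := E2; rewrite E3 E4 => h.
apply: (@mulfI _ 2) => //; rewrite -h; ring.
Qed.

End Mellin.

(** * Rising factorials and Gauss's limit *)

Section RisingFactorial.
Context {K : numFieldType}.
Implicit Types a b z : K.

(** The coefficient of w^k in (1 - w)^(-a). *)
Definition rfac a k : K := pochhammer a k / k`!%:R.

Lemma fact_neq0 n : n`!%:R != 0 :> K.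
Proof. by rewrite pnatr_eq0 -lt0n fact_gt0. Qed.

Lemma rfac0 a : rfac a 0 = 1.
Proof. by rewrite /rfac /pochhammer big_ord0 fact0 divr1. Qed.

Lemma rfacS a k : rfac a k.+1 * k.+1%:R = rfac a k * (a + k%:R).
Proof.
rewrite /rfac /pochhammer big_ord_recr /= factS natrM; field.
by rewrite fact_neq0 nat1r pnatr_eq0.
Qed.

Lemma pochhammer_add a m n : pochhammer a (m + n) = pochhammer a m * pochhammer (a + m%:R) n.
Proof.
elim: n => [|n ih]; first by rewrite addn0 /pochhammer big_ord0 mulr1.
rewrite addnS /pochhammer big_ord_recr /= -/(pochhammer a (m + n)) ih.
rewrite [in RHS]big_ord_recr /= -/(pochhammer (a + m%:R) n).
by rewrite natrD -!mulrA addrA.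
Qed.

(** The coefficient form of (1 - w)^(-a) (1 - w)^(-b) = (1 - w)^(-a-b). The induction multiplies by
    N + 1 and splits it as i + (N + 1 - i), so that the recurrence [rfacS] applies to one factor in
    each half. *)
Lemma rfac_vandermonde a b N :
  \sum_(i < N.+1) rfac a i * rfac b (N - i) = rfac (a + b) N.
Proof.
elim: N => [|N ih]; first by rewrite big_ord1 !rfac0 mulr1.
have N0 : N.+1%:R != 0 :> K by rewrite pnatr_eq0.
apply: (mulIf N0); rewrite rfacS -ih.
have -> : (\sum_(i < N.+2) rfac a i * rfac b (N.+1 - i)) * N.+1%:R =
  \sum_(i < N.+2) (rfac a i * i%:R) * rfac b (N.+1 - i) +
  \sum_(i < N.+2) rfac a i * (rfac b (N.+1 - i) * (N.+1 - i)%:R).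
  rewrite big_distrl -big_split /=; apply: eq_bigr => i _.
  rewrite natrB; last by rewrite -ltnS.
  ring.
rewrite big_ord_recl mulr0 mul0r add0r.
rewrite [X in _ + X]big_ord_recr /= subnn mulr0 mulr0 addr0 -big_split /=.
rewrite big_distrl /=; apply: eq_bigr => i _.
have iN : (i <= N)%N by rewrite -ltnS.
rewrite /bump /= add1n subSS rfacS (subSn iN) rfacS (natrB _ iN).
ring.
Qed.

Lemma rfac_bin a j l : (l <= j)%N -> rfac a j * 'C(j, l)%:R = rfac a l * rfac (a + l%:R) (j - l).
Proof.
move=> lj; rewrite /rfac -{1}(subnKC lj) pochhammer_add.
have := bin_fact lj => /(congr1 (fun n : nat => n%:R : K)); rewrite !natrM => <-.
have h1 := fact_neq0 l; have h2 := fact_neq0 (j - l).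
have h3 : 'C(j, l)%:R != 0 :> K by rewrite pnatr_eq0 -lt0n bin_gt0.
by field; rewrite h1 h2 h3.
Qed.

Lemma pochhammer_nat (m n : nat) : pochhammer (m.+1%:R : K) n * m`!%:R = (m + n)`!%:R.
Proof.
elim: n => [|n ih]; first by rewrite addn0 /pochhammer big_ord0 mul1r.
rewrite /pochhammer big_ord_recr /= -/(pochhammer _ n) mulrAC ih addnS factS natrM mulrC.
by rewrite -natrD addSn.
Qed.

(** Used with a = s + nu and b = 1 - s: their sum is free of s, so the inner Vandermonde sum is a
    quotient of factorials. With 1 - z = r the left side is the sum in [weight], while the right
    side carries the alternating coefficients of [scaled_Q]. *)
Lemma rfac_mul_binomial_sum a b z (nu n : nat) : a + b = nu.+1%:R ->
  \sum_(j < n.+1) rfac b (n - j) * rfac a j * (1 - z) ^+ j =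
  (nu + n)`!%:R * \sum_(l < n.+1) (- z) ^+ l * rfac a l / ((n - l)`!%:R * (nu + l)`!%:R).
Proof.
move=> abn.
have E (j : 'I_n.+1) : (1 - z) ^+ j = \sum_(l < n.+1) 'C(j, l)%:R * (- z) ^+ l.
  rewrite exprDn (big_ord_widen n.+1 (fun l => (1 ^+ (j - l) * (- z) ^+ l) *+ 'C(j, l))) // big_mkcond /=.
  apply: eq_bigr => l _; rewrite expr1n mul1r mulr_natl; case: ifPn => //.
  by rewrite -leqNgt => jl; rewrite bin_small.
under eq_bigr => j _ do rewrite E big_distrr /=.
rewrite exchange_big /= big_distrr /=; apply: eq_bigr => l _.
have ln : (l <= n)%N by rewrite -ltnS.
transitivity ((- z) ^+ l * rfac a l * rfac (nu.+1%:R + l%:R) (n - l)); last first.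
  rewrite /rfac -natrD addSn.
  have := pochhammer_nat (nu + l) (n - l); rewrite -addnA subnKC// => <-.
  have h1 := fact_neq0 l; have h2 := fact_neq0 (n - l); have h3 := fact_neq0 (nu + l).
  by field; rewrite h1 h2 h3.
have -> : nu.+1%:R + l%:R = (a + l%:R) + b by rewrite -abn; ring.
rewrite -rfac_vandermonde big_distrr /=.
rewrite -(big_mkord xpredT (fun j => rfac b (n - j) * rfac a j * ('C(j, l)%:R * (- z) ^+ l))).
(* Terms with j < l vanish with the binomial coefficient; the others, reindexed by i = j - l, form a
   convolution of length n - l. *)
rewrite (big_cat_nat (n := l)) //=; last exact: leqW.
rewrite big_nat_cond big1 ?add0r; last first.
  by move=> j /andP[/andP[_ jl] _]; rewrite bin_small// mul0r mulr0.
rewrite -{1}[l : nat]add0n big_addn (subSn ln) big_mkord; apply: eq_bigr => i _.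
have -> : rfac b (n - (i + l)) * rfac a (i + l) * ('C(i + l, l)%:R * (- z) ^+ l) =
  rfac b (n - (i + l)) * (rfac a (i + l) * 'C(i + l, l)%:R) * (- z) ^+ l by ring.
rewrite rfac_bin ?leq_addl// addnK addnC subnDA; ring.
Qed.

End RisingFactorial.

(** * Gauss's limit formula by concentration of gamma variables *)

Section GaussLimit.
Context {R : realType}.
Notation mu := (@lebesgue_measure R).
Notation Re := (@complex.Re R).
Notation Im := (@complex.Im R).
Notation cintegral := (@cintegral R).
Notation RT := (measurableTypeR R).
Implicit Types (z a s : R[i]) (x y : R).

Lemma sin_le_id (x : R) : `|sin x| <= `|x|.
Proof.
have H (y : R) : 0 <= y -> `|sin y| <= y.
  rewrite le_eqVlt => /predU1P[<-|y0]; first by rewrite sin0 normr0.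
  have [c _ ] := @MVT R sin cos 0 y y0 (fun x _ => is_derive_sin x) (continuous_subspaceT (@continuous_sin R)).
  by rewrite sin0 !subr0 => ->; rewrite normrM (gtr0_norm y0) ler_piMl ?(ltW y0)// norm_cos_le1.
have [x0|x0] := leP 0 x; first by rewrite (ger0_norm x0) H.
by rewrite (ltr0_norm x0) -normrN -sinN H// oppr_ge0 ltW.
Qed.

Lemma cos_sub1_le (x : R) : `|cos x - 1| <= `|x|.
Proof.
have H (y : R) : 0 <= y -> `|cos y - 1| <= y.
  rewrite le_eqVlt => /predU1P[<-|y0]; first by rewrite cos0 subrr normr0.
  have [c _ ] := @MVT R cos (fun x => - sin x) 0 y y0 (fun x _ => is_derive_cos x) (continuous_subspaceT (@continuous_cos R)).
  by rewrite cos0 subr0 => ->; rewrite normrM normrN (gtr0_norm y0) ler_piMl ?(ltW y0)// norm_sin_le1.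
have [x0|x0] := leP 0 x; first by rewrite (ger0_norm x0) H.
by rewrite (ltr0_norm x0) -cosN H// oppr_ge0 ltW.
Qed.

Lemma expR_sub1_le (u : R) : `|expR u - 1| <= `|u| * (1 + expR u).
Proof.
have h1 := expR_ge1Dx u; have h2 := expR_ge1Dx (- u); have h3 := expR_gt0 u.
have h4 : expR u * expR (- u) = 1 by rewrite expRxMexpNx_1.
have [u0|u0] := leP 0 u.
  rewrite ger0_norm; last by lra.
  rewrite ger0_norm//; nra.
rewrite ler0_norm; last by rewrite subr_le0 expR_le1 ltW.
by rewrite ltr0_norm//; nra.
Qed.

Lemma cabs_cexp_sub1 z : cabs (cexp z - 1) <= `|Re z| * (1 + expR (Re z)) + 2 * `|Im z|.
Proof.
case: z => u v /=.
have -> : cexp (u +i* v) - 1 = ((expR u - 1)%:C * cexp (0 +i* v)) + (cexp (0 +i* v) - 1).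
  have -> : u +i* v = u%:C + (0 +i* v) by apply: complexP => /=; rewrite ?addr0 ?add0r.
  by rewrite cexpD cexp_real rmorphB /=; ring.
rewrite (le_trans (cabsD _ _))// lerD//.
  by rewrite cabsM cabs_cexp /= expR0 mulr1 cabs_real expR_sub1_le.
rewrite (le_trans (cabs_le_ReIm _))// cReB cImB Re_cexp Im_cexp /= expR0 !mul1r subr0.
by rewrite mulr_natl mulr2n lerD// ?cos_sub1_le ?sin_le_id.
Qed.

(** One of e^y - 1 and e^-y - 1 is at least |y|. The right side is a combination of integer powers
    of e^y, whose gamma moments are explicit. *)
Lemma sqr_le_expR (y : R) : y ^+ 2 <= (expR y - 1) ^+ 2 + (expR (- y) - 1) ^+ 2.
Proof.
have h1 := expR_ge1Dx y; have h2 := expR_ge1Dx (- y).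
have [y0|y0] := leP 0 y.
  have : y ^+ 2 <= (expR y - 1) ^+ 2 by rewrite ler_sqr ?nnegrE//; lra.
  by have := sqr_ge0 (expR (- y) - 1); lra.
have : (- y) ^+ 2 <= (expR (- y) - 1) ^+ 2 by rewrite ler_sqr ?nnegrE//; lra.
by rewrite sqrrN; have := sqr_ge0 (expR y - 1); lra.
Qed.

Lemma cvg_ratio (a b : R) : 0 <= b -> (n%:R + a) / (n.+1%:R + b) @[n --> \oo] --> (1 : R).
Proof.
move=> b0.
have -> : (fun n : nat => (n%:R + a) / (n.+1%:R + b)) = (fun n : nat => 1 + (a - 1 - b) * (n.+1%:R + b)^-1).
  apply/funext => n; rewrite -natr1.
  have : (n%:R + 1 + b) != 0 :> R by rewrite gt_eqF// ltr_wpDr// ltr_wpDl.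
  by move=> ?; field.
rewrite -[X in _ --> X](addr0 (1 : R)); apply: cvgD; first exact: cvg_cst.
rewrite -[X in _ --> X](mulr0 (a - 1 - b)); apply: cvgM; first exact: cvg_cst.
apply: (@squeeze_cvgr _ _ _ _ (fun=> 0) (fun n => n.+1%:R^-1)); first 1 last.
- exact: cvg_cst.
- exact: cvg_harmonic.
apply: nearW => n; rewrite invr_ge0 addr_ge0//= lef_pV2 ?posrE ?ltr_wpDr//.
by rewrite lerDl.
Qed.

(* gamma_moment Q j m = E[(V/(m+Q+1))^(j-Q)] for V Gamma-distributed with parameter m+Q+1 *)
Definition gamma_moment (Q j m : nat) : R :=
  gamr (m.+1%:R + j%:R) * (m + Q).+1%:R ^+ Q / ((m + Q)`!%:R * (m + Q).+1%:R ^+ j).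

Lemma gamma_momentS Q j m : gamma_moment Q j.+1 m = gamma_moment Q j m * ((m%:R + j.+1%:R) / (m.+1%:R + Q%:R)).
Proof.
have e : m.+1%:R + j.+1%:R = (m.+1%:R + j%:R) + 1 :> R by rewrite -addrA natr1.
rewrite /gamma_moment e gamrS; last by rewrite -natrD ltr0n.
have -> : m.+1%:R + j%:R = m%:R + j.+1%:R :> R by rewrite -!natrD addSnnS.
have -> : m.+1%:R + Q%:R = (m + Q).+1%:R :> R by rewrite -natrD addSn.
rewrite exprS.
have h1 := @fact_neq0 R (m + Q).
have h2 : (m + Q).+1%:R != 0 :> R by rewrite pnatr_eq0.
have h3 : (m + Q).+1%:R ^+ j != 0 :> R by rewrite expf_neq0.
set N := (m + Q).+1%:R in h2 h3 *; set G := gamr _; set M := N ^+ j in h3 *; set P := N ^+ Q.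
by clearbody N G M P; field; rewrite ?h1 ?h2 ?h3.
Qed.

(** The offset p is left free because the induction on Q raises it by one. *)
Lemma fact_ratio_cvg (Q p : nat) : m`!%:R * (m + Q + p).+1%:R ^+ Q / (m + Q)`!%:R @[m --> \oo] --> (1 : R).
Proof.
elim: Q p => [|Q ih] p.
  have -> : (fun m : nat => m`!%:R * (m + 0 + p).+1%:R ^+ 0 / (m + 0)`!%:R) = (fun=> 1 : R).
    by apply/funext => m; rewrite addn0 expr0 mulr1 divff// fact_neq0.
  exact: cvg_cst.
have -> : (fun m : nat => m`!%:R * (m + Q.+1 + p).+1%:R ^+ Q.+1 / (m + Q.+1)`!%:R) =
  (fun m : nat => (m`!%:R * (m + Q + p.+1).+1%:R ^+ Q / (m + Q)`!%:R) * ((m%:R + Q.+1%:R) / (m.+1%:R + (Q.+1 + p)%:R))^-1 : R).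
  apply/funext => m; rewrite addnS !addSn addnS factS natrM exprS.
  have -> : m%:R + Q.+1%:R = (m + Q).+1%:R :> R by rewrite -natrD addnS.
  have -> : m.+1%:R + (Q.+1 + p)%:R = (m + Q + p).+2%:R :> R by rewrite -natrD !addnA addSn addnS addSn.
  have h1 := @fact_neq0 R (m + Q).
  have h2 : (m + Q).+1%:R != 0 :> R by rewrite pnatr_eq0.
  have h3 : (m + Q + p).+2%:R != 0 :> R by rewrite pnatr_eq0.
  rewrite invf_div; set x := (m + Q).+1%:R in h2 *; set y := (_ ^+ _); set w := (m + Q + p).+2%:R in h3 *.
  clearbody x y w; by field; rewrite ?h1 ?h2.
rewrite -[X in _ --> X](mulr1 (1 : R)); apply: cvgM; first exact: ih.
rewrite -[X in _ --> X](@invr1 R); apply: cvgV; first exact: oner_neq0.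
exact: cvg_ratio.
Qed.

Lemma gamma_moment_cvg Q j : gamma_moment Q j m @[m --> \oo] --> (1 : R).
Proof.
elim: j => [|j ih].
  have -> : gamma_moment Q 0 = (fun m : nat => m`!%:R * (m + Q + 0).+1%:R ^+ Q / (m + Q)`!%:R).
    by apply/funext => m; rewrite /gamma_moment addr0 gamr_nat expr0 mulr1 addn0.
  exact: fact_ratio_cvg.
have -> : gamma_moment Q j.+1 = (fun m => gamma_moment Q j m * ((m%:R + j.+1%:R) / (m.+1%:R + Q%:R))).
  by apply/funext => m; rewrite gamma_momentS.
by rewrite -[X in _ --> X](mulr1 (1 : R)); apply: cvgM => //; exact: cvg_ratio.
Qed.

(** The density of X = ln V, for V as in [gamma_moment]; in terms of X, [power_ratio] is (V / (m + Q
    + 1))^(j - Q). *)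
Definition gamma_density (Q m : nat) (x : R) : R :=
  expR ((m + Q).+1%:R * x - expR x) / (m + Q)`!%:R.

Definition power_ratio (Q j m : nat) (x : R) : R := expR ((j%:R - Q%:R) * (x - ln (m + Q).+1%:R)).

Lemma gamma_density_power_ratioE Q j m x :
  gamma_density Q m x * power_ratio Q j m x =
  ((m + Q).+1%:R ^+ Q / ((m + Q)`!%:R * (m + Q).+1%:R ^+ j)) * expR ((m.+1%:R + j%:R) * x - expR x).
Proof.
rewrite /gamma_density /power_ratio; set N : R := (m + Q).+1%:R.
have N0 : 0 < N by rewrite /N ltr0n.
have e : expR ((j%:R - Q%:R) * (x - ln N)) = expR ((j%:R - Q%:R) * x) * (N ^+ Q / N ^+ j).
  have -> : (j%:R - Q%:R) * (x - ln N) = (j%:R - Q%:R) * x + (Q%:R * ln N - j%:R * ln N) by ring.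
  by rewrite expRD expRB !expRM_natl lnK.
have e2 : expR ((m.+1%:R + j%:R) * x - expR x) = expR (N * x - expR x) * expR ((j%:R - Q%:R) * x).
  rewrite -expRD; congr expR.
  have -> : N = m.+1%:R + Q%:R by rewrite /N -natrD addSn.
  ring.
rewrite e e2.
have h1 := @fact_neq0 R (m + Q).
have h2 : N ^+ j != 0 by rewrite expf_neq0// gt_eqF.
by field; rewrite h1 h2.
Qed.

Lemma integrableT_gamma_density_power_ratio Q j m : integrableT (fun x => gamma_density Q m x * power_ratio Q j m x).
Proof.
under eq_fun do rewrite gamma_density_power_ratioE.
apply: integrableT_scale; apply: integrableT_gam_kernel.
by rewrite -natrD ltr0n.
Qed.

Lemma Rintegral_gamma_density_power_ratio Q j m : \int[mu]_x (gamma_density Q m x * power_ratio Q j m x) = gamma_moment Q j m.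
Proof.
transitivity (\int[mu]_x (((m + Q).+1%:R ^+ Q / ((m + Q)`!%:R * (m + Q).+1%:R ^+ j)) * expR ((m.+1%:R + j%:R) * x - expR x))).
  by apply: eq_Rintegral => x _; rewrite gamma_density_power_ratioE.
have h : 0 < m.+1%:R + j%:R :> R by rewrite -natrD ltr0n.
rewrite (RintegralZl _ measurableT (integrableT_gam_kernel h)) /gamma_moment gamrE.
by rewrite mulrC mulrA.
Qed.

Lemma Rintegral_gamma_density_sum Q m (l : seq (R * nat)) :
  integrableT (fun x => gamma_density Q m x * \sum_(q <- l) q.1 * power_ratio Q q.2 m x) /\
  \int[mu]_x (gamma_density Q m x * \sum_(q <- l) q.1 * power_ratio Q q.2 m x) = \sum_(q <- l) q.1 * gamma_moment Q q.2 m.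
Proof.
elim: l => [|q l [ih1 ih2]].
  have e : (fun x => gamma_density Q m x * \sum_(q <- [::]) q.1 * power_ratio Q q.2 m x) = (fun x => 0 * (gamma_density Q m x * power_ratio Q Q m x)).
    by apply/funext => x; rewrite big_nil mulr0 mul0r.
  rewrite e; split; first by apply: integrableT_scale; exact: integrableT_gamma_density_power_ratio.
  by rewrite (RintegralZl _ measurableT (integrableT_gamma_density_power_ratio Q Q m)) mul0r big_nil.
have e : (fun x => gamma_density Q m x * \sum_(q <- q :: l) q.1 * power_ratio Q q.2 m x) =
  (fun x => q.1 * (gamma_density Q m x * power_ratio Q q.2 m x) + gamma_density Q m x * \sum_(q <- l) q.1 * power_ratio Q q.2 m x).
  by apply/funext => x; rewrite big_cons; ring.
have i1 := integrableT_scale q.1 (integrableT_gamma_density_power_ratio Q q.2 m).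
rewrite e; split; first exact: integrableT_add.
rewrite (RintegralD measurableT i1 ih1) ih2 big_cons.
by rewrite (RintegralZl _ measurableT (integrableT_gamma_density_power_ratio Q q.2 m)) Rintegral_gamma_density_power_ratio.
Qed.

Lemma cvg_sum_gamma_moment Q (l : seq (R * nat)) :
  (\sum_(q <- l) q.1 * gamma_moment Q q.2 m) @[m --> \oo] --> \sum_(q <- l) q.1.
Proof.
elim: l => [|q l ih].
  by rewrite big_nil; under eq_fun do rewrite big_nil; exact: cvg_cst.
rewrite big_cons; under eq_fun do rewrite big_cons.
apply: cvgD; last exact: ih.
rewrite -[X in _ --> X](mulr1 q.1); apply: cvgM; first exact: cvg_cst.
exact: gamma_moment_cvg.
Qed.

(* Coefficients and exponents of a sum of powers of e^y dominating
   |e^(zy) - 1|, with total coefficient 4 C eta: by AM-GM,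
   2 |y| <= eta + y^2 / eta. *)
Definition majorant_terms (L : nat) (C eta : R) : seq (R * nat) :=
  [seq (C * q.1, q.2) | q <- flatten [seq
     [:: (eta * k.1, k.2.+2); (eta^-1 * k.1, k.2.+4); (- 2 * eta^-1 * k.1, k.2.+3);
         (2 * eta^-1 * k.1, k.2.+2); (- 2 * eta^-1 * k.1, k.2.+1); (eta^-1 * k.1, k.2)]
     | k <- [:: (2, L); (1, (L + L)%N); (1, 0%N)]]].

Lemma majorant_terms_sum L C eta : \sum_(q <- majorant_terms L C eta) q.1 = 4 * C * eta.
Proof.
rewrite /majorant_terms big_map /= !big_cons big_nil /=.
set e := eta^-1; ring.
Qed.

(** The lowest power of e^y on the right is -(L + 2); the shift by L + 2 in [power_ratio] makes all
    exponents of the list natural numbers. *)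
Lemma majorant_terms_power_ratio L C eta m x : let y := x - ln (m + L.+2).+1%:R in
  \sum_(q <- majorant_terms L C eta) q.1 * power_ratio L.+2 q.2 m x =
  C * ((2 + expR (L%:R * y) + expR (- (L%:R * y))) *
       (eta + eta^-1 * ((expR y - 1) ^+ 2 + (expR (- y) - 1) ^+ 2))).
Proof.
move=> y; rewrite /majorant_terms big_map /= !big_cons big_nil /= /power_ratio -/y.
have e j : expR ((j%:R - L.+2%:R) * y) = expR (- (L%:R * y)) * expR (- y) ^+ 2 * expR y ^+ j.
  rewrite -!expRM_natl -!expRD; congr expR.
  by rewrite -[L.+2]addn2 natrD; ring.
rewrite !e -[(L + L).+4]addn4 -[(L + L).+3]addn3 -[(L + L).+2]addn2 -[(L + L).+1]addn1.
rewrite -[L.+4]addn4 -[L.+3]addn3 -[L.+2]addn2 -[L.+1]addn1 !exprD.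
have -> : expR y ^+ L = expR (L%:R * y) by rewrite expRM_natl.
have E1 : expR (L%:R * y) * expR (- (L%:R * y)) = 1 by rewrite -expRD subrr expR0.
have E2 : expR y * expR (- y) = 1 by rewrite -expRD subrr expR0.
set A := expR (L%:R * y) in E1 *; set A' := expR (- (L%:R * y)) in E1 *.
set w := expR y in E2 *; set w' := expR (- y) in E2 *; set e0 := eta^-1.
have A0 : A != 0 by rewrite gt_eqF// expR_gt0.
have w0 : w != 0 by rewrite gt_eqF// expR_gt0.
have -> : A' = A^-1 by apply: (mulfI A0); rewrite E1 mulfV.
have -> : w' = w^-1 by apply: (mulfI w0); rewrite E2 mulfV.
clearbody A A' w w' e0; field; by rewrite A0 w0.
Qed.

(** In the elementary estimate of e^(z y) - 1, the exponential of Re z * y is replaced by e^(L y) +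
    e^(-L y) to reach integer exponents, and the factor |y| is removed at the price of the parameter
    eta. *)
Lemma cexp_sub1_majorant_terms z (L : nat) (eta : R) (m : nat) x : `|Re z| <= L%:R -> 0 < eta ->
  cabs (cexp (z * (x - ln (m + L.+2).+1%:R)%:C) - 1) <=
  \sum_(q <- majorant_terms L ((L%:R + 2 * `|Im z|) / 2) eta) q.1 * power_ratio L.+2 q.2 m x.
Proof.
move=> zL eta0; rewrite majorant_terms_power_ratio; set y := x - _; set C := L%:R + 2 * `|Im z|.
set A := expR (L%:R * y); set A' := expR (- (L%:R * y)).
have A0 : 0 < A by exact: expR_gt0.
have A'0 : 0 < A' by exact: expR_gt0.
have C0 : 0 <= C by rewrite addr_ge0// mulr_ge0.
rewrite (le_trans (cabs_cexp_sub1 _))// cReM cImM /= !mulr0 subr0 add0r !normrM.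
have h1 : expR (Re z * y) <= A + A'.
  have : `|Re z * y| <= `|L%:R * y| by rewrite !normrM (ger0_norm (ler0n R L)) ler_wpM2r.
  have [y0|y0] := leP 0 (L%:R * y).
    rewrite (ger0_norm y0) ler_norml => /andP[_ h].
    by rewrite (le_trans (_ : _ <= A))// ?ler_expR// lerDl ltW.
  rewrite (ltr0_norm y0) ler_norml => /andP[_ h].
  by rewrite (le_trans (_ : _ <= A'))// ?ler_expR// lerDr ltW.
have h2 : `|Re z| * `|y| * (1 + expR (Re z * y)) + 2 * (`|Im z| * `|y|) <= C * `|y| * (2 + A + A').
  have z0 := normr_ge0 (Im z); have y0 := normr_ge0 y; have z0' := normr_ge0 (Re z).
  have e0 := expR_gt0 (Re z * y).
  apply: (@le_trans _ _ (L%:R * `|y| * (2 + A + A') + 2 * `|Im z| * `|y| * (2 + A + A'))); last by rewrite /C; lra.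
  apply: lerD.
    apply: ler_pM; [by rewrite mulr_ge0|by lra|by rewrite ler_wpM2r|by lra].
  by rewrite mulrA ler_peMr ?mulr_ge0//; lra.
apply: (le_trans h2).
rewrite -[leRHS]mulrA [leRHS]mulrCA -[leRHS]mulrCA -mulrA ler_wpM2l// mulrC mulrCA ler_wpM2l//; first by lra.
have h3 := sqr_le_expR y; set B := _ ^+ 2 + _ ^+ 2 in h3 *.
have h4 : `|y| * eta * 2 <= eta ^+ 2 + y ^+ 2.
  by have := sqr_ge0 (`|y| - eta); rewrite sqrrB real_normK ?num_real//; lra.
rewrite mulrC ler_pdivlMr// -(ler_pM2r eta0).
have -> : (eta + eta^-1 * B) * eta = eta ^+ 2 + B by field; rewrite gt_eqF.
lra.
Qed.

Lemma gamma_densityE Q m x : gamma_density Q m x = gamma_density Q m x * power_ratio Q Q m x.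
Proof. by rewrite /power_ratio subrr mul0r expR0 mulr1. Qed.

Lemma gamma_density_ge0 Q m x : 0 <= gamma_density Q m x.
Proof. by rewrite /gamma_density divr_ge0 ?expR_ge0. Qed.

(** The Gamma ratio is the expectation of (V / (m + Q + 1))^(z - 1); the total mass of the density
    is 1, so the subtracted 1 goes under the integral sign. *)
Lemma Gam_ratio_gamma_density z (Q m : nat) : 0 < Re (z + (m + Q)%:R) ->
  Gam (z + (m + Q)%:R) * cexp (- (z - 1) * (ln (m + Q).+1%:R)%:C) / (m + Q)`!%:R - 1 =
  cintegral setT (fun x => (gamma_density Q m x)%:C * (cexp ((z - 1) * (x - ln (m + Q).+1%:R)%:C) - 1)) /\
  cmeasurable (setT : set RT) (fun x => (gamma_density Q m x)%:C * (cexp ((z - 1) * (x - ln (m + Q).+1%:R)%:C) - 1)).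
Proof.
move=> z0; set N := (m + Q).+1%:R : R; set c := cexp (- (z - 1) * (ln N)%:C) / (m + Q)`!%:R.
have ik : integrableT (gamma_density Q m).
  have := integrableT_gamma_density_power_ratio Q Q m; rewrite /integrableT.
  by under eq_fun do rewrite -gamma_densityE.
have ik1 : \int[mu]_x gamma_density Q m x = 1.
  have := Rintegral_gamma_density_power_ratio Q Q m.
  under eq_Rintegral do rewrite -gamma_densityE.
  move=> ->; rewrite /gamma_moment -natrD gamr_nat.
  have h : (m + Q).+1%:R ^+ Q != 0 :> R by rewrite expf_neq0// pnatr_eq0.
  have h1 := @fact_neq0 R (m + Q).
  by rewrite divff// mulf_neq0.
have E x : (gamma_density Q m x)%:C * (cexp ((z - 1) * (x - ln N)%:C) - 1) =
   c * cexp ((z + (m + Q)%:R) * x%:C - (expR x)%:C) - (gamma_density Q m x)%:C.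
  rewrite mulrBr mulr1; congr (_ - _).
  rewrite /c /gamma_density rmorphM /= fmorphV /= rmorph_nat mulrAC [RHS]mulrAC; congr (_ / _).
  rewrite -cexp_real -!cexpD; congr cexp.
  rewrite !rmorphB !rmorphM /= /N rmorph_nat -natr1; ring.
have i1 := cintegrable_gam_kernel z0.
have i2 := cintegrableZ c measurableT i1.
have i3 := cintegrable_real measurableT ik.
split.
  transitivity (cintegral setT (fun x => c * cexp ((z + (m + Q)%:R) * x%:C - (expR x)%:C) - (gamma_density Q m x)%:C)).
    rewrite (cintegralB measurableT i2 i3) (cintegralZ c measurableT i1) -GamE.
    by rewrite (cintegral_real _ measurableT) ik1 /c; congr (_ - _); ring.
  by apply: eq_cintegral => x _; rewrite E.
under eq_fun do rewrite E.
by apply: cmeasurableD; [exact: cintegrable_measurable|apply: cmeasurableN; exact: cintegrable_measurable].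
Qed.

(** Concentration: V / (n + 1) tends to 1 in every moment, so the expectation of the majorant tends
    to the sum of its coefficients, 4 C eta, with eta at our disposal. For small n the point z + n
    may lie outside the half-plane where Euler's integral converges; the shift by Q discards these
    indices. *)
Theorem Gam_ratio_cvg z :
  ccvg (fun n => Gam (z + n%:R) * cexp (- (z - 1) * (ln n.+1%:R)%:C) / n`!%:R) 1.
Proof.
set L := (Num.truncn `|Re (z - 1)|).+1; pose Q := L.+2.
have zL : `|Re (z - 1)| <= L%:R by rewrite ltW// truncnS_gt.
apply: (@ccvg_shift R _ _ Q).
set C := (L%:R + 2 * `|Im (z - 1)|) / 2.
have C0 : 0 <= C by rewrite divr_ge0// addr_ge0// mulr_ge0.
have z0 m : 0 < Re (z + (m + Q)%:R).
  rewrite cReD cRe_nat; move: zL; rewrite cReB /= ler_norml => /andP[h _].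
  have : L%:R < (m + Q)%:R :> R by rewrite ltr_nat /Q (leq_trans _ (leq_addl m _)).
  rewrite -[1]/(1%:R : R) in h; lra.
have main eta m : 0 < eta -> cabs (Gam (z + (m + Q)%:R) * cexp (- (z - 1) * (ln (m + Q).+1%:R)%:C) / (m + Q)`!%:R - 1) <=
    2 * \sum_(q <- majorant_terms L C eta) q.1 * gamma_moment Q q.2 m.
  move=> eta0; have [-> mm] := Gam_ratio_gamma_density (z0 m).
  have [iw <-] := Rintegral_gamma_density_sum Q m (majorant_terms L C eta).
  have b x : cabs ((gamma_density Q m x)%:C * (cexp ((z - 1) * (x - ln (m + Q).+1%:R)%:C) - 1)) <=
    gamma_density Q m x * \sum_(q <- majorant_terms L C eta) q.1 * power_ratio Q q.2 m x.
    rewrite cabsM cabs_real ger0_norm ?gamma_density_ge0// ler_wpM2l ?gamma_density_ge0//.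
    exact: cexp_sub1_majorant_terms.
  by apply: (cabs_cintegral measurableT (cintegrable_le measurableT mm iw (fun x _ => b x)) iw (fun x _ => b x)).
apply/cvgrPdist_lt => e e0.
(* The bound tends to 2 * 4 C eta, which this choice keeps below e. *)
pose eta := e / (16 * C + 1).
have D0 : 0 < 16 * C + 1 by rewrite ltr_wpDl// mulr_ge0.
have eta0 : 0 < eta by rewrite divr_gt0.
have lim := @cvg_sum_gamma_moment Q (majorant_terms L C eta); rewrite majorant_terms_sum in lim.
have small : 4 * C * eta < e / 2.
  have ee : e = 16 * (C * eta) + eta by rewrite /eta; field; rewrite gt_eqF.
  have := mulr_ge0 C0 (ltW eta0); lra.
near=> m; rewrite sub0r normrN ger0_norm ?cabs_ge0//.
apply: (le_lt_trans (main eta m eta0)).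
rewrite mulrC -ltr_pdivlMr//.
by near: m; apply: (cvgr_lt _ lim).
Unshelve. all: by end_near. Qed.

(** A zero at z would propagate to all z + n by the functional equation and contradict the limit
    1. *)
Lemma Gam_neq0 z : 0 < Re z -> Gam z != 0.
Proof.
move=> z0; apply/eqP => h.
have := Gam_ratio_cvg z.
have -> : (fun n : nat => Gam (z + n%:R) * cexp (- (z - 1) * (ln n.+1%:R)%:C) / n`!%:R) = (fun=> 0).
  by apply/funext => n; rewrite Gam_addn// h mulr0 !mul0r.
move=> /ccvg_unique/(_ (ccvg_cst 0)) /eqP.
by rewrite oner_eq0.
Qed.

(** The reciprocal form treats the poles uniformly: there the rising factorial contains a zero
    factor and both sides are 0. *)
Lemma cgammaE z : exists m : nat, 0 < Re (z + m%:R) /\ (cgamma z)^-1 = pochhammer z m / Gam (z + m%:R).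
Proof.
rewrite /cgamma; case: ifPn => [z0|].
  by exists 0%N; rewrite addr0 pochhammer0 euler_gammaE// mul1r.
rewrite -leNgt => z0; set m := (Num.truncn (- Re z)).+1.
have m0 : 0 < Re (z + m%:R).
  by rewrite cReD cRe_nat -ltrBlDl sub0r /m truncnS_gt.
by exists m; split => //; rewrite euler_gammaE// invf_div.
Qed.

Lemma cgamma_pos z : 0 < Re z -> cgamma z = Gam z.
Proof. by move=> z0; rewrite /cgamma z0 euler_gammaE. Qed.

(** Gauss's formula for 1 / Gamma on the whole plane; it will be applied at 1 - s, whose real part
    may have either sign. *)
Theorem rfac_cvg z :
  ccvg (fun n => cexp ((1 - z) * (ln n.+1%:R)%:C) * rfac z n) (cgamma z)^-1.
Proof.
have [m [m0 ->]] := cgammaE z.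
have G0 := Gam_neq0 m0.
apply: (@ccvg_shift R _ _ m).
have h := ccvg_shift' m (Gam_ratio_cvg z).
have := ccvgM (ccvg_cst (pochhammer z m / Gam (z + m%:R))) h; rewrite mulr1.
apply: ccvg_ext => k.
have -> : z + (k + m)%:R = (z + m%:R) + k%:R by rewrite natrD; ring.
rewrite (Gam_addn k m0) /rfac (addnC k m) pochhammer_add opprB.
have h1 := @fact_neq0 R[i] (m + k).
by field; rewrite h1 G0.
Qed.

End GaussLimit.
#[local] Opaque rfac.

(** * Mellin-Barnes weights and their limit *)

Section MellinWeights.
Context {R : realType}.
Notation mu := (@lebesgue_measure R).
Notation Re := (@complex.Re R).
Notation Im := (@complex.Im R).
Notation cintegral := (@cintegral R).
Notation RT := (measurableTypeR R).
Implicit Types (z a s : R[i]) (x y c r : R).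

Lemma exp_series_cvg (u : R) : \sum_(j < J) (u ^+ j / j`!%:R) @[J --> \oo] --> expR u.
Proof.
have := is_cvg_series_exp_coeff u; rewrite /expR => /cvg_toP/(_ erefl).
rewrite /series /=; under eq_fun do rewrite big_mkord; by [].
Qed.

Lemma exp_series_le (u : R) J : 0 <= u -> \sum_(j < J) (u ^+ j / j`!%:R) <= expR u.
Proof.
move=> u0; rewrite -(cvg_lim _ (@exp_series_cvg u))//.
apply: (nondecreasing_cvgn_le (u_ := fun J => \sum_(j < J) (u ^+ j / j`!%:R))).
  apply/nondecreasing_seqP => n; rewrite big_ord_recr /= lerDl.
  by rewrite divr_ge0// exprn_ge0.
by apply/cvg_ex; exists (expR u); exact: exp_series_cvg.
Qed.

Lemma integrableT_gam_scale (c la : R) : 0 < c -> 0 < la ->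
  integrableT (fun x => expR (c * x - la * expR x)).
Proof.
move=> c0 l0.
have := integrableT_scale (expR (- (c * ln la))) (integrableT_shift (ln la) (@continuous_gam_kernel R c) (integrableT_gam_kernel c0)).
rewrite /integrableT; apply: eq_integrable => // x _ /=; congr EFin.
by rewrite -expRD; congr expR; rewrite [expR (x + _)]expRD lnK//; ring.
Qed.

Lemma continuous_gam_trig (c b : R) (h : R -> R) : continuous h ->
  continuous (fun x => expR (c * x - expR x) * h (b * x)).
Proof.
move=> ch x; apply: cvgM; first exact: continuous_gam_kernel.
apply: (@cvg_comp _ _ _ (fun x : R => b * x) h _ (nbhs (b * x))); last exact: ch.
by apply: cvgM; [exact: cvg_cst|exact: cvg_id].
Qed.

Lemma Gam_scale a la : 0 < Re a -> 0 < la ->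
  cintegral setT (fun x => cexp (a * x%:C - (la * expR x)%:C)) = cexp (- a * (ln la)%:C) * Gam a.
Proof.
move=> a0 l0.
have i0 := cintegrable_gam_kernel a0.
pose f x := cexp (a * x%:C - (expR x)%:C).
have fE x : cexp (- a * (ln la)%:C) * f (x + ln la) = cexp (a * x%:C - (la * expR x)%:C).
  rewrite /f -cexpD; congr cexp; rewrite [expR (x + _)]expRD lnK// !rmorphD !rmorphM /=; ring.
have c1 : continuous (fun x => Re (f x)).
  have -> : (fun x => Re (f x)) = (fun x => expR (Re a * x - expR x) * cos (Im a * x)).
    by apply/funext => x; rewrite Re_cexp Re_gam_arg Im_gam_arg.
  by apply: continuous_gam_trig; exact: continuous_cos.
have c2 : continuous (fun x => Im (f x)).
  have -> : (fun x => Im (f x)) = (fun x => expR (Re a * x - expR x) * sin (Im a * x)).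
    by apply/funext => x; rewrite Im_cexp Re_gam_arg Im_gam_arg.
  by apply: continuous_gam_trig; exact: continuous_sin.
have [is0 es0] := cintegral_shift (ln la) c1 c2 i0.
transitivity (cintegral setT (fun x => cexp (- a * (ln la)%:C) * f (x + ln la))).
  by apply: eq_cintegral => x _; rewrite fE.
by rewrite (cintegralZ _ measurableT is0) GamE es0.
Qed.

(** Under the integral the sum is a partial sum of the exponential series of r e^x, so it is bounded
    by the integral in which e^x is replaced by (1 - r) e^x. This one converges because r < 1. *)
Lemma gamr_series_bound c r : 0 < c -> 0 <= r -> r < 1 ->
  exists M : R, forall J, \sum_(j < J) (r ^+ j / j`!%:R * gamr (c + j%:R)) <= M.
Proof.
move=> c0 r0 r1; exists (\int[mu]_x expR (c * x - (1 - r) * expR x)) => J.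
have r10 : 0 < 1 - r by rewrite subr_gt0.
have cj j : 0 < c + j%:R by rewrite ltr_wpDr.
have ik (j : nat) : integrableT (fun x => r ^+ j / j`!%:R * expR ((c + j%:R) * x - expR x)).
  by apply: integrableT_scale; exact: integrableT_gam_kernel.
have H : integrableT (fun x => \sum_(j < J) (r ^+ j / j`!%:R * expR ((c + j%:R) * x - expR x))) /\
  \int[mu]_x (\sum_(j < J) (r ^+ j / j`!%:R * expR ((c + j%:R) * x - expR x))) = \sum_(j < J) (r ^+ j / j`!%:R * gamr (c + j%:R)).
  elim: J => [|J [ih1 ih2]].
    have e : (fun x => \sum_(j < 0) (r ^+ j / j`!%:R * expR ((c + j%:R) * x - expR x))) = (fun x => 0 * (r ^+ 0 / 0`!%:R * expR ((c + 0%:R) * x - expR x))).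
      by apply/funext => x; rewrite big_ord0 mul0r.
    rewrite e; split; first by apply: integrableT_scale; exact: ik.
    by rewrite (RintegralZl 0 measurableT (ik 0%N)) mul0r big_ord0.
  have e : (fun x => \sum_(j < J.+1) (r ^+ j / j`!%:R * expR ((c + j%:R) * x - expR x))) = (fun x => \sum_(j < J) (r ^+ j / j`!%:R * expR ((c + j%:R) * x - expR x)) + r ^+ J / J`!%:R * expR ((c + J%:R) * x - expR x)).
    by apply/funext => x; rewrite big_ord_recr.
  rewrite e; split; first exact: (integrableT_add ih1 (ik J)).
  rewrite (RintegralD measurableT ih1 (ik J)) ih2 big_ord_recr /=.
  by rewrite (RintegralZl _ measurableT (integrableT_gam_kernel (cj J))) -gamrE.
case: H => H1 <-.
apply: (le_Rintegral measurableT H1 (integrableT_gam_scale c0 r10)) => x _.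
have -> : \sum_(j < J) (r ^+ j / j`!%:R * expR ((c + j%:R) * x - expR x)) =
  expR (c * x - expR x) * \sum_(j < J) ((r * expR x) ^+ j / j`!%:R).
  rewrite big_distrr; apply: eq_bigr => j _ /=.
  have -> : expR ((c + j%:R) * x - expR x) = expR (c * x - expR x) * expR x ^+ j.
    by rewrite -expRM_natl -expRD; congr expR; ring.
  by rewrite exprMn; ring.
have -> : expR (c * x - (1 - r) * expR x) = expR (c * x - expR x) * expR (r * expR x).
  by rewrite -expRD; congr expR; ring.
by rewrite ler_wpM2l ?expR_ge0// exp_series_le// mulr_ge0// expR_ge0.
Qed.

(** The binomial series of (1 - r)^(-a) multiplied by Gamma a, summed under Euler's integral by
    dominated convergence. *)
Lemma Gam_series_cvg a r : 0 < Re a -> 0 <= r -> r < 1 ->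
  ccvg (fun J => \sum_(j < J) (r ^+ j / j`!%:R)%:C * Gam (a + j%:R))
       (cexp (- a * (ln (1 - r))%:C) * Gam a).
Proof.
move=> a0 r0 r1; have r10 : 0 < 1 - r by rewrite subr_gt0.
rewrite -(Gam_scale a0 r10).
pose f J x : R[i] := (\sum_(j < J) ((r * expR x) ^+ j / j`!%:R))%:C * cexp (a * x%:C - (expR x)%:C).
have fE J x : f J x = \sum_(j < J) (r ^+ j / j`!%:R)%:C * cexp ((a + j%:R) * x%:C - (expR x)%:C).
  rewrite /f rmorph_sum big_distrl /=; apply: eq_bigr => j _.
  have -> : (a + j%:R) * x%:C - (expR x)%:C = (a * x%:C - (expR x)%:C) + (j%:R * x)%:C.
    by rewrite rmorphM /= rmorph_nat; ring.
  rewrite (cexpD _ (j%:R * x)%:C) cexp_real expRM_natl exprMn !rmorphM /= !rmorphXn /=; ring.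
have aj j : 0 < Re (a + j%:R) by exact: Re_gt0_addn.
have ij (j : nat) := cintegrableZ (r ^+ j / j`!%:R)%:C measurableT (cintegrable_gam_kernel (aj j)).
have fI J : cintegral setT (f J) = \sum_(j < J) (r ^+ j / j`!%:R)%:C * Gam (a + j%:R).
  transitivity (cintegral setT (fun x => \sum_(j < J) (r ^+ j / j`!%:R)%:C * cexp ((a + j%:R) * x%:C - (expR x)%:C))).
    by apply: eq_cintegral => x _; rewrite fE.
  rewrite (@cintegral_sum R _ 'I_J (index_enum _) (fun (j : 'I_J) x => (r ^+ j / j`!%:R)%:C * cexp ((a + j%:R) * x%:C - (expR x)%:C)) measurableT (fun j : 'I_J => ij j)); apply: eq_bigr => j _.
  by rewrite (cintegralZ _ measurableT (cintegrable_gam_kernel (aj j))) -GamE.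
apply: ccvg_ext fI _.
apply: (proj2 (ccvg_dominated (h := fun x => expR (Re a * x - (1 - r) * expR x)) measurableT _ _ _ _)).
- move=> J; apply: cmeasurableM; last exact: cmeasurable_gam_kernel.
  apply: cmeasurable_real; apply: measurable_sum => j.
  apply: measurable_funM; last exact: measurable_cst.
  apply: measurable_funX; apply: measurable_funM; [exact: measurable_cst|exact: measurable_expR].
- exact: integrableT_gam_scale.
- move=> J x _; rewrite cabsM cabs_gam_kernel cabs_real ger0_norm; last first.
    by apply: sumr_ge0 => j _; rewrite divr_ge0// exprn_ge0// mulr_ge0// expR_ge0.
  have -> : expR (Re a * x - (1 - r) * expR x) = expR (r * expR x) * expR (Re a * x - expR x).
    by rewrite -expRD; congr expR; ring.
  by rewrite ler_wpM2r ?expR_ge0// exp_series_le// mulr_ge0// expR_ge0.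
- move=> x _.
  have -> : cexp (a * x%:C - ((1 - r) * expR x)%:C) = (expR (r * expR x))%:C * cexp (a * x%:C - (expR x)%:C).
    rewrite -cexp_real -cexpD; congr cexp; rewrite !rmorphM !rmorphB /=; ring.
  apply: ccvgM; last exact: ccvg_cst.
  rewrite /ccvg.
  have -> : (fun n : nat => cabs ((\sum_(j < n) ((r * expR x) ^+ j / j`!%:R))%:C - (expR (r * expR x))%:C)) =
    (fun n : nat => `|\sum_(j < n) ((r * expR x) ^+ j / j`!%:R) - expR (r * expR x)|).
    by apply/funext => n; rewrite -rmorphB cabs_real.
  by apply/norm_cvg0P/subr_cvg0; exact: exp_series_cvg.
Qed.

(** The range of summation grows with n, so domination is required only for j <= n. *)
Lemma tannery (b : nat -> nat -> R[i]) (g : nat -> R) (M : R) (l : nat -> R[i]) (L : R[i]) :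
  (forall n j, (j <= n)%N -> cabs (b n j) <= g j) ->
  (forall j, ccvg (fun n => b n j) (l j)) ->
  (forall J, \sum_(j < J) g j <= M) ->
  ccvg (fun J => \sum_(j < J) l j) L ->
  ccvg (fun n => \sum_(j < n.+1) b n j) L.
Proof.
move=> bg bl gM lL.
have g0 j : 0 <= g j by apply: le_trans (bg j j (leqnn j)); exact: cabs_ge0.
pose G J := \sum_(j < J) g j.
have Gnd : nondecreasing_seq G by apply/nondecreasing_seqP => n; rewrite /G big_ord_recr /= lerDl.
have Gc : cvgn G by apply: nondecreasing_is_cvgn => //; exists M => _ [n _ <-]; exact: gM.
have Gle n : G n <= limn G by exact: nondecreasing_cvgn_le.
apply/cvgrPdist_lt => e e0; have e4 : 0 < e / 4 by rewrite divr_gt0.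
have /cvgrPdist_lt/(_ _ e4) [J1 _ HJ1] := Gc.
move/cvgrPdist_lt: lL => /(_ _ e4) [J2 _ HJ2].
set J := maxn J1 J2.
have h1 : limn G - G J < e / 4.
  by have := HJ1 J (leq_maxl _ _); rewrite ger0_norm// subr_ge0.
have h2 : cabs (\sum_(j < J) l j - L) < e / 4.
  by have := HJ2 J (leq_maxr _ _); rewrite /= sub0r normrN ger0_norm// cabs_ge0.
have hs : ccvg (fun n => \sum_(j < J) b n j) (\sum_(j < J) l j).
  elim: J {h1 h2} => [|k ih].
    by rewrite big_ord0; under eq_fun do rewrite big_ord0; exact: ccvg_cst.
  rewrite big_ord_recr; under eq_fun do rewrite big_ord_recr; exact: ccvgD.
move/cvgrPdist_lt: hs => /(_ _ e4) h3.
near=> n; rewrite sub0r normrN ger0_norm ?cabs_ge0//.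
have Jn : (J <= n)%N by near: n; exact: nbhs_infty_ge.
have h4 : cabs (\sum_(j < J) b n j - \sum_(j < J) l j) < e / 4.
  have : `|0 - cabs (\sum_(j < J) b n j - \sum_(j < J) l j)| < e / 4 by near: n.
  by rewrite sub0r normrN ger0_norm// cabs_ge0.
have -> : \sum_(j < n.+1) b n j - L = (\sum_(j < J) b n j - \sum_(j < J) l j) + (\sum_(j < J) l j - L) + \sum_(J <= j < n.+1) b n j.
  rewrite -(big_mkord xpredT (fun j => b n j)) (big_cat_nat (n := J)) ?(leqW Jn)//= big_mkord; ring.
rewrite (le_lt_trans (cabsD _ _))//.
have h5 : cabs (\sum_(J <= j < n.+1) b n j) <= e / 4.
  rewrite (le_trans (cabs_sum _ _))//.
  apply: (@le_trans _ _ (\sum_(J <= j < n.+1) g j)).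
    by rewrite big_nat [leRHS]big_nat; apply: ler_sum => j /andP[_ jn]; apply: bg.
  have : G n.+1 = G J + \sum_(J <= j < n.+1) g j.
    by rewrite /G -!(big_mkord xpredT g) (big_cat_nat (n := J)) ?(leqW Jn).
  have := Gle n.+1; lra.
have := cabsD (\sum_(j < J) b n j - \sum_(j < J) l j) (\sum_(j < J) l j - L).
lra.
Unshelve. all: by end_near. Qed.

Lemma ln_ratio_cvg (j : nat) : (ln (k + j).+1%:R - ln k.+1%:R) @[k --> \oo] --> (0 : R).
Proof.
apply: (@squeeze_cvgr _ _ _ _ (fun=> 0) (fun k => j%:R * k.+1%:R^-1)); first 1 last.
- exact: cvg_cst.
- by rewrite -[X in _ --> X](mulr0 j%:R); apply: cvgM; [exact: cvg_cst|exact: cvg_harmonic].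
apply: nearW => k; apply/andP; split.
  by rewrite subr_ge0 ler_ln ?posrE// ler_nat ltnS leq_addr.
rewrite -ln_div ?posrE//.
have -> : (k + j).+1%:R / k.+1%:R = 1 + j%:R * k.+1%:R^-1 :> R.
  by rewrite -addSn natrD mulrDl divff.
by rewrite le_ln1Dx// (@lt_le_trans _ _ 0)// mulr_ge0.
Qed.

Lemma cexp_small_cvg s (v : nat -> R) : v @ \oo --> (0 : R) -> ccvg (fun n => cexp (s * (v n)%:C)) 1.
Proof.
move=> v0.
have nv : `|v n| @[n --> \oo] --> (0 : R) by apply/norm_cvg0P.
have ev : expR (Re s * v n) @[n --> \oo] --> (1 : R).
  rewrite -(@expR0 R); apply: (@cvg_comp _ _ _ (fun n => Re s * v n) expR _ (nbhs (0 : R))); last exact: continuous_expR.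
  have h : Re s * v n @[n --> \oo] --> Re s * 0 by apply: cvgM => //; exact: cvg_cst.
  by move: h; rewrite mulr0.
apply: (ccvg_le (v := fun n => `|Re s| * `|v n| * (1 + expR (Re s * v n)) + 2 * (`|Im s| * `|v n|))).
  have -> : (0 : R) = `|Re s| * 0 * (1 + 1) + 2 * (`|Im s| * 0) by ring.
  apply: cvgD.
    apply: cvgM; first by apply: cvgM => //; exact: cvg_cst.
    by apply: cvgD => //; exact: cvg_cst.
  by apply: cvgM; [exact: cvg_cst|apply: cvgM => //; exact: cvg_cst].
apply: nearW => n; rewrite (le_trans (cabs_cexp_sub1 _))//.
by rewrite cReM cImM /= !mulr0 subr0 add0r !normrM.
Qed.

(** The inequality ln v <= v at v = (j + 1) h / c. A polynomial in j is thus absorbed by an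
    exponential of arbitrarily small rate h. *)
Lemma pow_le_exp c h (j : nat) : 0 < c -> 0 < h ->
  expR (c * ln j.+1%:R) <= expR (h + c * ln (c / h)) * expR h ^+ j.
Proof.
move=> c0 h0; rewrite -expRM_natl -expRD ler_expR.
have x0 : 0 < j.+1%:R * (h / c) by rewrite mulr_gt0// divr_gt0.
have H : ln j.+1%:R + ln (h / c) <= j.+1%:R * (h / c).
  by rewrite -lnM ?posrE ?divr_gt0//; exact: ltW (ln_sublinear x0).
have el : ln (h / c) = - ln (c / h) by rewrite -lnV ?posrE ?divr_gt0// invf_div.
rewrite el in H.
have e : c * (j.+1%:R * (h / c)) = h + j%:R * h by rewrite -natr1; field; rewrite gt_eqF.
by have := ler_wpM2l (ltW c0) H; rewrite e; lra.
Qed.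

(** n + 1 <= (n - j + 1) (j + 1). The weight (n + 1)^c is shared: the first part is matched by the
    decay of the rising factorial of index n - j, the second is absorbed by r^j. *)
Lemma ln_split_le c (n j : nat) : 0 <= c -> (j <= n)%N ->
  expR (c * ln n.+1%:R) <= expR (c * ln (n - j).+1%:R) * expR (c * ln j.+1%:R).
Proof.
move=> c0 jn; rewrite -expRD ler_expR -mulrDr ler_wpM2l//.
rewrite -lnM ?posrE// ler_ln ?posrE ?mulr_gt0// -natrM ler_nat.
by rewrite mulnS mulSn addSn ltnS addnA subnK// leq_addr.
Qed.

(** Uniformity in k is bought with a fixed power of |s|. A factor |q - s| / q with q >= k0 is
    compared with |s + p| / (c + p), where p = q - k0: as k0 >= 2 c, the distance q - c is at least
    c + p, and the remaining (q - c) / q <= (q / (q + 1))^c telescopes to the decay (k + 1)^(-c).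
    The factors |s + p| are absorbed by [Gam s] through the functional equation. The factors with q
    < k0 are estimated crudely by S. *)
Lemma Gam_rfac_bound c (k0 : nat) : 0 < c -> 2 * c <= k0%:R -> forall s k, Re s = c ->
  cabs (Gam s) * cabs (rfac (1 - s) k) <=
  2 * gamr c * ((1 + c^-1) * cabs s) ^+ k0 * expR (c * (ln k0%:R - ln k.+1%:R)).
Proof.
move=> c0 ck0 s k sc; set S := (1 + c^-1) * cabs s.
have s0 : 0 < Re s by rewrite sc.
have T0 : c <= cabs s by rewrite -sc cabs_ge_Re.
have TS : 1 + cabs s <= S.
  by rewrite /S mulrDl mul1r addrC lerD2l mulrC ler_pdivlMr// mul1r.
have S1 : 1 <= S by have := cabs_ge0 s; lra.
have S0 : 0 <= S by lra.
have k00 : (0 < k0)%N by rewrite -(ltr_nat R); lra.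
have fac i : cabs (1 - s + i%:R) <= i.+1%:R * S.
  have -> : 1 - s + i%:R = i.+1%:R%:C - s by rewrite -natr1 rmorphD /= rmorph_nat; ring.
  rewrite (le_trans (cabsD _ _))// cabsN cabs_real ger0_norm//.
  apply: (@le_trans _ _ (i.+1%:R * (1 + cabs s))); last by rewrite ler_wpM2l.
  rewrite mulrDr mulr1 lerD2l ler_peMl ?cabs_ge0//; by rewrite ler1n.
have rS i : cabs (rfac (1 - s) i.+1) * i.+1%:R = cabs (rfac (1 - s) i) * cabs (1 - s + i%:R).
  rewrite -cabsM -rfacS (cabsM (rfac _ _) i.+1%:R); congr (_ * _).
  by rewrite -[i.+1%:R in RHS](rmorph_nat (real_complex R)) cabs_real ger0_norm.
have low i : cabs (rfac (1 - s) i) <= S ^+ i.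
  elim: i => [|i ih]; first by rewrite rfac0 cabs1.
  have i0 : 0 < i.+1%:R :> R by [].
  rewrite -(ler_pM2r i0) rS exprS mulrC [S * _]mulrC -mulrA [S * _]mulrC.
  by rewrite mulrC ler_pM ?cabs_ge0.
have g0 := gamr_ge0 c.
have Gs : cabs (Gam s) <= 2 * gamr c by rewrite -sc cabs_Gam.
(* For k < k0 the crude bound is enough, the last exponential being at least 1. *)
have [kk0|kk0] := ltnP k k0.
  apply: (@le_trans _ _ (2 * gamr c * S ^+ k0)).
    rewrite ler_pM ?cabs_ge0// (le_trans (low k))//.
    by apply: ler_weXn2l => //; exact: ltnW.
  have h1 : 0 <= c * (ln k0%:R - ln k.+1%:R).
    by rewrite mulr_ge0 ?(ltW c0)// subr_ge0 ler_ln ?posrE ?ltr0n// ler_nat.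
  rewrite ler_peMr ?mulr_ge0 ?exprn_ge0//.
  by rewrite -[leLHS]expR0 ler_expR.
have high p : cabs (rfac (1 - s) (k0.-1 + p)) <=
   S ^+ k0.-1 * (\prod_(j < p) (cabs (s + j%:R) / (c + j%:R))) * expR (c * (ln k0%:R - ln (k0 + p)%:R)).
  elim: p => [|p ih].
    by rewrite addn0 big_ord0 addn0 subrr mulr0 expR0 !mulr1.
  have q0 : 0 < (k0.-1 + p).+1%:R :> R by [].
  rewrite addnS -(ler_pM2r q0) rS big_ord_recr /=.
  have e1 : (k0.-1 + p).+1 = (k0 + p)%N by rewrite -addSn prednK.
  have kp0 : 0 < (k0 + p)%:R :> R by rewrite ltr0n addn_gt0 k00.
  have cp0 : 0 < c + p%:R by rewrite ltr_wpDr.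
  set q := (k0 + p)%:R in kp0 *.
  have qc : c + p%:R <= q - c by rewrite /q natrD; lra.
  have step : cabs (1 - s + (k0.-1 + p)%:R) <= cabs (s + p%:R) / (c + p%:R) * expR (c * (ln q - ln (k0 + p.+1)%:R)) * q.
    have e2 : 1 - s + (k0.-1 + p)%:R = q%:C - s.
      have -> : q%:C = (k0.-1 + p)%:R + 1 :> R[i] by rewrite /q -e1 rmorph_nat -natr1.
      by ring.
    rewrite e2.
    apply: (@le_trans _ _ (cabs (s + p%:R) / (c + p%:R) * (q - c))).
      (* After squaring, with u = q - c, v = c + p and t = Im s, this reduces to t^2 v^2 <= t^2
         u^2. *)
      rewrite mulrAC ler_pdivlMr// -ler_sqr ?nnegrE ?mulr_ge0 ?cabs_ge0 ?(ltW cp0)//; last by lra.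
      rewrite !exprMn /cabs !sqr_sqrtr ?addr_ge0 ?sqr_ge0//.
      rewrite cReB cImB cReD cImD cRe_nat cIm_nat sc /= sub0r sqrrN addr0.
      have t0 := sqr_ge0 (Im s).
      set u := q - c in qc *; set v := c + p%:R in qc cp0 *.
      have uv : v ^+ 2 <= u ^+ 2 by rewrite ler_sqr ?nnegrE; lra.
      nra.
    rewrite -[leRHS]mulrA ler_wpM2l ?divr_ge0 ?cabs_ge0 ?(ltW cp0)//.
    have q1 : (k0 + p.+1)%:R = q + 1 by rewrite /q addnS -natr1.
    have lnle : ln (q + 1) - ln q <= q^-1.
      rewrite -ln_div ?posrE ?ltr_wpDr// mulrDl divff ?gt_eqF// mul1r le_ln1Dx//.
      by rewrite (@lt_le_trans _ _ 0)// invr_ge0 ltW.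
    have e3 : 1 - c / q <= expR (c * (ln q - ln (q + 1))).
      apply: (@le_trans _ _ (expR (- (c / q)))); first by have := expR_ge1Dx (- (c / q)); lra.
      by rewrite ler_expR -mulrN ler_wpM2l ?(ltW c0)//; lra.
    rewrite q1; have -> : q - c = (1 - c / q) * q by rewrite mulrBl mul1r divfK ?gt_eqF.
    by rewrite ler_wpM2r// ltW.
  have A0 : 0 <= \prod_(j < p) (cabs (s + j%:R) / (c + j%:R)).
    by apply: prodr_ge0 => j _; rewrite divr_ge0 ?cabs_ge0// addr_ge0// ltW.
  have h := ler_pM (cabs_ge0 _) (cabs_ge0 _) ih step.
  apply: (le_trans h); rewrite e1 -/q.
  have -> : expR (c * (ln k0%:R - ln (k0 + p.+1)%:R)) = expR (c * (ln k0%:R - ln q)) * expR (c * (ln q - ln (k0 + p.+1)%:R)).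
    by rewrite -expRD; congr expR; ring.
  apply: eq_ler; ring.
have -> : k = (k0.-1 + (k - k0.-1))%N by rewrite subnKC// (leq_trans (leq_pred _)).
set p := (k - k0.-1)%N.
have e1 : (k0.-1 + p).+1 = (k0 + p)%N by rewrite -addSn prednK.
rewrite e1; apply: (le_trans (ler_wpM2l (cabs_ge0 _) (high p))).
rewrite mulrA ler_wpM2r ?expR_ge0// mulrCA mulrC.
(* The factors |s + j| rebuild |Gam (s + p)| and the factors c + j rebuild [gamr (c + p)], which
   bounds it up to 2. *)
have PG : cabs (Gam s) * \prod_(j < p) (cabs (s + j%:R) / (c + j%:R)) <= 2 * gamr c.
  have P0 : 0 < \prod_(j < p) (c + j%:R) by apply: prodr_gt0 => j _; rewrite ltr_wpDr.
  rewrite big_split /= mulrA prodfV -/(\prod_(j < p) (c + j%:R)) ler_pdivrMr//.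
  have -> : cabs (Gam s) * \prod_(i < p) cabs (s + i%:R) = cabs (Gam (s + p%:R)).
    by rewrite Gam_addn// cabsM /pochhammer cabs_prod mulrC.
  have := cabs_Gam (Re_gt0_addn p s0); rewrite cReD cRe_nat sc.
  have gp i : gamr (c + i%:R) = gamr c * \prod_(j < i) (c + j%:R).
    elim: i => [|i ih]; first by rewrite addr0 big_ord0 mulr1.
    by rewrite -natr1 addrA gamrS ?ltr_wpDr// ih big_ord_recr /= mulrCA [(c + _) * _]mulrC mulrA.
  rewrite gp.
  by rewrite mulrA.
rewrite ler_pM ?mulr_ge0 ?exprn_ge0 ?cabs_ge0//.
- by apply: prodr_ge0 => j _; rewrite divr_ge0 ?cabs_ge0// addr_ge0// ltW.
- by apply: ler_weXn2l => //; exact: leq_pred.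
Qed.

(* Gam s * weight nu r n s is the Mellin transform of scaled_Q nu (1 - r) n;
   this form, unlike the defining alternating sum, passes to the limit term by
   term. *)
Definition weight (nu : nat) (r : R) (n : nat) (s : R[i]) : R[i] :=
  cexp ((s + nu%:R) * (ln (1 - r))%:C) *
  \sum_(j < n.+1) rfac (1 - s) (n - j) * ((r ^+ j / j`!%:R)%:C * Gam (s + nu%:R + j%:R)).

(** The limits of the individual terms sum to (1 - r)^(-(s + nu)) Gam (s + nu) / Gamma (1 - s) by
    [Gam_series_cvg]; the prefactor of [weight] cancels the power of 1 - r, so r disappears. *)
Theorem weight_cvg (nu : nat) r s : 0 < r -> r < 1 -> 0 < Re s ->
  ccvg (fun n => cexp (s * (ln n.+1%:R)%:C) * weight nu r n s)
       (Gam (s + nu%:R) / cgamma (1 - s)).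
Proof.
move=> r0 r1 s0; set c := Re s.
have a0 : 0 < Re (s + nu%:R) by exact: Re_gt0_addn.
pose u (k : nat) := cexp (s * (ln k.+1%:R)%:C) * rfac (1 - s) k.
have ucv : ccvg u (cgamma (1 - s))^-1.
  by have := rfac_cvg (1 - s); rewrite opprB addrCA subrr addr0.
have [Cs [Cs0 HCs]] := ccvg_bounded ucv.
(* Half of the geometric decay pays for (j + 1)^c: r' = r e^h is the square root of r, still below
   1. *)
set h := - ln r / 2.
have h0 : 0 < h by rewrite divr_gt0// oppr_gt0 ln_lt0// r0.
pose r' := r * expR h.
have r'0 : 0 <= r' by rewrite mulr_ge0 ?expR_ge0// ltW.
have r'1 : r' < 1.
  rewrite /r' -{1}(lnK (x := r)) ?posrE// -expRD expR_lt1 /h.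
  have : ln r < 0 by rewrite ln_lt0// r0.
  lra.
have ca0 : 0 < c + nu%:R by have := a0; rewrite cReD cRe_nat.
have [M HM] := gamr_series_bound ca0 r'0 r'1.
set K := expR (h + c * ln (c / h)).
pose l j := (cgamma (1 - s))^-1 * ((r ^+ j / j`!%:R)%:C * Gam (s + nu%:R + j%:R)).
pose b n j := cexp (s * (ln n.+1%:R)%:C) * rfac (1 - s) (n - j) * ((r ^+ j / j`!%:R)%:C * Gam (s + nu%:R + j%:R)).
have main : ccvg (fun n => \sum_(j < n.+1) b n j) ((cgamma (1 - s))^-1 * (cexp (- (s + nu%:R) * (ln (1 - r))%:C) * Gam (s + nu%:R))).
  apply: (@tannery b (fun j => (2 * Cs * K) * (r' ^+ j / j`!%:R * gamr (c + nu%:R + j%:R))) (2 * Cs * K * M) l).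
  - move=> n j jn; rewrite /b (cabsM (cexp _ * rfac _ _)) (cabsM (cexp _) (rfac _ _)) (cabsM _%:C) cabs_real ger0_norm; last by rewrite divr_ge0// exprn_ge0// ltW.
    have h1 : cabs (Gam (s + nu%:R + j%:R)) <= 2 * gamr (c + nu%:R + j%:R).
      by have := cabs_Gam (Re_gt0_addn j a0); rewrite !cReD !cRe_nat.
    have h2 : cabs (cexp (s * (ln n.+1%:R)%:C)) * cabs (rfac (1 - s) (n - j)) <= Cs * (K * expR h ^+ j).
      have := HCs (n - j)%N; rewrite /u cabsM !cabs_cexp !cReM /= !mulr0 !subr0 -/c => h3.
      apply: (@le_trans _ _ (expR (c * ln (n - j).+1%:R) * expR (c * ln j.+1%:R) * cabs (rfac (1 - s) (n - j)))).
        by rewrite ler_wpM2r ?cabs_ge0// ln_split_le// ltW.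
      rewrite mulrAC ler_pM ?mulr_ge0 ?expR_ge0 ?cabs_ge0//.
      exact: pow_le_exp.
    apply: (le_trans (ler_pM _ _ h2 (ler_pM _ _ (lexx _) h1))); rewrite ?mulr_ge0 ?divr_ge0 ?exprn_ge0 ?cabs_ge0 ?(ltW r0)//.
    rewrite /r' exprMn; apply: eq_ler; ring.
  - move=> j; rewrite /b /l; apply: ccvgM; last exact: ccvg_cst.
    (* With n = k + j, the rising factorial has index k and is matched with (k + 1)^s; the ratio ((k
       + j + 1) / (k + 1))^s tends to 1. *)
    apply: (@ccvg_shift R _ _ j).
    have := ccvgM ucv (cexp_small_cvg s (ln_ratio_cvg j)); rewrite mulr1.
    apply: ccvg_ext => k; rewrite /u addnK mulrAC -cexpD; congr (cexp _ * _).
    by rewrite rmorphB /=; ring.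
  - move=> J; rewrite -big_distrr /=; apply: ler_wpM2l; last exact: HM.
    by rewrite !mulr_ge0// expR_ge0.
  - rewrite /l; under eq_fun do rewrite -big_distrr /=.
    by apply: ccvgM; [exact: ccvg_cst|apply: Gam_series_cvg => //; exact: ltW].
have := ccvgM (ccvg_cst (cexp ((s + nu%:R) * (ln (1 - r))%:C))) main.
have -> : cexp ((s + nu%:R) * (ln (1 - r))%:C) * ((cgamma (1 - s))^-1 * (cexp (- (s + nu%:R) * (ln (1 - r))%:C) * Gam (s + nu%:R))) = Gam (s + nu%:R) / cgamma (1 - s).
  by rewrite mulNr cexpN mulrCA mulVKf ?cexp_neq0// mulrC.
apply: ccvg_ext => n; rewrite /weight /b !big_distrr /=; apply: eq_bigr => j _; ring.
Qed.

End MellinWeights.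

(** * Convergence of the Mellin-Barnes integrals *)

Section MellinBarnes.
Context {R : realType}.
Notation mu := (@lebesgue_measure R).
Notation Re := (@complex.Re R).
Notation Im := (@complex.Im R).
Notation cintegral := (@cintegral R).
Notation RT := (measurableTypeR R).
Implicit Types (z a s : R[i]) (x y c r : R).

Lemma ccvg_cabs_le (u : nat -> R[i]) l (B : R) : ccvg u l -> (forall n, cabs (u n) <= B) -> cabs l <= B.
Proof.
move=> ul uB; rewrite leNgt; apply/negP => Bl.
move/cvgrPdist_lt: ul; rewrite -subr_gt0 in Bl; move=> /(_ _ Bl) [n _ /(_ n (leqnn n))].
rewrite sub0r normrN ger0_norm ?cabs_ge0// => h.
have := cabsD (u n - l) (- u n).
rewrite addrAC subrr sub0r !cabsN; have := uB n; lra.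
Qed.

Definition mb_integrand (nu : nat) (r : R) (n : nat) (s : R[i]) : R[i] :=
  Gam s * (cexp (s * (ln n.+1%:R)%:C) * weight nu r n s).

Definition mb_limit (nu : nat) (s : R[i]) : R[i] := Gam s * (Gam (s + nu%:R) / cgamma (1 - s)).

Lemma mb_integrand_cvg nu r s : 0 < r -> r < 1 -> 0 < Re s -> ccvg (fun n => mb_integrand nu r n s) (mb_limit nu s).
Proof. by move=> r0 r1 s0; apply: ccvgM; [exact: ccvg_cst|exact: weight_cvg]. Qed.

(** [Gam_rfac_bound] loses |s|^k0 and [Gam_decay] at s + nu + j gains |s|^m. The price of the gain
    is the argument c + nu + m + j in [gamr], and the series over j is still summable by
    [gamr_series_bound]. *)
Lemma mb_integrand_bound nu r c : 0 < r -> r < 1 -> 0 < c -> exists C : R, 0 <= C /\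
  forall n s, Re s = c -> cabs (mb_integrand nu r n s) <= C * (cabs s ^+ 3)^-1.
Proof.
move=> r0 r1 c0.
have lr0 : ln r < 0 by rewrite ln_lt0// r0.
pose k0 := (Num.truncn (2 * c)).+1.
have ck0 : 2 * c <= k0%:R by rewrite ltW// truncnS_gt// mulr_ge0// ltW.
set h := - ln r / 2.
have h0 : 0 < h by rewrite divr_gt0// oppr_gt0.
pose r' := r * expR h.
have r'0 : 0 <= r' by rewrite mulr_ge0 ?expR_ge0// ltW.
have r'1 : r' < 1.
  by rewrite /r' -{1}(lnK (x := r)) ?posrE// -expRD expR_lt1 /h; lra.
(* k0 powers repay the loss and 3 remain: two for integrability on the line, one for the Lipschitz
   estimate in [mb_integral_regular]. *)
pose m := (k0 + 3)%N.
have cm0 : 0 < c + nu%:R + m%:R by rewrite !ltr_wpDr.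
have [M HM] := gamr_series_bound cm0 r'0 r'1.
have M0 : 0 <= M by have := HM 0%N; rewrite big_ord0.
set K := expR (h + c * ln (c / h)).
set A := 2 * gamr c * (1 + c^-1) ^+ k0 * expR (c * ln k0%:R).
have ci0 : 0 <= 1 + c^-1 by rewrite addr_ge0// invr_ge0 ltW.
have g0 := gamr_ge0 c.
have A0 : 0 <= A by rewrite /A !mulr_ge0 ?exprn_ge0 ?expR_ge0.
have K0 : 0 <= K by exact: expR_ge0.
have AK : 0 <= A * K * 2 := mulr_ge0 (mulr_ge0 A0 K0) (ler0n _ 2).
exists (A * K * 2 * M); split; first exact: (mulr_ge0 AK M0).
move=> n s sc; set T := cabs s.
have s0 : 0 < Re s by rewrite sc.
have T0 : 0 < T by exact: (lt_le_trans s0 (cabs_ge_Re s0)).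
have an0 : 0 < Re (s + nu%:R) by exact: Re_gt0_addn.
pose F j := rfac (1 - s) (n - j) * ((r ^+ j / j`!%:R)%:C * Gam (s + nu%:R + j%:R)).
have e1 : cabs (mb_integrand nu r n s) = cabs (Gam s) * expR (c * ln n.+1%:R) * (expR ((c + nu%:R) * ln (1 - r)) * cabs (\sum_(j < n.+1) F j)).
  rewrite /mb_integrand /weight (cabsM (Gam s)) (cabsM (cexp _)) (cabsM (cexp _) (\sum_(j < n.+1) _)).
  rewrite !cabs_cexp !cReM /= !mulr0 !subr0 cReD cRe_nat sc mulrA; by [].
have e2 : expR ((c + nu%:R) * ln (1 - r)) <= 1.
  rewrite -[leRHS]expR0 ler_expR mulr_ge0_le0 ?addr_ge0 ?(ltW c0)//.
  by rewrite ln_le0//; lra.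
have G0 : 0 <= cabs (Gam s) * expR (c * ln n.+1%:R) by rewrite mulr_ge0 ?cabs_ge0 ?expR_ge0.
have e3 : cabs (mb_integrand nu r n s) <= cabs (Gam s) * expR (c * ln n.+1%:R) * \sum_(j < n.+1) cabs (F j).
  rewrite e1; apply: ler_wpM2l => //; rewrite -[leRHS]mul1r.
  by apply: ler_pM; rewrite ?expR_ge0 ?cabs_ge0 ?cabs_sum.
apply: (le_trans e3); rewrite big_distrr /=.
have e4 j : (j <= n)%N -> cabs (Gam s) * expR (c * ln n.+1%:R) * cabs (F j) <=
    A * K * 2 * (T ^+ 3)^-1 * (r' ^+ j / j`!%:R * gamr (c + nu%:R + m%:R + j%:R)).
  move=> jn.
  have b1 := Gam_rfac_bound c0 ck0 (n - j)%N sc.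
  have b2 := ln_split_le (ltW c0) jn.
  have b3 : expR (c * ln j.+1%:R) <= K * expR h ^+ j by exact: pow_le_exp.
  have b4 : cabs (Gam (s + nu%:R + j%:R)) <= 2 * gamr (c + nu%:R + m%:R + j%:R) / T ^+ m.
    have aj0 : 0 < Re (s + nu%:R + j%:R) by exact: Re_gt0_addn.
    apply: (le_trans (Gam_decay m aj0)).
    have -> : Re (s + nu%:R + j%:R) + m%:R = c + nu%:R + m%:R + j%:R.
      by rewrite !cReD !cRe_nat sc; ring.
    rewrite ler_wpM2l ?mulr_ge0 ?gamr_ge0// lef_pV2 ?posrE ?exprn_gt0//; last first.
      exact: (lt_le_trans aj0 (cabs_ge_Re aj0)).
    rewrite lerXn2r ?nnegrE ?cabs_ge0//.
    by apply: (@le_trans _ _ (cabs (s + nu%:R))); apply: cabs_le_addn => //; exact: ltW.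
  rewrite /F (cabsM (rfac _ _)) (cabsM _%:C) cabs_real ger0_norm; last by rewrite divr_ge0// exprn_ge0// ltW.
  set X := expR (c * ln (n - j).+1%:R) in b2.
  have X0 : 0 < X by exact: expR_gt0.
  have b5 : cabs (Gam s) * cabs (rfac (1 - s) (n - j)) <= A * T ^+ k0 * X^-1.
    apply: (le_trans b1); rewrite /A /X exprMn mulrBr expRD expRN.
    apply: eq_ler; rewrite -/T; ring.
  set gj := gamr (c + nu%:R + m%:R + j%:R) in b4 *.
  have gj0 : 0 <= gj by exact: gamr_ge0.
  apply: (@le_trans _ _ ((A * T ^+ k0 * X^-1) * (X * (K * expR h ^+ j)) * (r ^+ j / j`!%:R * (2 * gj / T ^+ m)))).
    have rj0 : 0 <= r ^+ j / j`!%:R by rewrite divr_ge0// exprn_ge0// ltW.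
    have -> : cabs (Gam s) * expR (c * ln n.+1%:R) * (cabs (rfac (1 - s) (n - j)) * (r ^+ j / j`!%:R * cabs (Gam (s + nu%:R + j%:R)))) =
      (cabs (Gam s) * cabs (rfac (1 - s) (n - j))) * expR (c * ln n.+1%:R) * (r ^+ j / j`!%:R * cabs (Gam (s + nu%:R + j%:R))) by ring.
    apply: (ler_pM _ (mulr_ge0 rj0 (cabs_ge0 _))).
    - by rewrite !mulr_ge0 ?cabs_ge0 ?expR_ge0.
    - apply: (ler_pM (mulr_ge0 (cabs_ge0 _) (cabs_ge0 _)) (expR_ge0 _) b5).
      by apply: (le_trans b2); rewrite ler_wpM2l// ltW.
    - exact: (ler_wpM2l rj0 b4).
  apply: eq_ler.
  have -> : (T ^+ 3)^-1 = T ^+ k0 / T ^+ m.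
    have -> : T ^+ m = T ^+ k0 * T ^+ 3 by exact: exprD.
    by rewrite [(T ^+ k0 * _)^-1]invfM mulVKf// expf_neq0// gt_eqF.
  have -> : A * T ^+ k0 / X * (X * (K * expR h ^+ j)) = A * T ^+ k0 * (K * expR h ^+ j).
    by rewrite -[LHS]mulrA mulKf// gt_eqF.
  rewrite /r' exprMn; ring.
apply: (@le_trans _ _ (\sum_(j < n.+1) A * K * 2 * (T ^+ 3)^-1 * (r' ^+ j / j`!%:R * gamr (c + nu%:R + m%:R + j%:R)))).
  by apply: ler_sum => j _; apply: e4; rewrite -ltnS.
rewrite -big_distrr /=.
have -> : A * K * 2 * M * (T ^+ 3)^-1 = A * K * 2 * (T ^+ 3)^-1 * M by ring.
apply: ler_wpM2l; last exact: HM.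
by apply: (mulr_ge0 AK); rewrite invr_ge0 exprn_ge0// ltW.
Qed.

(** Inherited from [mb_integrand] by passing to the limit; the limit does not involve r, so r = 1 /
    2 is as good as any other value. Measurability of [mb_limit] is obtained in the same way. *)
Lemma mb_limit_bound nu c : 0 < c -> exists C : R, 0 <= C /\
  forall s, Re s = c -> cabs (mb_limit nu s) <= C * (cabs s ^+ 3)^-1.
Proof.
move=> c0; have r0 : 0 < 2^-1 :> R by rewrite invr_gt0.
have r1 : 2^-1 < 1 :> R by rewrite invf_lt1// ltr1n.
have [C [C0 HC]] := mb_integrand_bound nu r0 r1 c0; exists C; split => // s sc.
have s0 : 0 < Re s by rewrite sc.
by apply: (ccvg_cabs_le (mb_integrand_cvg nu r0 r1 s0)) => n; exact: HC.
Qed.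

Lemma cmeasurable_rfac1 c k : cmeasurable (setT : set RT) (fun t => rfac (1 - (c +i* t)) k).
Proof.
have h t : \prod_(i < k) (1 - (c +i* t) + i%:R) * k`!%:R^-1 = rfac (1 - (c +i* t)) k by [].
under eq_fun do rewrite -h; apply: cmeasurableM; last exact: cmeasurable_cst.
apply: cmeasurable_prod => i; apply: cmeasurableD; last exact: cmeasurable_cst.
apply: cmeasurableD; first exact: cmeasurable_cst.
by apply: cmeasurableN; exact: cmeasurable_line.
Qed.

Lemma cmeasurable_Gam_addn c (k : nat) : 0 < c -> cmeasurable (setT : set RT) (fun t => Gam (c +i* t + k%:R)).
Proof. by move=> c0; apply: cmeasurable_Gam; rewrite cRe_nat ltr_wpDr. Qed.

Lemma cmeasurable_mb_integrand nu r n c : 0 < c -> cmeasurable (setT : set RT) (fun t => mb_integrand nu r n (c +i* t)).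
Proof.
move=> c0; rewrite /mb_integrand /weight; apply: cmeasurableM; first exact: cmeasurable_Gam0.
apply: cmeasurableM.
  apply: cmeasurable_cexp; apply: cmeasurableM; last exact: cmeasurable_cst.
  exact: cmeasurable_line.
apply: cmeasurableM.
  apply: cmeasurable_cexp; apply: cmeasurableM; last exact: cmeasurable_cst.
  by apply: cmeasurableD; [exact: cmeasurable_line|exact: cmeasurable_cst].
apply: cmeasurable_sum => j; apply: cmeasurableM; first exact: cmeasurable_rfac1.
apply: cmeasurableM; first exact: cmeasurable_cst.
have h t : c +i* t + nu%:R + j%:R = c +i* t + (nu + j)%:R by rewrite natrD addrA.
by under eq_fun do rewrite h; exact: cmeasurable_Gam_addn.
Qed.

Lemma cmeasurable_mb_limit nu c : 0 < c -> cmeasurable (setT : set RT) (fun t => mb_limit nu (c +i* t)).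
Proof.
move=> c0; have r0 : 0 < 2^-1 :> R by rewrite invr_gt0.
have r1 : 2^-1 < 1 :> R by rewrite invf_lt1// ltr1n.
apply: (@cmeasurable_lim _ _ _ _ (fun n t => mb_integrand nu 2^-1 n (c +i* t))) => //.
- by move=> n; exact: cmeasurable_mb_integrand.
- by move=> t _; exact: mb_integrand_cvg.
Qed.

Lemma line_cube_le c C t : 0 < c -> 0 <= C ->
  C * (cabs (c +i* t) ^+ 3)^-1 <= C / c * (cabs (c +i* t) ^+ 2)^-1.
Proof.
move=> c0 C0; have T0 : c <= cabs (c +i* t) by exact: (@cabs_ge_Re R (c +i* t) c0).
have T1 : 0 < cabs (c +i* t) by exact: lt_le_trans T0.
rewrite -[leRHS]mulrA ler_wpM2l// exprS invfM ler_wpM2r ?invr_ge0 ?exprn_ge0 ?(ltW T1)//.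
by rewrite lef_pV2 ?posrE.
Qed.

Lemma cintegrable_cube_bound (F : R[i] -> R[i]) c C : 0 < c -> 0 <= C ->
  cmeasurable (setT : set RT) (fun t => F (c +i* t)) ->
  (forall s, Re s = c -> cabs (F s) <= C * (cabs s ^+ 3)^-1) -> forall x,
  cintegrable setT (fun t => F (c +i* t) * cexp (- (c +i* t) * x%:C)).
Proof.
move=> c0 C0 mF hF x.
apply: (cintegrable_le measurableT _ (integrableT_scale (C / c * expR (- (c * x))) (integrableT_line c0))).
  by apply: cmeasurableM => //; exact: cmeasurable_line_exp.
move=> t _; rewrite cabsM cabs_line_exp [leRHS]mulrAC ler_wpM2r ?expR_ge0//.
by apply: le_trans (line_cube_le _ c0 C0); exact: hF.
Qed.

(** An L1 distance along the line. No argument q enters it, and this is the source of the uniformity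
    in q. *)
Definition mb_error nu r c (n : nat) : R := \int[mu]_t cabs (mb_integrand nu r n (c +i* t) - mb_limit nu (c +i* t)).

Lemma mb_error_bound_integrable nu r c : 0 < r -> r < 1 -> 0 < c -> exists g : R -> R, integrableT g /\
  forall n t, cabs (mb_integrand nu r n (c +i* t) - mb_limit nu (c +i* t)) <= g t.
Proof.
move=> r0 r1 c0.
have [C [C0 HC]] := mb_integrand_bound nu r0 r1 c0; have [D [D0 HD]] := mb_limit_bound nu c0.
exists (fun t => (C + D) / c * (cabs (c +i* t) ^+ 2)^-1); split.
  exact: (integrableT_scale _ (integrableT_line c0)).
move=> n t; rewrite (le_trans (cabsD _ _))// cabsN.
apply: le_trans (line_cube_le t c0 (addr_ge0 C0 D0)); rewrite mulrDl.
by apply: lerD; [exact: HC|exact: HD].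
Qed.

Lemma cmeasurable_mb_diff nu r n c : 0 < c ->
  cmeasurable (setT : set RT) (fun t => mb_integrand nu r n (c +i* t) - mb_limit nu (c +i* t)).
Proof.
move=> c0; apply: cmeasurableD; first exact: cmeasurable_mb_integrand.
by apply: cmeasurableN; exact: cmeasurable_mb_limit.
Qed.

Lemma mb_error_cvg nu r c : 0 < r -> r < 1 -> 0 < c -> mb_error nu r c n @[n --> \oo] --> (0 : R).
Proof.
move=> r0 r1 c0; have [g [ig Hg]] := mb_error_bound_integrable nu r0 r1 c0.
have z0 : \int[mu]_(t in setT) (0 : R) = 0 by rewrite Rintegral_cst// mul0r.
have H : \int[mu]_(t in setT) cabs (mb_integrand nu r n (c +i* t) - mb_limit nu (c +i* t)) @[n --> \oo] --> \int[mu]_(t in setT) (0 : R).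
  2: by move: H; rewrite z0.
apply: (proj2 (@dominated_cvg_Rintegral R _ _ mu setT (fun n t => cabs (mb_integrand nu r n (c +i* t) - mb_limit nu (c +i* t))) (fun=> 0) g measurableT _ _ _ _)) => //.
- by move=> n; apply: cmeasurable_abs; exact: cmeasurable_mb_diff.
- by move=> n t _; rewrite ger0_norm ?cabs_ge0.
- by move=> t _; exact: mb_integrand_cvg.
Qed.

Lemma mb_error_ge0 nu r c n : 0 <= mb_error nu r c n.
Proof. by apply: Rintegral_ge0 => t _; exact: cabs_ge0. Qed.

(** The factor i of ds = i dt cancels the one in 1 / (2 pi i). The Gamma factor at 1 - s may leave
    the half-plane of Euler's integral and therefore stays in the form [cgamma]. *)
Lemma meijerG20E nu c x : 0 < c -> 0 < x ->
  meijerG20 nu c x = ((2 * pi)^-1)%:C * cintegral setT (fun t => mb_limit nu (c +i* t) * cexp (- (c +i* t) * (ln x)%:C)).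
Proof.
move=> c0 x0; rewrite /meijerG20 /vline_integral.
have -> : cintegral setT (fun t => cgamma (c +i* t) * cgamma (c +i* t + nu%:R) / cgamma (1 - (c +i* t)) * cpow x (- (c +i* t))) =
  cintegral setT (fun t => mb_limit nu (c +i* t) * cexp (- (c +i* t) * (ln x)%:C)).
  apply: eq_cintegral => t _; have s0 : 0 < Re (c +i* t) by [].
  by rewrite /mb_limit (cgamma_pos s0) (cgamma_pos (Re_gt0_addn nu s0)) cpowE// mulrA.
have i0 : 'i != 0 :> R[i] by rewrite neq0Ci.
have p0 : pi != 0 :> R by rewrite gt_eqF// pi_gt0.
rewrite mulrA; congr (_ * _).
rewrite invfM divfK// fmorphV rmorphM /=; congr (_ * _)^-1.
by rewrite (rmorph_nat (real_complex R) 2).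
Qed.

(** The S_n of the overview: with q = y / N and z = D / alpha^2 it is the sum in [Q] at y / (N D),
    up to the factor found in [sum_Q_scaled]. No contour appears in it, and [meijerG20_indep] relies
    on this. *)
Definition scaled_Q (nu : nat) (z : R) (n : nat) (q : R) : R :=
  \sum_(l < n.+1) (nu + n)`!%:R * (-1) ^+ l / ((n - l)`!%:R * (nu + l)`!%:R * l`!%:R) *
    z ^+ (nu + l) * bessel_integral (nu + l)%:R (q / z).

(** Vandermonde read backwards, with a = s + nu, b = 1 - s and z = 1 - r: each term is now a single
    Gamma factor, whose inverse Mellin transform is a Bessel function. *)
Lemma weightE nu r n s : 0 < r -> r < 1 -> 0 < Re s ->
  weight nu r n s = cexp ((s + nu%:R) * (ln (1 - r))%:C) *
   \sum_(l < n.+1) ((nu + n)`!%:R * (-1) ^+ l / ((n - l)`!%:R * (nu + l)`!%:R * l`!%:R) * (1 - r) ^+ l)%:C * Gam (s + (nu + l)%:R).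
Proof.
move=> r0 r1 s0; rewrite /weight; congr (_ * _).
have a0 : 0 < Re (s + nu%:R) by exact: Re_gt0_addn.
have ab : (s + nu%:R) + (1 - s) = nu.+1%:R by rewrite -natr1; ring.
have H := rfac_mul_binomial_sum (1 - r)%:C n ab.
have e1 : 1 - (1 - r)%:C = r%:C by rewrite rmorphB /=; ring.
rewrite e1 in H.
transitivity (Gam (s + nu%:R) * \sum_(j < n.+1) rfac (1 - s) (n - j) * rfac (s + nu%:R) j * r%:C ^+ j).
  rewrite big_distrr; apply: eq_bigr => j _ /=.
  rewrite (Gam_addn j a0) rmorphM fmorphV rmorphXn rmorph_nat /=.
  have -> : rfac (s + nu%:R) j = pochhammer (s + nu%:R) j / j`!%:R by [].
  ring.
rewrite H !big_distrr; apply: eq_bigr => l _ /=.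
rewrite natrD addrA (Gam_addn l a0).
have -> : rfac (s + nu%:R) l = pochhammer (s + nu%:R) l / l`!%:R by [].
rewrite !rmorphM !fmorphV !rmorphM !rmorphXn !rmorph_nat rmorphN1 /= (exprNn (1 - r)%:C) !invfM.
ring.
Qed.

Lemma cintegrable_Gam2 c y (k : nat) : 0 < c ->
  cintegrable setT (fun t => Gam (c +i* t) * Gam (c +i* t + k%:R) * cexp (- (c +i* t) * y%:C)).
Proof.
move=> c0.
apply: (cintegrable_le measurableT _ (integrableT_scale (2 * gamr (c + 2) * (2 * gamr (c + k%:R)) * expR (- (c * y))) (integrableT_line c0))).
  apply: cmeasurableM; last exact: cmeasurable_line_exp.
  by apply: cmeasurableM; [exact: cmeasurable_Gam0|exact: cmeasurable_Gam_addn].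
move=> t _; rewrite (cabsM (_ * _)) (cabsM (Gam _)) cabs_line_exp.
have -> : 2 * gamr (c + 2) * (2 * gamr (c + k%:R)) * expR (- (c * y)) * (cabs (c +i* t) ^+ 2)^-1 =
  (2 * gamr (c + 2) * (cabs (c +i* t) ^+ 2)^-1) * (2 * gamr (c + k%:R)) * expR (- (c * y)) by ring.
apply: ler_wpM2r; first exact: expR_ge0.
apply: ler_pM; rewrite ?cabs_ge0//; first exact: Gam_line_bound.
have s0 : 0 < Re (c +i* t) by [].
by have := cabs_Gam (Re_gt0_addn k s0); rewrite cReD cRe_nat.
Qed.

Lemma scaled_Q_mellin nu r n c q : 0 < r -> r < 1 -> 0 < c -> 0 < q ->
  cintegral setT (fun t => mb_integrand nu r n (c +i* t) * cexp (- (c +i* t) * (ln (n.+1%:R * q))%:C)) =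
  (2 * pi * scaled_Q nu (1 - r) n q)%:C.
Proof.
move=> r0 r1 c0 q0; set z := 1 - r; have z0 : 0 < z by rewrite subr_gt0.
have qz0 : 0 < q / z by rewrite divr_gt0.
pose k l : R := (nu + n)`!%:R * (-1) ^+ l / ((n - l)`!%:R * (nu + l)`!%:R * l`!%:R) * z ^+ (nu + l).
pose y := ln (q / z).
pose f (l : nat) t := Gam (c +i* t) * Gam (c +i* t + (nu + l)%:R) * cexp (- (c +i* t) * y%:C).
have i_f l : cintegrable setT (f l) by exact: cintegrable_Gam2.
transitivity (cintegral setT (fun t => \sum_(l < n.+1) (k l)%:C * f l t)).
  apply: eq_cintegral => t _; set s := c +i* t; have s0 : 0 < Re s by [].
  rewrite /mb_integrand (weightE nu n r0 r1 s0) -/z.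
  (* The powers of n + 1 cancel, and the powers of z move into the argument q / z up to z^nu. *)
  have e1 : cexp (s * (ln n.+1%:R)%:C) * cexp ((s + nu%:R) * (ln z)%:C) * cexp (- s * (ln (n.+1%:R * q))%:C) = (z ^+ nu)%:C * cexp (- s * y%:C).
    have -> : (z ^+ nu)%:C = cexp (nu%:R * ln z)%:C.
      by rewrite cexp_real expRM_natl lnK.
    rewrite -!cexpD; congr cexp; rewrite /y !lnM ?posrE ?invr_gt0// lnV ?posrE//.
    rewrite !rmorphD rmorphN rmorphM rmorph_nat /=; ring.
  transitivity (Gam s * (\sum_(l < n.+1) ((nu + n)`!%:R * (-1) ^+ l / ((n - l)`!%:R * (nu + l)`!%:R * l`!%:R) * z ^+ l)%:C * Gam (s + (nu + l)%:R)) * ((z ^+ nu)%:C * cexp (- s * y%:C))).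
    rewrite -e1; ring.
  rewrite big_distrr big_distrl; apply: eq_bigr => l _ /=; rewrite /k /f exprD.
  rewrite !(rmorphM, rmorphXn) /=; ring.
rewrite (@cintegral_sum R _ 'I_n.+1 (index_enum _) (fun (l : 'I_n.+1) t => (k l)%:C * f l t) measurableT); last first.
  by move=> l; apply: (cintegrableZ _ measurableT).
rewrite /scaled_Q big_distrr rmorph_sum /=; apply: eq_bigr => l _.
rewrite (cintegralZ _ measurableT (i_f l)).
have -> : cintegral setT (f l) = (2 * pi * bessel_integral (nu + l)%:R (q / z))%:C.
  have := @bessel_integral_mellin R (nu + l)%:R c y (ler0n _ _) c0.
  have ey : expR y = q / z by rewrite /y lnK.
  rewrite ey => H; apply: (etrans _ H); apply: eq_cintegral => t _.
  by rewrite /f rmorph_nat.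
by rewrite -rmorphM /k; congr (_%:C); ring.
Qed.

(** Both terms are integrals over the same line, on which ((n + 1) q)^(-s) has constant modulus;
    what remains is [mb_error]. The factor 2 of [cabs_cintegral] is absorbed by 1 / (2 pi). *)
Theorem scaled_Q_approx nu r n c q : 0 < r -> r < 1 -> 0 < c -> 0 < q ->
  cabs ((scaled_Q nu (1 - r) n q)%:C - meijerG20 nu c (n.+1%:R * q)) <=
  expR (- (c * ln (n.+1%:R * q))) * mb_error nu r c n.
Proof.
move=> r0 r1 c0 q0; have nq0 : 0 < n.+1%:R * q by rewrite mulr_gt0.
have p0 : pi != 0 :> R by rewrite gt_eqF// pi_gt0.
set x := ln (n.+1%:R * q).
have [C [C0 HC]] := mb_integrand_bound nu r0 r1 c0; have [D [D0 HD]] := mb_limit_bound nu c0.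
have i1 := cintegrable_cube_bound c0 C0 (cmeasurable_mb_integrand nu r n c0) (HC n) x.
have i2 := cintegrable_cube_bound c0 D0 (cmeasurable_mb_limit nu c0) HD x.
have -> : (scaled_Q nu (1 - r) n q)%:C = ((2 * pi)^-1)%:C * cintegral setT (fun t => mb_integrand nu r n (c +i* t) * cexp (- (c +i* t) * x%:C)).
  rewrite scaled_Q_mellin// -rmorphM mulKf// mulf_neq0//.
rewrite (meijerG20E nu c0 nq0) -mulrBr -(cintegralB measurableT i1 i2) cabsM.
have [g [ig Hg]] := mb_error_bound_integrable nu r0 r1 c0.
have mE := cmeasurable_abs (cmeasurable_mb_diff nu r n c0).
have iE : integrableT (fun t => cabs (mb_integrand nu r n (c +i* t) - mb_limit nu (c +i* t))).
  by apply: (integrableT_le ig mE) => t; rewrite ger0_norm ?cabs_ge0.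
have iEx := integrableT_scale (expR (- (c * x))) iE.
have i3 : cintegrable setT (fun t => mb_integrand nu r n (c +i* t) * cexp (- (c +i* t) * x%:C) - mb_limit nu (c +i* t) * cexp (- (c +i* t) * x%:C)).
  have := cintegrableD measurableT i1 (cintegrableZ (-1) measurableT i2).
  by apply: eq_cintegrable => t; rewrite mulN1r.
have B : cabs (cintegral setT (fun t => mb_integrand nu r n (c +i* t) * cexp (- (c +i* t) * x%:C) - mb_limit nu (c +i* t) * cexp (- (c +i* t) * x%:C))) <= 2 * (expR (- (c * x)) * mb_error nu r c n).
  apply: (le_trans (cabs_cintegral measurableT i3 iEx _)).
    by move=> t _; rewrite -mulrBl cabsM cabs_line_exp mulrC.
  by rewrite (RintegralZl _ measurableT iE).
have e0 : 0 <= expR (- (c * x)) * mb_error nu r c n by rewrite mulr_ge0 ?expR_ge0 ?mb_error_ge0.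
have p2 : 2 <= pi :> R by exact: pi_ge2.
rewrite cabs_real ger0_norm; last by rewrite invr_ge0 mulr_ge0// (le_trans _ p2).
have pp : 0 < 2 * pi :> R by rewrite mulr_gt0// (lt_le_trans _ p2).
rewrite mulrC ler_pdivrMr// (le_trans B)// mulrC.
by apply: ler_wpM2l => //; lra.
Qed.

End MellinBarnes.

(** * The two factors of the limiting integrand *)

Section PSide.
Context {R : realType}.
Implicit Types (x y z w u : R).

(** Power series of the P side and differences of two of them are majorised by a multiple of an
    exponential series; convergence and bound come together. *)
Lemma series_exp_bound (f : nat -> R) K z : 0 <= K -> 0 <= z ->
  (forall k, `|f k| <= K * (z ^+ k / k`!%:R)) ->
  cvgn (series f) /\ `|limn (series f)| <= K * expR z.
Proof.
move=> K0 z0 fb.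
have cf : cvgn (series f).
  apply: normed_cvg; apply: (@series_le_cvg _ _ (fun k => K *: exp_coeff z k)).
  - by move=> k; exact: normr_ge0.
  - by move=> k; rewrite mulr_ge0// divr_ge0// exprn_ge0.
  - by move=> k; exact: fb.
  - by apply: is_cvg_seriesZ; exact: is_cvg_series_exp_coeff.
split => //.
have b J : `|series f J| <= K * expR z.
  rewrite /series /= big_mkord (le_trans (ler_norm_sum _ _ _))//.
  apply: (@le_trans _ _ (K * \sum_(k < J) (z ^+ k / k`!%:R))).
    by rewrite big_distrr; apply: ler_sum => k _; exact: fb.
  by apply: ler_wpM2l => //; exact: exp_series_le.
rewrite ler_norml; apply/andP; split.
  by apply: limr_ge => //; apply: nearW => J; have := b J; rewrite ler_norml => /andP[].
by apply: limr_le => //; apply: nearW => J; have := b J; rewrite ler_norml => /andP[].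
Qed.

(** I_k (z) is (z / 2)^k times this series at w = (z / 2)^2. *)
Definition bessel_series (k : nat) (w : R) : R := limn (series (fun m : nat => w ^+ m / (m`!%:R * (m + k)`!%:R))).

Lemma fact_ge1 k : 1 <= k`!%:R :> R.
Proof. by rewrite ler1n fact_gt0. Qed.

Lemma bessel_series_term_le (k m : nat) w : 0 <= w ->
  w ^+ m / (m`!%:R * (m + k)`!%:R) <= k`!%:R^-1 * (w ^+ m / m`!%:R).
Proof.
move=> w0; rewrite mulrCA ler_wpM2l ?exprn_ge0//.
rewrite -invfM lef_pV2 ?posrE ?mulr_gt0 ?ltr0n ?fact_gt0//.
rewrite [leLHS]mulrC ler_wpM2l// ler_nat.
elim: m => [//|m ih]; rewrite addSn factS (leq_trans ih)// leq_pmull//.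
Qed.

Lemma bessel_series_cvg k w : 0 <= w -> cvgn (series (fun m : nat => w ^+ m / (m`!%:R * (m + k)`!%:R))).
Proof.
move=> w0; have h0 : 0 <= k`!%:R^-1 :> R by rewrite invr_ge0.
apply: (proj1 (@series_exp_bound _ k`!%:R^-1 w h0 w0 _)) => m.
by rewrite ger0_norm ?bessel_series_term_le// divr_ge0 ?exprn_ge0 ?mulr_ge0.
Qed.

(** The lower bound is the term m = 0, the upper one uses (m + k)! >= k!. At w = O(1/N) the two
    differ by O(1/N) / k!, so the Bessel factor in [scaled_P] may be replaced by 1 / k!. *)
Lemma bessel_series_bounds k w : 0 <= w -> k`!%:R^-1 <= bessel_series k w <= k`!%:R^-1 * expR w.
Proof.
move=> w0; have h0 : 0 <= k`!%:R^-1 :> R by rewrite invr_ge0.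
apply/andP; split; last first.
  apply: (le_trans (ler_norm _)); apply: (proj2 (@series_exp_bound _ k`!%:R^-1 w h0 w0 _)) => m.
  by rewrite ger0_norm ?bessel_series_term_le// divr_ge0 ?exprn_ge0 ?mulr_ge0.
apply: limr_ge; first exact: bessel_series_cvg.
near=> J; rewrite /series /= big_mkord.
have J0 : (0 < J)%N by near: J; exact: nbhs_infty_gt.
rewrite -(prednK J0) big_ord_recl /= expr0 fact0 mul1r add0n mul1r lerDl.
by apply: sumr_ge0 => i _; rewrite divr_ge0 ?exprn_ge0 ?mulr_ge0.
Unshelve. all: by end_near. Qed.

Lemma besselI_bessel_series k d x : 0 <= x ->
  besselI k (2 * d * Num.sqrt x) = (d * Num.sqrt x) ^+ k * bessel_series k (d ^+ 2 * x).
Proof.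
move=> x0; rewrite /besselI /bessel_series.
have w0 : 0 <= d ^+ 2 * x by rewrite mulr_ge0 ?sqr_ge0.
have e : (fun m : nat => (2 * d * Num.sqrt x / 2) ^+ (2 * m + k) / (m`!%:R * (m + k)`!%:R)) =
  (d * Num.sqrt x) ^+ k *: (fun m : nat => (d ^+ 2 * x) ^+ m / (m`!%:R * (m + k)`!%:R)).
  apply/funext => m; rewrite fctE; have -> : 2 * d * Num.sqrt x / 2 = d * Num.sqrt x by field.
  have e2 : (d * Num.sqrt x) ^+ 2 = d ^+ 2 * x by rewrite exprMn sqr_sqrtr.
  by rewrite exprD exprM e2 /GRing.scale /=; ring.
by rewrite e (lim_seriesZ _ (@bessel_series_cvg k _ w0)).
Qed.

(* P and Q at x / (N D) and y / (N D), D = alpha^2 - delta^2, up to factors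
   whose product is D; here e = delta^2 / D and z = D / alpha^2. *)
Definition scaled_P (nu : nat) (e : R) (N n : nat) (x : R) : R :=
  \sum_(k < n.+1) pochhammer (- n%:R) k / ((nu + k)`!%:R * k`!%:R) * (x / N%:R) ^+ k * bessel_series k (e * x / N%:R).

(** n (n - 1) ... (n - k + 1) / N^k, close to u^k when n / N is close to u. *)
Definition falling_ratio (N n k : nat) : R := \prod_(i < k) ((n%:R - i%:R) / N%:R).

Lemma pochhammer_falling_ratio N n k : pochhammer (- n%:R : R) k * N%:R^-1 ^+ k = (-1) ^+ k * falling_ratio N n k.
Proof.
elim: k => [|k ih]; first by rewrite pochhammer0 /falling_ratio big_ord0 !expr0.
rewrite pochhammerS /falling_ratio big_ord_recr /= -/(falling_ratio N n k).
transitivity ((pochhammer (- n%:R : R) k * N%:R^-1 ^+ k) * ((- n%:R + k%:R) * N%:R^-1)); first by rewrite exprS; ring.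
by rewrite ih exprS; ring.
Qed.

Lemma falling_ratio0 N n k : (n < k)%N -> falling_ratio N n k = 0.
Proof.
move=> nk; rewrite /falling_ratio (bigD1 (Ordinal nk))//= subrr mul0r mul0r; by [].
Qed.

Lemma falling_ratio_bounds N n k : (n < N)%N -> 0 <= falling_ratio N n k <= 1.
Proof.
move=> nN; have N0 : 0 < N%:R :> R by rewrite ltr0n (leq_ltn_trans _ nN).
have [nk|kn] := ltnP n k; first by rewrite falling_ratio0// lexx ler01.
elim: k kn => [_|k ih kn]; first by rewrite /falling_ratio big_ord0 ler01 lexx.
rewrite /falling_ratio big_ord_recr /= -/(falling_ratio N n k).
have /andP[h1 h2] := ih (ltnW kn).
have h3 : 0 <= (n%:R - k%:R) / N%:R :> R by rewrite divr_ge0 ?subr_ge0 ?ler_nat ?ltW// ltnW.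
have h4 : (n%:R - k%:R) / N%:R <= 1 :> R.
  by rewrite ler_pdivrMr// mul1r; have : n%:R <= N%:R :> R := ltac:(by rewrite ler_nat ltnW); have : 0 <= k%:R :> R := ler0n _ k; lra.
by rewrite mulr_ge0//= mulr_ile1.
Qed.

(** The factor of index i differs from (n + 1) / N by (i + 1) / N, and all factors lie in [0, 1], so
    the errors add up to at most k^2 / N. If k > n the product is 0, while u^k <= u <= k / N. *)
Lemma falling_ratio_approx N n k : (n < N)%N ->
  `|falling_ratio N n k - (n.+1%:R / N%:R) ^+ k| <= k%:R ^+ 2 / N%:R.
Proof.
move=> nN; have N0 : 0 < N%:R :> R by rewrite ltr0n (leq_ltn_trans _ nN).
set u : R := n.+1%:R / N%:R.
have u0 : 0 <= u by rewrite divr_ge0.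
have u1 : u <= 1 by rewrite ler_pdivrMr// mul1r ler_nat.
have [nk|kn] := ltnP n k.
  rewrite falling_ratio0// sub0r normrN ger0_norm ?exprn_ge0//.
  have k0 : (0 < k)%N by exact: leq_ltn_trans nk.
  apply: (@le_trans _ _ u).
    by rewrite -(prednK k0) exprS ler_piMr// exprn_ile1.
  rewrite ler_wpM2r ?invr_ge0 ?(ltW N0)// -natrX ler_nat (leq_trans nk)//.
  by rewrite expnS leq_pmulr// expn1.
elim: k kn => [_|k ih kn]; first by rewrite /falling_ratio big_ord0 expr0 subrr normr0 mulr_ge0 ?sqr_ge0 ?invr_ge0 ?ltW.
have /andP[b1 b2] := falling_ratio_bounds k nN.
rewrite /falling_ratio big_ord_recr /= -/(falling_ratio N n k).
set v : R := (n%:R - k%:R) / N%:R.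
have v0 : 0 <= v by rewrite divr_ge0 ?subr_ge0 ?ler_nat// ltnW.
have v1 : v <= 1.
  by rewrite ler_pdivrMr// mul1r; have : n%:R <= N%:R :> R := ltac:(by rewrite ler_nat ltnW); have : 0 <= k%:R :> R := ler0n _ k; lra.
have -> : falling_ratio N n k * v - u ^+ k.+1 = (falling_ratio N n k - u ^+ k) * v + u ^+ k * (v - u).
  by rewrite exprSr; ring.
have uv : `|v - u| = (k%:R + 1) / N%:R.
  have -> : v - u = - ((k%:R + 1) / N%:R) by rewrite /v /u -natr1; ring.
  by rewrite normrN ger0_norm// divr_ge0// addr_ge0.
clearbody u v.
rewrite (le_trans (ler_normD _ _))// !normrM (ger0_norm v0) (ger0_norm (exprn_ge0 k u0)).
have e1 : `|falling_ratio N n k - u ^+ k| * v <= k%:R ^+ 2 / N%:R.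
  by apply: (le_trans _ (ih (ltnW kn))); rewrite ler_piMr.
have e2 : u ^+ k * `|v - u| <= (k%:R + 1) / N%:R.
  by rewrite uv ler_piMl ?exprn_ile1// divr_ge0// addr_ge0.
apply: (le_trans (lerD e1 e2)); rewrite -mulrDl ler_wpM2r ?invr_ge0 ?(ltW N0)//.
rewrite -natr1; have : 0 <= k%:R :> R := ler0n _ k; nra.
Qed.

(** The factorials absorb the k^2 produced by [falling_ratio_approx] and leave an exponential
    series. *)
Lemma G10_coeff_le (nu k : nat) : k%:R ^+ 2 / (k`!%:R ^+ 2 * (nu + k)`!%:R) <= k`!%:R^-1 :> R.
Proof.
have f1 : 0 < k`!%:R :> R by rewrite ltr0n fact_gt0.
have f2 : 0 < (nu + k)`!%:R :> R by rewrite ltr0n fact_gt0.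
have hk : k%:R <= k`!%:R :> R.
  by rewrite ler_nat; case: (k) => // p; rewrite factS leq_pmulr// fact_gt0.
have hn : k`!%:R <= (nu + k)`!%:R :> R.
  by rewrite ler_nat; elim: (nu) => [//|p ih]; rewrite addSn factS (leq_trans ih)// leq_pmull.
rewrite ler_pdivrMr ?mulr_gt0 ?exprn_gt0//.
have -> : k`!%:R^-1 * (k`!%:R ^+ 2 * (nu + k)`!%:R) = k`!%:R * (nu + k)`!%:R :> R by field; rewrite gt_eqF.
by rewrite expr2 ler_pM// (le_trans hk).
Qed.

Lemma G10_coeff_le1 (nu k : nat) : (k`!%:R ^+ 2 * (nu + k)`!%:R)^-1 <= k`!%:R^-1 :> R.
Proof.
have f1 : 0 < k`!%:R :> R by rewrite ltr0n fact_gt0.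
have f2 : 0 < (nu + k)`!%:R :> R by rewrite ltr0n fact_gt0.
rewrite lef_pV2 ?posrE ?mulr_gt0 ?exprn_gt0// expr2 -mulrA ler_peMr ?(ltW f1)//.
have h1 := fact_ge1 k; have h2 := fact_ge1 (nu + k); nra.
Qed.

Lemma G10_coeff_lem1 (nu k : nat) : k%:R / (k`!%:R ^+ 2 * (nu + k)`!%:R) <= k`!%:R^-1 :> R.
Proof.
have f1 : 0 < k`!%:R :> R by rewrite ltr0n fact_gt0.
have f2 : 0 < (nu + k)`!%:R :> R by rewrite ltr0n fact_gt0.
apply: le_trans (G10_coeff_le nu k); rewrite ler_wpM2r ?invr_ge0 ?mulr_ge0 ?sqr_ge0 ?(ltW f2)//.
by rewrite -natrX ler_nat; case: (k) => // p; rewrite expnS leq_pmulr// expn_gt0.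
Qed.

Lemma G10_term_norm nu k z : 0 <= z ->
  `|(-1) ^+ k * z ^+ k / (k`!%:R ^+ 2 * (nu + k)`!%:R)| <= 1 * (z ^+ k / k`!%:R).
Proof.
move=> z0; rewrite !normrM normrX normrN1 expr1n !mul1r (ger0_norm (exprn_ge0 k z0)).
rewrite ger0_norm ?invr_ge0 ?mulr_ge0 ?sqr_ge0//.
by rewrite ler_wpM2l ?exprn_ge0// G10_coeff_le1.
Qed.

Lemma meijerG10_cvg nu z : 0 <= z ->
  cvgn (series (fun k => (-1) ^+ k * z ^+ k / (k`!%:R ^+ 2 * (nu + k)`!%:R))).
Proof. by move=> z0; exact: (proj1 (series_exp_bound ler01 z0 (fun k => G10_term_norm nu k z0))). Qed.

Lemma meijerG10_bound nu z : 0 <= z -> `|meijerG10 nu z| <= expR z.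
Proof. by move=> z0; rewrite -[leRHS]mul1r; exact: (proj2 (series_exp_bound ler01 z0 (fun k => G10_term_norm nu k z0))). Qed.

Lemma normr_expB_le M z w (k : nat) : 1 <= M -> 0 <= z <= M -> 0 <= w <= M ->
  `|z ^+ k - w ^+ k| <= k%:R * M ^+ k * `|z - w|.
Proof.
move=> M1 /andP[z0 zM] /andP[w0 wM]; have M0 : 0 <= M by lra.
elim: k => [|k ih]; first by rewrite !expr0 subrr normr0 !mul0r.
have -> : z ^+ k.+1 - w ^+ k.+1 = z * (z ^+ k - w ^+ k) + w ^+ k * (z - w) by rewrite !exprS; ring.
rewrite (le_trans (ler_normD _ _))// !normrM (ger0_norm z0) (ger0_norm (exprn_ge0 k w0)).
have e1 : z * `|z ^+ k - w ^+ k| <= M * (k%:R * M ^+ k * `|z - w|) by apply: ler_pM.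
have Mk : w ^+ k <= M ^+ k by apply: lerXn2r.
have MS : M ^+ k <= M ^+ k.+1 by rewrite exprS ler_peMl// exprn_ge0.
have e2 : w ^+ k * `|z - w| <= M ^+ k.+1 * `|z - w| by rewrite ler_wpM2r// (le_trans Mk).
apply: (le_trans (lerD e1 e2)); rewrite -natr1 exprS.
apply: eq_ler; ring.
Qed.

Lemma meijerG10_lip nu M z w : 1 <= M -> 0 <= z <= M -> 0 <= w <= M ->
  `|meijerG10 nu z - meijerG10 nu w| <= `|z - w| * expR M.
Proof.
move=> M1 hz hw; have /andP[z0 zM] := hz; have /andP[w0 wM] := hw; have M0 : 0 <= M by lra.
have cz := @meijerG10_cvg nu z z0; have cw := @meijerG10_cvg nu w w0.
rewrite /meijerG10 -(lim_seriesB cz cw).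
apply: (proj2 (series_exp_bound (normr_ge0 _) M0 _)) => k /=.
rewrite (_ : (_ - _) k = (-1) ^+ k * (z ^+ k - w ^+ k) / (k`!%:R ^+ 2 * (nu + k)`!%:R)); last by rewrite !fctE; ring.
rewrite !normrM normrX normrN1 expr1n mul1r.
rewrite [X in _ * X]ger0_norm ?invr_ge0 ?mulr_ge0 ?sqr_ge0//.
have i0 : 0 <= (k`!%:R ^+ 2 * (nu + k)`!%:R)^-1 :> R by rewrite invr_ge0 ?mulr_ge0 ?sqr_ge0.
apply: (le_trans (ler_wpM2r i0 (normr_expB_le k M1 hz hw))).
have -> : k%:R * M ^+ k * `|z - w| * (k`!%:R ^+ 2 * (nu + k)`!%:R)^-1 = `|z - w| * (M ^+ k * (k%:R / (k`!%:R ^+ 2 * (nu + k)`!%:R))) by ring.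
rewrite ler_wpM2l// ler_wpM2l ?exprn_ge0//.
exact: G10_coeff_lem1.
Qed.

(** Two replacements, each of cost O(1/N): the Bessel factor by 1 / k!, then the falling ratio by
    ((n + 1) / N)^k. The two summands of the constant are their costs. *)
Lemma scaled_P_approx nu e M : 0 <= e -> 0 <= M -> exists C : R, 0 <= C /\
  forall N n x, (n < N)%N -> 0 <= x <= M ->
  `|scaled_P nu e N n x - meijerG10 nu (n.+1%:R / N%:R * x)| <= C / N%:R.
Proof.
move=> e0 M0; exists (expR M * (e * M * (1 + expR (e * M))) + expR M); split.
  by rewrite addr_ge0 ?mulr_ge0 ?addr_ge0 ?expR_ge0.
move=> N n x nN /andP[x0 xM]; have N0 : 0 < N%:R :> R by rewrite ltr0n (leq_ltn_trans _ nN).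
have N1 : 1 <= N%:R :> R by rewrite ler1n (leq_ltn_trans _ nN).
set w := e * x / N%:R.
have w0 : 0 <= w by rewrite divr_ge0 ?mulr_ge0// ltW.
have wM : w <= e * M / N%:R by rewrite ler_wpM2r ?invr_ge0 ?(ltW N0)// ler_wpM2l.
have wM' : w <= e * M.
  by rewrite (le_trans wM)// ler_pdivrMr// ler_peMr// mulr_ge0.
pose a k := (-1) ^+ k * falling_ratio N n k * x ^+ k / (nu + k)`!%:R / k`!%:R.
(* The summand with the Bessel factor replaced by its value 1 / k! at w = 0. *)
pose t k := (-1) ^+ k * falling_ratio N n k * x ^+ k / (k`!%:R ^+ 2 * (nu + k)`!%:R).
have pE : scaled_P nu e N n x = \sum_(k < n.+1) a k * bessel_series k w.
  apply: eq_bigr => k _; rewrite /a -pochhammer_falling_ratio expr_div_n exprVn /w; congr (_ * _).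
  by rewrite invfM; ring.
have e1 : `|scaled_P nu e N n x - \sum_(k < n.+1) t k| <= expR M * (e * M * (1 + expR (e * M))) / N%:R.
  rewrite pE -sumrB (le_trans (ler_norm_sum _ _ _))//.
  have K0 : 0 <= e * M * (1 + expR (e * M)) / N%:R := (divr_ge0 (mulr_ge0 (mulr_ge0 e0 M0) (addr_ge0 ler01 (expR_ge0 _))) (ltW N0)).
  apply: (@le_trans _ _ (\sum_(k < n.+1) (M ^+ k / k`!%:R) * (e * M * (1 + expR (e * M)) / N%:R))); last first.
    rewrite -big_distrl /= -[leRHS]mulrA ler_wpM2r//.
    exact: exp_series_le.
  apply: ler_sum => k _.
  have f1 : 0 < k`!%:R :> R by rewrite ltr0n fact_gt0.
  have -> : t k = a k * k`!%:R^-1 by rewrite /t /a expr2 !invfM; ring.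
  rewrite -mulrBr normrM.
  have /andP[b1 b2] := bessel_series_bounds k w0.
  have /andP[q0 q1] := falling_ratio_bounds k nN.
  have ha : `|a k| <= M ^+ k.
    rewrite /a !normrM normrX normrN1 expr1n mul1r (ger0_norm q0) (ger0_norm (exprn_ge0 k x0)).
    rewrite !ger0_norm ?invr_ge0//.
    have i1 : (nu + k)`!%:R^-1 <= 1 :> R by rewrite invf_le1 ?fact_ge1// ltr0n fact_gt0.
    have i2 : k`!%:R^-1 <= 1 :> R by rewrite invf_le1 ?fact_ge1.
    have xk : x ^+ k <= M ^+ k by apply: lerXn2r.
    have xk0 : 0 <= x ^+ k by exact: exprn_ge0.
    apply: le_trans xk; rewrite -[leRHS]mulr1; apply: ler_pM => //; rewrite ?mulr_ge0 ?invr_ge0//.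
    rewrite -[leRHS]mulr1; apply: ler_pM => //; rewrite ?mulr_ge0 ?invr_ge0//.
    by rewrite ler_piMl.
  have hb : `|bessel_series k w - k`!%:R^-1| <= k`!%:R^-1 * (e * M * (1 + expR (e * M)) / N%:R).
    rewrite ger0_norm ?subr_ge0//.
    apply: (@le_trans _ _ (k`!%:R^-1 * (expR w - 1))); first by rewrite mulrBr mulr1 lerD2r.
    rewrite ler_wpM2l ?invr_ge0 ?(ltW f1)// (le_trans (ler_norm _))// (le_trans (expR_sub1_le _))//.
    rewrite (ger0_norm w0) [leRHS]mulrAC; apply: (ler_pM w0 (addr_ge0 ler01 (expR_ge0 _)) wM).
    by rewrite lerD2l ler_expR.
  apply: (le_trans (ler_pM (normr_ge0 _) (normr_ge0 _) ha hb)).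
  by apply: eq_ler; ring.
have tb k : `|t k| <= 1 * (M ^+ k / k`!%:R).
  have /andP[q0 q1] := falling_ratio_bounds k nN.
  rewrite /t !normrM normrX normrN1 expr1n !mul1r (ger0_norm q0) (ger0_norm (exprn_ge0 k x0)).
  rewrite [X in _ * X]ger0_norm ?invr_ge0 ?mulr_ge0 ?sqr_ge0//.
  apply: ler_pM; rewrite ?mulr_ge0 ?exprn_ge0 ?invr_ge0 ?mulr_ge0 ?sqr_ge0 ?G10_coeff_le1//.
  by apply: (@le_trans _ _ (x ^+ k)); [rewrite ler_piMl ?exprn_ge0|exact: lerXn2r].
have [ct _] := series_exp_bound ler01 M0 tb.
(* The falling ratio vanishes beyond n, so the finite sum is a full series and can be compared with
   that of [meijerG10] term by term. *)
have lt : limn (series t) = \sum_(k < n.+1) t k.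
  apply: cvg_lim => //; apply: cvg_near_cst.
  near=> J; have nJ : (n.+1 <= J)%N by near: J; exact: nbhs_infty_ge.
  rewrite /series /= (big_cat_nat (n := n.+1))//= big_mkord [X in _ + X]big1_seq ?addr0//.
  by move=> i /andP[_]; rewrite mem_index_iota => /andP[ni _]; rewrite /t falling_ratio0// mulr0 !mul0r.
set u := n.+1%:R / N%:R.
have u0 : 0 <= u by rewrite divr_ge0.
have ux0 : 0 <= u * x by rewrite mulr_ge0.
have e2 : `|\sum_(k < n.+1) t k - meijerG10 nu (u * x)| <= expR M / N%:R.
  rewrite -lt /meijerG10 -(lim_seriesB ct (@meijerG10_cvg nu _ ux0)) [leRHS]mulrC.
  have iN0 : 0 <= N%:R^-1 :> R by rewrite invr_ge0 ltW.
  apply: (proj2 (series_exp_bound iN0 M0 _)) => k /=.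
  rewrite (_ : (_ - _) k = (-1) ^+ k * (falling_ratio N n k - u ^+ k) * x ^+ k / (k`!%:R ^+ 2 * (nu + k)`!%:R)); last by rewrite !fctE /t exprMn; ring.
  rewrite !normrM normrX normrN1 expr1n mul1r (ger0_norm (exprn_ge0 k x0)).
  rewrite [X in _ * X]ger0_norm ?invr_ge0 ?mulr_ge0 ?sqr_ge0//.
  have i0 : 0 <= (k`!%:R ^+ 2 * (nu + k)`!%:R)^-1 :> R by rewrite invr_ge0 ?mulr_ge0 ?sqr_ge0.
  have xk : x ^+ k <= M ^+ k by exact: lerXn2r.
  apply: (le_trans (ler_wpM2r i0 (ler_pM (normr_ge0 _) (exprn_ge0 k x0) (falling_ratio_approx k nN) xk))).
  have -> : k%:R ^+ 2 / N%:R * M ^+ k * (k`!%:R ^+ 2 * (nu + k)`!%:R)^-1 = N%:R^-1 * (M ^+ k * (k%:R ^+ 2 / (k`!%:R ^+ 2 * (nu + k)`!%:R))) :> R by ring.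
  by rewrite !ler_wpM2l ?exprn_ge0// G10_coeff_le.
rewrite mulrDl; apply: le_trans (lerD e1 e2).
exact: ler_distD.
Unshelve. all: by end_near. Qed.

End PSide.
#[local] Opaque mb_limit.

(** * Regularity of the limiting integrand and Riemann sums *)

Section G20Regularity.
Context {R : realType}.
Notation mu := (@lebesgue_measure R).
Notation Re := (@complex.Re R).
Notation Im := (@complex.Im R).
Notation cintegral := (@cintegral R).
Notation RT := (measurableTypeR R).
Implicit Types (z a s : R[i]) (x y c r u : R).

Definition mb_integral (nu : nat) (c x : R) : R[i] :=
  cintegral setT (fun t => mb_limit nu (c +i* t) * cexp (- (c +i* t) * x%:C)).

(** The size follows from |s|^-2. For the increment, e^(-s (x' - x)) - 1 is at most a multiple of
    |s| (x' - x), which uses one more power of |s|; this is what the cubic bound on [mb_limit] is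
    for. *)
Lemma mb_integral_regular nu c : 0 < c -> exists K : R, 0 <= K /\
  (forall x, cabs (mb_integral nu c x) <= K * expR (- (c * x))) /\
  (forall x x', x <= x' -> cabs (mb_integral nu c x - mb_integral nu c x') <= K * (x' - x) * expR (- (c * x))).
Proof.
move=> c0; have [D [D0 HD]] := mb_limit_bound nu c0.
have iL := @integrableT_line R c c0.
set I := \int[mu]_t (cabs (c +i* t) ^+ 2)^-1.
have I0 : 0 <= I by apply: Rintegral_ge0 => t _; rewrite invr_ge0 sqr_ge0.
have ii x := cintegrable_cube_bound c0 D0 (cmeasurable_mb_limit nu c0) HD x.
have DI : 0 <= D * I by rewrite mulr_ge0.
have Dc : 0 <= D / c by rewrite divr_ge0// ltW.
have J1 : 0 <= 2 * (D / c) * I := mulr_ge0 (mulr_ge0 (ler0n _ 2) Dc) I0.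
have J2 : 0 <= 8 * (D * I) := mulr_ge0 (ler0n _ 8) DI.
exists (2 * (D / c) * I + 8 * (D * I)); split.
  exact: (addr_ge0 J1 J2).
split.
  move=> x; rewrite /mb_integral.
  apply: (le_trans (cabs_cintegral measurableT (ii x) (integrableT_scale (D / c * expR (- (c * x))) iL) _)).
    move=> t _; rewrite cabsM cabs_line_exp [leRHS]mulrAC ler_wpM2r ?expR_ge0//.
    by apply: le_trans (line_cube_le _ c0 D0); exact: HD.
  rewrite (RintegralZl _ measurableT iL) -/I.
  have -> : 2 * (D / c * expR (- (c * x)) * I) = 2 * (D / c) * I * expR (- (c * x)) by ring.
  by rewrite ler_wpM2r ?expR_ge0// lerDl.
move=> x x' xx'; rewrite /mb_integral -(cintegralB measurableT (ii x) (ii x')).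
have i3 : cintegrable setT (fun t => mb_limit nu (c +i* t) * cexp (- (c +i* t) * x%:C) - mb_limit nu (c +i* t) * cexp (- (c +i* t) * x'%:C)).
  have := cintegrableD measurableT (ii x) (cintegrableZ (-1) measurableT (ii x')).
  by apply: eq_cintegrable => t; rewrite mulN1r.
have d0 : 0 <= x' - x by rewrite subr_ge0.
apply: (le_trans (cabs_cintegral measurableT i3 (integrableT_scale (4 * D * (x' - x) * expR (- (c * x))) iL) _)).
  move=> t _; set s := c +i* t.
  have s0 : 0 < Re s by [].
  have T0 : 0 < cabs s by exact: lt_le_trans (cabs_ge_Re s0).
  have e1 : cexp (- s * x'%:C) = cexp (- s * x%:C) * cexp (- s * (x' - x)%:C).
    by rewrite -cexpD; congr cexp; rewrite rmorphB /=; ring.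
  have -> : mb_limit nu s * cexp (- s * x%:C) - mb_limit nu s * cexp (- s * x'%:C) =
    mb_limit nu s * (cexp (- s * x%:C) * - (cexp (- s * (x' - x)%:C) - 1)) by rewrite e1; ring.
  rewrite (cabsM (mb_limit _ _)) (cabsM (cexp _)) cabsN cabs_line_exp.
  have e2 : cabs (cexp (- s * (x' - x)%:C) - 1) <= 4 * cabs s * (x' - x).
    apply: (le_trans (cabs_cexp_sub1 _)).
    rewrite cReM cImM cReN cImN /= !mulr0 subr0 add0r !normrM (ger0_norm d0) !normrN.
    have h1 : expR (- c * (x' - x)) <= 1.
      by rewrite -[leRHS]expR0 ler_expR mulNr oppr_le0 mulr_ge0// ltW.
    have h2 := cabs_Re s; have h3 := cabs_Im s; rewrite /= in h2 h3.
    have h4 : `|c| * (x' - x) * (1 + expR (- c * (x' - x))) <= cabs s * (x' - x) * 2.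
      by apply: (ler_pM (mulr_ge0 (normr_ge0 _) d0) (addr_ge0 ler01 (expR_ge0 _)) (ler_wpM2r d0 h2)); lra.
    have h5 : (x' - x) * `|t| <= (x' - x) * cabs s by rewrite ler_wpM2l.
    lra.
  have e3 := HD s erefl.
  apply: (le_trans (ler_pM (cabs_ge0 _) (mulr_ge0 (expR_ge0 _) (cabs_ge0 _)) e3 (ler_wpM2l (expR_ge0 _) e2))).
  apply: eq_ler.
  have -> : (cabs s ^+ 2)^-1 = cabs s * (cabs s ^+ 3)^-1.
    by rewrite [_ ^+ 3]exprS [(cabs s * _)^-1]invfM mulVKf// gt_eqF.
  ring.
rewrite (RintegralZl _ measurableT iL) -/I.
have -> : 2 * (4 * D * (x' - x) * expR (- (c * x)) * I) = 8 * (D * I) * (x' - x) * expR (- (c * x)) by ring.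
by rewrite ler_wpM2r ?expR_ge0// ler_wpM2r// lerDr.
Qed.

(** Serves the measurability of [mb_integral]. The constant is taken at x - 1, the left end of a
    unit neighbourhood of x, where the exponential is largest. *)
Lemma local_lip_continuous (F : R -> R) (K c : R) : 0 <= K -> 0 < c ->
  (forall x x', x <= x' -> `|F x - F x'| <= K * (x' - x) * expR (- (c * x))) ->
  continuous F.
Proof.
move=> K0 c0 h x; pose L := K * expR (- (c * (x - 1))) + 1.
have L0 : 0 < L by rewrite ltr_wpDl// mulr_ge0 ?expR_ge0.
have hL x' : `|x - x'| < 1 -> `|F x - F x'| <= L * `|x - x'|.
  move=> d1; have [xx'|xx'] := leP x x'.
    apply: (le_trans (h _ _ xx')).
    rewrite distrC ger0_norm ?subr_ge0// mulrAC ler_wpM2r ?subr_ge0//.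
    rewrite /L; apply: (@le_trans _ _ (K * expR (- (c * (x - 1))))); last by rewrite lerDl.
    rewrite ler_wpM2l// ler_expR lerN2 ler_wpM2l ?(ltW c0)//; lra.
  have := h _ _ (ltW xx'); rewrite distrC => /le_trans; apply.
  rewrite gtr0_norm ?subr_gt0// mulrAC ler_wpM2r ?subr_ge0 ?(ltW xx')//.
  rewrite /L; apply: (@le_trans _ _ (K * expR (- (c * (x - 1))))); last by rewrite lerDl.
  rewrite ler_wpM2l// ler_expR lerN2 ler_wpM2l ?(ltW c0)//.
  move: d1; rewrite ltr_norml => /andP[]; lra.
apply/cvgrPdist_lt => e e0; have eL : 0 < e / L by rewrite divr_gt0.
near=> x'.
have d1 : `|x - x'| < 1.
  near: x'; have /cvgrPdist_lt/(_ 1 ltr01) : x' @[x' --> x] --> x by exact: cvg_id.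
  by [].
have d2 : `|x - x'| < e / L.
  near: x'; have /cvgrPdist_lt/(_ _ eL) : x' @[x' --> x] --> x by exact: cvg_id.
  by [].
by rewrite (le_lt_trans (hL _ d1))// mulrC -ltr_pdivlMr.
Unshelve. all: by end_near. Qed.

Lemma cmeasurable_mb_integral nu c : 0 < c -> cmeasurable (setT : set RT) (mb_integral nu c).
Proof.
move=> c0; have [K [K0 [_ h]]] := mb_integral_regular nu c0.
split; apply: continuous_measurableT; apply: (@local_lip_continuous _ K c K0 c0) => x x' xx';
  apply: le_trans (h x x' xx').
  by rewrite -cReB cabs_Re.
by rewrite -cImB cabs_Im.
Qed.

Lemma meijerG20_mb_integral nu c x : 0 < c -> 0 < x ->
  meijerG20 nu c x = ((2 * pi)^-1)%:C * mb_integral nu c (ln x).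
Proof. exact: meijerG20E. Qed.

Lemma cabs_inv2pi : cabs (((2 * pi)^-1)%:C : R[i]) <= 1.
Proof.
have p2 : 2 <= pi :> R by exact: pi_ge2.
have h : 1 <= 2 * pi :> R by lra.
rewrite cabs_real ger0_norm ?invr_ge0; last by lra.
by rewrite invf_le1//; lra.
Qed.

Lemma meijerG20_regular nu c : 0 < c -> exists K : R, 0 <= K /\
  (forall z : R, 0 < z -> cabs (meijerG20 nu c z) <= K * expR (- (c * ln z))) /\
  (forall z z' : R, 0 < z -> z <= z' ->
     cabs (meijerG20 nu c z - meijerG20 nu c z') <= K * (ln z' - ln z) * expR (- (c * ln z))).
Proof.
move=> c0; have [K [K0 [h1 h2]]] := mb_integral_regular nu c0; exists K; split => //; split.
  move=> z z0; rewrite meijerG20_mb_integral// cabsM -[leRHS]mul1r.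
  by apply: ler_pM; rewrite ?cabs_ge0 ?cabs_inv2pi.
move=> z z' z0 zz'; have z'0 : 0 < z' by exact: lt_le_trans zz'.
rewrite !meijerG20_mb_integral// -mulrBr cabsM -[leRHS]mul1r.
apply: ler_pM; rewrite ?cabs_ge0 ?cabs_inv2pi//.
by apply: h2; rewrite ler_ln ?posrE.
Qed.

(** Both contours give the limit of one and the same sequence, [scaled_Q] at z / (n + 1), by
    [scaled_Q_approx]; uniqueness of limits plays the part of a contour shift. The value r = 1 / 2
    is arbitrary. *)
Lemma meijerG20_indep nu c c' (z : R) : 0 < c -> 0 < c' -> 0 < z ->
  meijerG20 nu c z = meijerG20 nu c' z.
Proof.
move=> c0 c'0 z0; have r0 : 0 < 2^-1 :> R by rewrite invr_gt0.
have r1 : 2^-1 < 1 :> R by rewrite invf_lt1// ltr1n.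
have key d : 0 < d -> ccvg (fun n => (scaled_Q nu (1 - 2^-1) n (z / n.+1%:R))%:C) (meijerG20 nu d z).
  move=> d0; apply: (ccvg_le (v := fun n => expR (- (d * ln z)) * mb_error nu 2^-1 d n)).
    have -> : (0 : R) = expR (- (d * ln z)) * 0 by rewrite mulr0.
    by apply: cvgM; [exact: cvg_cst|exact: mb_error_cvg].
  apply: nearW => n; have q0 : 0 < z / n.+1%:R by rewrite divr_gt0.
  have e : n.+1%:R * (z / n.+1%:R) = z by rewrite mulrC divfK.
  by have := scaled_Q_approx nu n r0 r1 d0 q0; rewrite e.
exact: ccvg_unique (key c c0) (key c' c'0).
Qed.

Definition limit_integrand (nu : nat) (c x y u : R) : R[i] :=
  (meijerG10 nu (u * x))%:C * meijerG20 nu c (u * y).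

(** [meijerG20] is Lipschitz in ln z, and ln u' - ln u <= (u' - u) / u: hence the factor that
    degenerates at u = 0. The increment of [meijerG10] is bounded in the same form since u <= 1. *)
Lemma limit_integrand_regular nu c (m M : R) : 0 < c -> 0 < m -> 1 <= M -> exists K : R, 0 <= K /\
  forall x y, 0 <= x <= M -> m <= y <= M ->
  (forall u, 0 < u <= 1 -> cabs (limit_integrand nu c x y u) <= K * expR (- (c * ln u))) /\
  (forall u u', 0 < u -> u <= u' -> u' <= 1 ->
     cabs (limit_integrand nu c x y u - limit_integrand nu c x y u') <= K * ((u' - u) / u) * expR (- (c * ln u))).
Proof.
move=> c0 m0 M1; have [K [K0 [h1 h2]]] := meijerG20_regular nu c0.
set B := K * expR (- (c * ln m)).
have B0 : 0 <= B by rewrite mulr_ge0 ?expR_ge0.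
have M0 : 0 <= M by lra.
have MB : 0 <= M * expR M * B by rewrite !mulr_ge0 ?expR_ge0.
have MB' : 0 <= expR M * B by rewrite mulr_ge0 ?expR_ge0.
exists (expR M * B + M * expR M * B); split; first by rewrite addr_ge0.
move=> x y /andP[x0 xM] /andP[my yM].
have y0 : 0 < y by exact: lt_le_trans my.
have ly : ln m <= ln y by rewrite ler_ln ?posrE.
have ey u : 0 < u -> K * expR (- (c * ln (u * y))) <= B * expR (- (c * ln u)).
  move=> u0; rewrite /B -mulrA -expRD ler_wpM2l// ler_expR lnM ?posrE//.
  by have := ler_wpM2l (ltW c0) ly; lra.
have g20 u : 0 < u -> cabs (meijerG20 nu c (u * y)) <= B * expR (- (c * ln u)).
  by move=> u0; apply: le_trans (ey u u0); apply: h1; rewrite mulr_gt0.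
have ux u : 0 < u -> u <= 1 -> 0 <= u * x <= M.
  move=> u0 u1; rewrite mulr_ge0 ?(ltW u0)//= (le_trans _ xM)// ler_piMl//.
have g10 u : 0 < u -> u <= 1 -> cabs (meijerG10 nu (u * x))%:C <= expR M.
  move=> u0 u1; have /andP[a1 a2] := ux u u0 u1.
  by rewrite cabs_real (le_trans (meijerG10_bound nu a1))// ler_expR.
split.
  move=> u /andP[u0 u1]; rewrite /limit_integrand cabsM.
  apply: (le_trans (ler_pM (cabs_ge0 _) (cabs_ge0 _) (g10 u u0 u1) (g20 u u0))).
  by rewrite mulrA ler_wpM2r ?expR_ge0// lerDl.
move=> u u' u0 uu' u'1; have u'0 : 0 < u' by exact: lt_le_trans uu'.
have u1 : u <= 1 by exact: le_trans u'1.
have d0 : 0 <= u' - u by rewrite subr_ge0.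
have -> : limit_integrand nu c x y u - limit_integrand nu c x y u' =
  (meijerG10 nu (u * x) - meijerG10 nu (u' * x))%:C * meijerG20 nu c (u * y) +
  (meijerG10 nu (u' * x))%:C * (meijerG20 nu c (u * y) - meijerG20 nu c (u' * y)).
  by rewrite /limit_integrand rmorphB /=; ring.
rewrite (le_trans (cabsD _ _))// (cabsM (meijerG10 nu (u * x) - meijerG10 nu (u' * x))%:C) (cabsM (meijerG10 nu (u' * x))%:C).
have duu : u' - u <= (u' - u) / u by rewrite ler_peMr// invf_ge1.
have p1 : cabs (meijerG10 nu (u * x) - meijerG10 nu (u' * x))%:C <= M * expR M * ((u' - u) / u).
  rewrite cabs_real (le_trans (meijerG10_lip nu M1 (ux u u0 u1) (ux u' u'0 u'1)))//.
  rewrite -mulrBl normrM (ger0_norm x0).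
  rewrite [`|u - u'|]distrC (ger0_norm d0) [leRHS]mulrAC ler_wpM2r ?expR_ge0//.
  by rewrite mulrC; apply: ler_pM.
have p2 : cabs (meijerG20 nu c (u * y) - meijerG20 nu c (u' * y)) <= (u' - u) / u * (B * expR (- (c * ln u))).
  have uy0 : 0 < u * y by rewrite mulr_gt0.
  have uy : u * y <= u' * y by rewrite ler_wpM2r// ltW.
  apply: (le_trans (h2 _ _ uy0 uy)).
  have q0 : 0 <= ln (u' * y) - ln (u * y) by rewrite subr_ge0 ler_ln ?posrE// mulr_gt0.
  have q3 : ln (u' * y) - ln (u * y) <= (u' - u) / u.
    have -> : ln (u' * y) - ln (u * y) = ln u' - ln u by rewrite !lnM ?posrE//; ring.
    rewrite -ln_div ?posrE//.
    have -> : u' / u = 1 + (u' - u) / u by rewrite mulrBl divff ?gt_eqF//; ring.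
    by rewrite le_ln1Dx// (@lt_le_trans _ _ 0)// divr_ge0// ltW.
  have -> : K * (ln (u' * y) - ln (u * y)) * expR (- (c * ln (u * y))) = (ln (u' * y) - ln (u * y)) * (K * expR (- (c * ln (u * y)))) by ring.
  exact: (ler_pM q0 (mulr_ge0 K0 (expR_ge0 _)) q3 (ey u u0)).
have q1 := ler_pM (cabs_ge0 _) (cabs_ge0 _) p1 (g20 u u0).
have q2 := ler_pM (cabs_ge0 _) (cabs_ge0 _) (g10 u' u'0 u'1) p2.
apply: (le_trans (lerD q1 q2)); apply: eq_ler; ring.
Qed.

Lemma cmeasurable_limit_integrand nu c x y : 0 < c -> 0 <= x -> 0 < y ->
  cmeasurable (`]0, 1]%classic : set RT) (limit_integrand nu c x y).
Proof.
move=> c0 x0 y0; apply: cmeasurableM.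
  pose f (J : nat) (u : R) : R := \sum_(k < J) ((-1) ^+ k * (u * x) ^+ k / (k`!%:R ^+ 2 * (nu + k)`!%:R)).
  apply: (@cmeasurable_lim _ _ _ _ (fun J u => (f J u)%:C)) => //.
  - move=> J; apply: cmeasurable_real; apply: measurable_sum => k.
    apply: measurable_funM; last exact: measurable_cst.
    apply: measurable_funM; first exact: measurable_cst.
    apply: measurable_funX; apply: measurable_funM; [exact: measurable_id|exact: measurable_cst].
  - move=> u /=; rewrite in_itv /= => /andP[u0 u1].
    have ux0 : 0 <= u * x by rewrite mulr_ge0// ltW.
    rewrite /ccvg.
    have -> : (fun n : nat => cabs ((f n u)%:C - (meijerG10 nu (u * x))%:C)) = (fun n => `|f n u - meijerG10 nu (u * x)|).
      by apply/funext => n; rewrite -rmorphB cabs_real.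
    apply/norm_cvg0P/subr_cvg0.
    have fE : (fun n => f n u) = series (fun k => (-1) ^+ k * (u * x) ^+ k / (k`!%:R ^+ 2 * (nu + k)`!%:R)).
      by apply/funext => n; rewrite /series /= big_mkord.
    rewrite fE; exact: (@meijerG10_cvg R nu _ ux0).
have h : cmeasurable (`]0, 1]%classic : set RT) (fun u => ((2 * pi)^-1)%:C * mb_integral nu c (ln (u * y))).
  apply: cmeasurableM; first exact: cmeasurable_cst.
  have mf : measurable_fun (`]0, 1]%classic : set RT) (fun u : R => ln (u * y)).
    apply: (measurableT_comp (@measurable_ln R)).
    by apply: measurable_funM; [exact: measurable_id|exact: measurable_cst].
  have [m1 m2] := cmeasurable_mb_integral nu c0.
  by split; [apply: (measurableT_comp m1)|apply: (measurableT_comp m2)].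
case: h => h1 h2; split.
  apply: (eq_measurable_fun _ _ h1) => u; rewrite inE /= in_itv /= => /andP[u0 u1].
  by rewrite meijerG20_mb_integral// mulr_gt0.
apply: (eq_measurable_fun _ _ h2) => u; rewrite inE /= in_itv /= => /andP[u0 u1].
by rewrite meijerG20_mb_integral// mulr_gt0.
Qed.

(** The function is u^(-1/2). The substitution u = e^x turns u^(-1/2) / (1 + u) on the half-line
    into e^(x/2) / (1 + e^x), which is at most e^(-|x|/2). *)
Lemma integrable_exp_half_ln :
  mu.-integrable `]0, 1] (EFin \o (fun u : R => expR (- (ln u / 2)))).
Proof.
(* The factor 1 / (1 + u) makes the function integrable at infinity and costs at most a factor 2 on
   ]0, 1]. *)
pose g u : R := expR (- (ln u / 2)) / (1 + u).
have h0 : 0 < 2^-1 :> R by rewrite invr_gt0.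
have [ig _] : mu.-integrable `]0, +oo[ (EFin \o g) /\ \int[mu]_(x in `]0, +oo[) g x = \int[mu]_x (g (expR x) * expR x).
  apply: Rintegral_expR_subst.
    move=> u; rewrite in_itv /= andbT => u0; apply: cvgM.
      apply: (@cvg_comp _ _ _ (fun u : R => - (ln u / 2)) expR _ (nbhs (- (ln u / 2)))); last exact: continuous_expR.
      by apply: cvgN; apply: cvgM; [exact: continuous_ln|exact: cvg_cst].
    apply: cvgV; first by rewrite gt_eqF// addr_gt0.
    by apply: cvgD; [exact: cvg_cst|exact: cvg_id].
  apply: (integrableT_le (integrableT_exp_abs h0)).
    apply: continuous_measurableT => x; apply: cvgM; last exact: continuous_expR.
    rewrite /g; under eq_fun do rewrite expRK; rewrite expRK; apply: cvgM.
      apply: (@cvg_comp _ _ _ (fun u : R => - (u / 2)) expR _ (nbhs (- (x / 2)))); last exact: continuous_expR.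
      by apply: cvgN; apply: cvgM; [exact: cvg_id|exact: cvg_cst].
    apply: cvgV; first by rewrite gt_eqF// addr_gt0// expR_gt0.
    by apply: cvgD; [exact: cvg_cst|exact: continuous_expR].
  move=> x; have e0 := expR_gt0 x.
  rewrite /g expRK ger0_norm; last by rewrite mulr_ge0 ?divr_ge0 ?expR_ge0// addr_ge0// expR_ge0.
  rewrite mulrAC ler_pdivrMr ?addr_gt0// -expRD mulrDr mulr1.
  have [x0|x0] := leP 0 x.
    rewrite (ger0_norm x0) -expRD; apply: (@le_trans _ _ (expR (- (2^-1 * x) + x))); first by rewrite ler_expR; lra.
    by rewrite lerDr expR_ge0.
  rewrite (ltr0_norm x0); apply: (@le_trans _ _ (expR (- (2^-1 * - x)))); first by rewrite ler_expR; lra.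
  by rewrite lerDl mulr_ge0 ?expR_ge0.
have sub : `]0, 1]%classic `<=` (`]0, +oo[%classic : set RT).
  by move=> u /=; rewrite !in_itv /= andbT => /andP[].
have ig1 : mu.-integrable `]0, 1] (EFin \o g).
  by apply: integrableS ig => //; exact: sub.
have ig2 : mu.-integrable `]0, 1] (EFin \o (fun u => 2 * g u)).
  exact: (@integrableZl _ _ _ mu `]0, 1]%classic (measurable_itv _) 2 _ ig1).
have mf : cmeasurable (`]0, 1]%classic : set RT) (fun u => (expR (- (ln u / 2)))%:C).
  apply: cmeasurable_real; apply: (measurableT_comp (@measurable_expR R)).
  apply: measurable_funN; apply: measurable_funM; last exact: measurable_cst.
  exact: measurable_funTS (@measurable_ln R).
have [h1 _] : cintegrable `]0, 1] (fun u => (expR (- (ln u / 2)))%:C).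
  apply: (cintegrable_le (measurable_itv _) mf ig2).
  move=> u /=; rewrite in_itv /= => /andP[u0 u1].
  have u10 : 0 < 1 + u by rewrite addr_gt0.
  rewrite cabs_real ger0_norm ?expR_ge0//.
  rewrite /g mulrA ler_pdivlMr// mulrC ler_wpM2r ?expR_ge0//; lra.
exact: h1.
Qed.

Lemma cintegrable_cst_itv (a b : R) z : cintegrable `]a, b] (fun=> z).
Proof.
have H (k : R) : mu.-integrable `]a, b] (EFin \o (fun=> k)).
  apply/integrableP; split; first exact: measurable_cst.
  rewrite integral_cst; last exact: measurable_itv.
  have hf : (mu `]a, b] < +oo)%E.
    by rewrite lebesgue_measure_itv /=; case: ifP => _; rewrite ?ltry// -EFinB ltry.
  by apply: lte_mul_pinfty.
by split; apply: H.
Qed.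

(* min (1, 1/t) <= t^(-1/4) *)
Lemma exp_quarter_le (t X A : R) : 0 < t -> 0 <= A -> X <= A / t -> X <= A -> X <= A * expR (- (ln t / 4)).
Proof.
move=> t0 A0 h1 h2; have [t1|t1] := leP 1 t.
  apply: (le_trans h1); rewrite ler_wpM2l//.
  have l0 := ln_ge0 t1.
  rewrite -{1}(lnK (x := t)) ?posrE// -expRN ler_expR; lra.
apply: (le_trans h2); rewrite ler_peMr// -[leLHS]expR0 ler_expR.
have : ln t < 0 by rewrite ln_lt0// t0.
lra.
Qed.

Lemma cintegral_itvD (f : R -> R[i]) (a b : R) : 0 <= a -> a <= b ->
  cintegrable `]0, b] f ->
  cintegral `]0, b] f = cintegral `]0, a] f + cintegral `]a, b] f.
Proof.
move=> a0 ab [i1 i2].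
have H (g : R -> R) : mu.-integrable `]0, b] (EFin \o g) ->
   \int[mu]_(x in `]0, b]) g x = \int[mu]_(x in `]0, a]) g x + \int[mu]_(x in `]a, b]) g x.
  move=> ig; rewrite -(@Rintegral_itvB R g (BRight 0) (BRight b) a ig) ?bnd_simp//.
  by rewrite addrC subrK.
by apply: complexP; rewrite ?cReD ?cImD ?Re_cintegral ?Im_cintegral; apply: H.
Qed.

Lemma cintegrableS (D E : set RT) (f : R -> R[i]) : measurable D -> measurable E -> D `<=` E ->
  cintegrable E f -> cintegrable D f.
Proof. by move=> mD mE DE [i1 i2]; split; [apply: integrableS i1|apply: integrableS i2]. Qed.

Lemma cintegral_cst_itv (a b : R) z : a <= b -> cintegral `]a, b] (fun=> z) = (b - a)%:C * z.
Proof.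
move=> ab; have E : fine (mu `]a, b]) = b - a.
  rewrite lebesgue_measure_itv /= lte_fin; case: ltgtP ab => //= -> _.
  by rewrite subrr.
have H (k : R) : \int[mu]_(x in `]a, b]) k = (b - a) * k.
  rewrite Rintegral_cst; last exact: measurable_itv.
  by rewrite mulrC; congr (_ * _).
by apply: complexP; rewrite ?Re_cintegral ?Im_cintegral ?cReM ?cImM H /= !mul0r ?subr0 ?addr0.
Qed.

(** Cell by cell, by induction on their number. The error is controlled by an integrable majorant h
    rather than by a supremum, because f is unbounded near 0. *)
Lemma riemann_sum_bound (f : R -> R[i]) (v : nat -> R[i]) (h : R -> R) (N : nat) : (0 < N)%N ->
  cintegrable `]0, 1] f -> mu.-integrable `]0, 1] (EFin \o h) ->
  (forall n u, (n < N)%N -> n%:R / N%:R < u <= n.+1%:R / N%:R -> cabs (f u - v n) <= h u) ->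
  cabs (cintegral `]0, 1] f - (N%:R^-1)%:C * \sum_(n < N) v n) <= 2 * \int[mu]_(u in `]0, 1]) h u.
Proof.
move=> N0 cf ih hv; have N0' : 0 < N%:R :> R by rewrite ltr0n.
have key k : (k <= N)%N -> cabs (cintegral `]0, k%:R / N%:R] f - (N%:R^-1)%:C * \sum_(n < k) v n) <= 2 * \int[mu]_(u in `]0, k%:R / N%:R]) h u.
  elim: k => [_|k ihk kN].
    rewrite mul0r big_ord0 mulr0 subr0.
    have -> : `]0 : R, 0]%classic = set0 by apply: set_itv_ge; rewrite bnd_simp ltxx.
    have -> : cintegral set0 f = 0.
      by apply: complexP; rewrite ?Re_cintegral ?Im_cintegral Rintegral_set0.
    rewrite Rintegral_set0 mulr0.
    by rewrite cabs0.
  set a := k%:R / N%:R in ihk *; set b := k.+1%:R / N%:R.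
  have a0 : 0 <= a by rewrite divr_ge0.
  have ab : a <= b by rewrite ler_wpM2r ?invr_ge0 ?(ltW N0')// ler_nat.
  have b1 : b <= 1 by rewrite ler_pdivrMr// mul1r ler_nat.
  have ba : b - a = N%:R^-1 by rewrite /a /b -natr1; ring.
  have sb : `]0, b]%classic `<=` (`]0, 1]%classic : set RT).
    by move=> u /=; rewrite !in_itv /= => /andP[-> /le_trans]; apply.
  have sab : `]a, b]%classic `<=` (`]0, 1]%classic : set RT).
    move=> u /=; rewrite !in_itv /= => /andP[h1 h2].
    by rewrite (le_lt_trans a0 h1) (le_trans h2 b1).
  have mi (i : interval R) : measurable ([set` i] : set RT) by exact: measurable_itv.
  have cfb := cintegrableS (mi _) (mi _) sb cf.
  have cfab := cintegrableS (mi _) (mi _) sab cf.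
  have ihb : mu.-integrable `]0, b] (EFin \o h) by exact: (integrableS (mi _) (mi _) sb ih).
  have ihab : mu.-integrable `]a, b] (EFin \o h) by exact: (integrableS (mi _) (mi _) sab ih).
  rewrite (cintegral_itvD a0 ab cfb) big_ord_recr /= mulrDr.
  have ccst : cintegrable `]a, b] (fun=> v k).
    exact: cintegrable_cst_itv.
  have e1 : (N%:R^-1)%:C * v k = cintegral `]a, b] (fun=> v k) by rewrite cintegral_cst_itv// ba.
  rewrite e1 opprD addrACA -(cintegralB (mi _) cfab ccst).
  have -> : \int[mu]_(u in `]0, b]) h u = \int[mu]_(u in `]0, a]) h u + \int[mu]_(u in `]a, b]) h u.
    rewrite -(@Rintegral_itvB R h (BRight 0) (BRight b) a ihb) ?bnd_simp//.
    by rewrite addrC subrK.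
  rewrite mulrDr (le_trans (cabsD _ _))//; apply: lerD; first exact: ihk (ltnW kN).
  apply: cabs_cintegral => //.
    have := cintegrableD (mi _) cfab (cintegrableZ (-1) (mi _) ccst).
    by apply: eq_cintegrable => t; rewrite mulN1r.
  by move=> u /=; rewrite in_itv /=; exact: hv.
by have := key N (leqnn N); rewrite divff ?gt_eqF.
Qed.

Lemma cintegral_oc_cc (f : R -> R[i]) : cintegrable `]0, 1] f ->
  cintegral `[0, 1] f = cintegral `]0, 1] f.
Proof.
move=> [i1 i2]; apply: complexP; rewrite ?Re_cintegral ?Im_cintegral.
  exact/esym/(Rintegral_itv_obnd_cbnd i1).
exact/esym/(Rintegral_itv_obnd_cbnd i2).
Qed.

End G20Regularity.
#[local] Opaque bessel_integral.

(** * Rescaling and Riemann sums *)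

Section Assembly.
Context {R : realType}.
Notation mu := (@lebesgue_measure R).
Notation cintegral := (@cintegral R).
Notation RT := (measurableTypeR R).
Implicit Types (x y c r u : R).

Lemma powR_half (D : R) (k : nat) : 0 < D -> D `^ (k%:R + 2^-1) = D ^+ k * Num.sqrt D.
Proof.
move=> D0; rewrite powRD; last by rewrite (gt_eqF D0) implybT.
by rewrite powR_mulrn ?ltW// powR12_sqrt// ltW.
Qed.

Lemma powR_div2 x (k : nat) : 0 < x -> x `^ (k%:R / 2) = Num.sqrt x ^+ k.
Proof.
move=> x0; rewrite mulrC powRrM powR12_sqrt ?ltW// powR_mulrn// sqrtr_ge0.
Qed.

(** The power X^(k/2) and the prefactor (d sqrt X)^k of the Bessel function combine with D^k to (D
    X)^k = (x / N)^k, and the powers of d cancel. *)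
Lemma sum_P_scaled (a d D : R) (nu n N : nat) x : 0 < d -> 0 < D -> (0 < N)%N -> 0 < x ->
  let X := x / (N%:R * D) in
  \sum_(k < n.+1) D `^ (k%:R + 2^-1) / d ^+ k
    * (pochhammer (- n%:R) k / ((nu + k)`!%:R * k`!%:R))
    * X `^ (k%:R / 2) * besselI k (2 * d * Num.sqrt X) =
  Num.sqrt D * scaled_P nu (d ^+ 2 / D) N n x.
Proof.
move=> d0 D0 N0 x0 X; have N0' : 0 < N%:R :> R by rewrite ltr0n.
have X0 : 0 < X by rewrite divr_gt0// mulr_gt0.
rewrite /scaled_P big_distrr /=; apply: eq_bigr => k _.
rewrite powR_half// powR_div2// besselI_bessel_series ?(ltW X0)//.
have -> : d ^+ 2 / D * x / N%:R = d ^+ 2 * X by rewrite /X; field; rewrite !gt_eqF.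
have -> : x / N%:R = D * Num.sqrt X ^+ 2.
  by rewrite sqr_sqrtr ?(ltW X0)// /X; field; rewrite !gt_eqF.
have dk : d ^+ k != 0 by rewrite expf_neq0// gt_eqF.
set s := Num.sqrt X; set B := bessel_series _ _; set p := pochhammer _ _ / _.
rewrite [(d * s) ^+ k]exprMn [(D * s ^+ 2) ^+ k]exprMn [s ^+ 2 ^+ k]exprAC expr2.
have -> : D ^+ k * Num.sqrt D / d ^+ k * p * s ^+ k * (d ^+ k * s ^+ k * B) =
  (d ^+ k / d ^+ k) * (Num.sqrt D * (p * (D ^+ k * (s ^+ k * s ^+ k)) * B)) by ring.
by rewrite divff// mul1r.
Qed.

Lemma pochhammer_opp (n l : nat) : (l <= n)%N ->
  pochhammer (- n%:R : R) l = (-1) ^+ l * n`!%:R / (n - l)`!%:R.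
Proof.
have f0 k : k`!%:R != 0 :> R by rewrite gt_eqF// ltr0n fact_gt0.
elim: l => [_|l ih ln]; first by rewrite pochhammer0 subn0 expr0 mul1r divff.
rewrite pochhammerS ih ?(ltnW ln)//.
have e : (n - l)%N = (n - l.+1).+1 by rewrite subnSK.
have -> : - n%:R + l%:R = - (n - l.+1).+1%:R :> R.
  by rewrite -e natrB ?(ltnW ln)//; ring.
rewrite e factS natrM exprS.
have h1 := f0 (n - l.+1)%N; have h2 : (n - l.+1).+1%:R != 0 :> R by rewrite pnatr_eq0.
set q : R := (n - l.+1).+1%:R in h2 *; clearbody q.
by field; rewrite h1 h2.
Qed.

(** In [scaled_Q] the Bessel argument is q / z = a^2 Y, and (D / a^2)^(l + nu) times the factor (a
    sqrt Y)^(l + nu) of [besselK_bessel_integral] gives the powers of D, a and Y in [Q]. *)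
Lemma sum_Q_scaled (a D : R) (nu n N : nat) y : 0 < a -> 0 < D -> (0 < N)%N -> 0 < y ->
  let Y := y / (N%:R * D) in
  \sum_(l < n.+1) D `^ (l%:R + nu%:R + 2^-1) / a ^+ (l + nu)
    * (pochhammer (- n%:R) l / ((nu + l)`!%:R * l`!%:R))
    * Y `^ ((l + nu)%:R / 2) * besselK (l + nu)%:R (2 * a * Num.sqrt Y) =
  Num.sqrt D / 2 * n`!%:R / (nu + n)`!%:R * scaled_Q nu (D / a ^+ 2) n (y / N%:R).
Proof.
move=> a0 D0 N0 y0 Y; have N0' : 0 < N%:R :> R by rewrite ltr0n.
have Y0 : 0 < Y by rewrite divr_gt0// mulr_gt0.
have f0 k : k`!%:R != 0 :> R by rewrite gt_eqF// ltr0n fact_gt0.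
rewrite /scaled_Q big_distrr /=; apply: eq_bigr => l _.
have ln : (l <= n)%N by rewrite -ltnS.
rewrite -natrD powR_half// powR_div2// pochhammer_opp//.
have -> : y / N%:R / (D / a ^+ 2) = a ^+ 2 * Y by rewrite /Y; field; rewrite !gt_eqF.
set L := (l + nu)%N; rewrite [(nu + l)%N]addnC -/L.
have aY0 : 0 < a ^+ 2 * Y by rewrite mulr_gt0 ?exprn_gt0.
have sE : Num.sqrt (a ^+ 2 * Y) = a * Num.sqrt Y by rewrite sqrtrM ?sqr_ge0// sqrtr_sqr gtr0_norm.
rewrite besselK_bessel_integral// sE powR_mulrn ?mulr_ge0 ?sqrtr_ge0 ?(ltW a0)// (_ : 2 * (a * Num.sqrt Y) = 2 * a * Num.sqrt Y); last by rewrite mulrA.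
have s0 : 0 < Num.sqrt Y by rewrite sqrtr_gt0.
set s := Num.sqrt Y in s0 *; set K := besselK _ _.
rewrite expr_div_n -exprM mulnC exprM exprMn.
have aL : a ^+ L != 0 by rewrite expf_neq0// gt_eqF.
have h1 := f0 (n - l)%N; have h2 := f0 L; have h3 := f0 (nu + n)%N; have h4 := f0 l.
by field; rewrite aL h1 h2 h3 h4.
Qed.

(** The prefactors of P and Q multiply to D: the signs square to 1, the factorials cancel, and the
    two factors sqrt D remain. *)
Lemma kernel_N_scaled (m : R) (nu N : nat) x y : 0 < m -> m < 1 -> (0 < N)%N -> 0 < x -> 0 < y ->
  let D := alpha m ^+ 2 - delta m ^+ 2 in
  (N%:R * D)^-1 * kernel_N m nu N (x / (N%:R * D)) (y / (N%:R * D)) =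
  N%:R^-1 * \sum_(n < N) scaled_P nu (delta m ^+ 2 / D) N n x * scaled_Q nu (D / alpha m ^+ 2) n (y / N%:R).
Proof.
move=> m0 m1 N0 x0 y0 D; have N0' : 0 < N%:R :> R by rewrite ltr0n.
have a0 : 0 < alpha m by rewrite divr_gt0 ?mulr_gt0 ?addr_gt0.
have d0 : 0 < delta m by rewrite divr_gt0 ?mulr_gt0 ?subr_gt0.
have D0 : 0 < D.
  have -> : D = m^-1 by rewrite /D /alpha /delta; field; rewrite gt_eqF.
  by rewrite invr_gt0.
have f0 k : k`!%:R != 0 :> R by rewrite gt_eqF// ltr0n fact_gt0.
have PQ n : P m nu n (x / (N%:R * D)) * Q m nu n (y / (N%:R * D)) =
  D * (scaled_P nu (delta m ^+ 2 / D) N n x * scaled_Q nu (D / alpha m ^+ 2) n (y / N%:R)).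
  rewrite /P /Q -/D (sum_P_scaled (alpha m) nu n d0 D0 N0 x0) (sum_Q_scaled nu n a0 D0 N0 y0).
  set p := scaled_P _ _ _ _ _; set S := scaled_Q _ _ _ _.
  have sD : Num.sqrt D * Num.sqrt D = D by rewrite -expr2 sqr_sqrtr// ltW.
  have sg : (-1) ^+ n * (-1) ^+ n = 1 :> R by rewrite -exprMn mulrNN mul1r expr1n.
  have h1 := f0 n; have h2 := f0 (nu + n)%N.
  transitivity ((-1) ^+ n * (-1) ^+ n * (Num.sqrt D * Num.sqrt D) * (p * S)); last by rewrite sg sD mul1r.
  by field; rewrite h1 h2.
rewrite /kernel_N; under eq_bigr do rewrite PQ.
by rewrite -big_distrr /= mulrA invfM mulfVK// gt_eqF.
Qed.

Lemma sum_inv_sqrt_le (N : nat) : \sum_(n < N) (Num.sqrt n.+1%:R)^-1 <= 2 * Num.sqrt N%:R :> R.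
Proof.
elim: N => [|N ih]; first by rewrite big_ord0 sqrtr0 mulr0.
rewrite big_ord_recr /=.
have a0 : 0 < Num.sqrt N.+1%:R :> R by rewrite sqrtr_gt0.
have ea : Num.sqrt N.+1%:R ^+ 2 = N%:R + 1 :> R by rewrite sqr_sqrtr// natr1.
have es : Num.sqrt N%:R ^+ 2 = N%:R :> R by rewrite sqr_sqrtr.
move: ih a0 ea es; set a := Num.sqrt N.+1%:R; set s := Num.sqrt N%:R => ih a0 ea es.
(* Since a^2 = s^2 + 1, the inequality 2 s + 1 / a <= 2 a amounts to 2 a s <= a^2 + s^2. *)
apply: (@le_trans _ _ (2 * s + a^-1)); first by rewrite lerD2r.
rewrite -(ler_pM2r a0) mulrDl mulVf ?gt_eqF//.
have := sqr_ge0 (a - s); nra.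
Qed.

(** u^(-1/4) at the right end u = (n + 1) / N of a cell: the size of the integrand there for c =
    1/4. *)
Definition cell_weight (N n : nat) : R := expR (- (ln (n.+1%:R / N%:R) / 4)).

(** As (n + 1) / N <= 1, the exponent 1/4 may be weakened to 1/2, for which [sum_inv_sqrt_le] is at
    hand. *)
Lemma cell_weight_le N n : (n < N)%N -> cell_weight N n <= Num.sqrt N%:R * (Num.sqrt n.+1%:R)^-1.
Proof.
move=> nN; have N0 : 0 < N%:R :> R by rewrite ltr0n (leq_ltn_trans _ nN).
have sq k : 0 < k%:R :> R -> Num.sqrt k%:R = expR (ln k%:R / 2) :> R.
  move=> k0; rewrite -powR12_sqrt ?ltW// /powR gt_eqF//; congr expR; ring.
rewrite !sq// -expRN -expRD /cell_weight ler_expR lnM ?posrE ?invr_gt0// lnV ?posrE//.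
have : ln n.+1%:R <= ln N%:R :> R by rewrite ler_ln ?posrE// ler_nat.
lra.
Qed.

Lemma weighted_cesaro (E : nat -> R) : (forall n, 0 <= E n) -> E n @[n --> \oo] --> (0 : R) ->
  N%:R^-1 * \sum_(n < N) cell_weight N n * E n @[N --> \oo] --> (0 : R).
Proof.
move=> E0 cE; apply/cvgrPdist_lt => e e0.
(* Indices n >= n0 contribute at most 2 e / 3, those below n0 less than e / 3 once sqrt N is
   large. *)
have e3 : 0 < e / 3 by rewrite divr_gt0.
move/cvgrPdist_lt: (cE) => /(_ _ e3) [n0 _ Hn0].
have /cvg_seq_bounded[B [_ HB]] : cvgn E by apply/cvg_ex; exists 0.
have EB n : E n <= `|B| + 1.
  have BB : B < `|B| + 1 by rewrite (le_lt_trans (ler_norm B))// ltrDl.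
  by have := HB _ BB n I; rewrite /= ger0_norm.
set B1 := `|B| + 1 in EB.
have B10 : 0 <= B1 by rewrite addr_ge0.
near=> N.
have N0 : (0 < N)%N by near: N; exact: nbhs_infty_gt.
have n0N : (n0 <= N)%N by near: N; exact: nbhs_infty_ge.
have N0' : 0 < N%:R :> R by rewrite ltr0n.
have s0 : 0 < Num.sqrt N%:R :> R by rewrite sqrtr_gt0.
have Nbig : (B1 * n0%:R / (e / 3)) ^+ 2 < N%:R.
  near: N; exact: nbhs_infty_gtr.
have sbig : B1 * n0%:R < Num.sqrt N%:R * (e / 3).
  rewrite -ltr_pdivrMr// -(ger0_norm (_ : 0 <= B1 * n0%:R / (e / 3))); last first.
    by rewrite divr_ge0 ?mulr_ge0// ltW.
  by rewrite -sqrtr_sqr ltr_sqrt.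
have t0 n : 0 <= cell_weight N n * E n by rewrite mulr_ge0 ?expR_ge0.
rewrite sub0r normrN ger0_norm; last by rewrite mulr_ge0 ?invr_ge0 ?(ltW N0')// sumr_ge0.
have b1 : \sum_(n < N) cell_weight N n * E n <= Num.sqrt N%:R * (B1 * n0%:R + (e / 3) * (2 * Num.sqrt N%:R)).
  apply: (@le_trans _ _ (\sum_(n < N) Num.sqrt N%:R * ((Num.sqrt n.+1%:R)^-1 * E n))).
    apply: ler_sum => n _; rewrite mulrA ler_wpM2r//; exact: cell_weight_le.
  rewrite -big_distrr /= ler_wpM2l ?(ltW s0)//.
  apply: (@le_trans _ _ (\sum_(n < N) ((if (n < n0)%N then B1 else 0) + (e / 3) * (Num.sqrt n.+1%:R)^-1))).
    apply: ler_sum => n _.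
    have i0 : 0 <= (Num.sqrt n.+1%:R)^-1 :> R by rewrite invr_ge0 sqrtr_ge0.
    case: ltnP => nn0.
      apply: (@le_trans _ _ B1); last by rewrite lerDl mulr_ge0// ltW.
      rewrite -[leRHS]mul1r; apply: ler_pM => //.
      by rewrite invf_le1 ?sqrtr_gt0// -[leLHS]sqrtr1 ler_wsqrtr// ler1n.
    rewrite add0r mulrC ler_wpM2r//.
    by have := Hn0 n nn0; rewrite sub0r normrN ger0_norm// => /ltW.
  rewrite big_split /= -big_distrr /=; apply: lerD; last first.
    by rewrite ler_wpM2l ?(ltW e3)// sum_inv_sqrt_le.
  rewrite -big_mkcond -(big_ord_widen N (fun=> B1) n0N) sumr_const card_ord mulr_natr.
  exact: lexx.
rewrite mulrC ltr_pdivrMr// (le_lt_trans b1)//.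
have eN : N%:R = Num.sqrt N%:R * Num.sqrt N%:R :> R by rewrite -expr2 sqr_sqrtr.
rewrite [in ltRHS]eN [ltRHS]mulrCA ltr_pM2l//.
have := sbig; set s := Num.sqrt N%:R; lra.
Unshelve. all: by end_near. Qed.

(** A is closed and misses 0, so a ball around 0 lies in the complement; its radius is the lower
    bound. *)
Lemma compact_pos_bounds (A : set R) : compact A -> A `<=` [set x | 0 < x] ->
  exists m M : R, [/\ 0 < m, 1 <= M & forall x, A x -> m <= x <= M].
Proof.
move=> cA Apos.
have [B [_ HB]] := compact_bounded cA.
have clA : closed A by apply: compact_closed => //; exact: Rhausdorff.
have nA0 : (~` A) 0 by move=> /Apos /=; rewrite ltxx.
have oA : open (~` A) by exact: closed_openC.
have [e /= e0 He] : nbhs (0 : R) (~` A) by apply: open_nbhs_nbhs.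
exists e, (`|B| + 1); split => //; first by rewrite lerDr.
move=> x Ax; have x0 : 0 < x := Apos x Ax; apply/andP; split.
  rewrite leNgt; apply/negP => xe; apply: (He x) => //=.
  by rewrite sub0r normrN gtr0_norm.
have BB : B < `|B| + 1 by rewrite (le_lt_trans (ler_norm B))// ltrDl.
by have := HB _ BB x Ax; rewrite /= gtr0_norm.
Qed.

Lemma cvg_expR_ln_quarter : expR (- (ln n%:R / 4)) @[n --> \oo] --> (0 : R).
Proof.
apply/cvgrPdist_lt => e e0; near=> n.
rewrite sub0r normrN ger0_norm ?expR_ge0//.
have nb : expR (- (4 * ln e)) < n%:R by near: n; exact: nbhs_infty_gtr.
have n0 : 0 < n%:R :> R by apply: lt_trans nb; exact: expR_gt0.
rewrite -[ltRHS](lnK (x := e)) ?posrE// ltr_expR.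
have : - (4 * ln e) < ln n%:R by rewrite -(expRK (- (4 * ln e))) ltr_ln ?posrE// expR_gt0.
lra.
Unshelve. all: by end_near. Qed.

(** The contour is exchanged pointwise for Re s = 1/4, where the singularity at 0 is at most
    u^(-1/4); the integrand for any c is then dominated by a multiple of u^(-1/2). The endpoint 0,
    where the integrand is a default value, has measure zero. *)
Lemma limit_integrand_cintegrable nu c x y m M : 0 < c -> 0 < m -> 1 <= M -> 0 < x <= M -> m <= y <= M ->
  cintegrable `]0, 1] (limit_integrand nu c x y) /\
  limit_kernel nu c x y = cintegral `]0, 1] (limit_integrand nu 4^-1 x y).
Proof.
move=> c0 m0 M1 /andP[x0 xM] /andP[my yM].
have y0 : 0 < y by exact: lt_le_trans my.
have q0 : 0 < 4^-1 :> R by rewrite invr_gt0.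
have [K [K0 HK]] := limit_integrand_regular nu q0 m0 M1.
have xx : 0 <= x <= M by rewrite (ltW x0).
have yy : m <= y <= M by rewrite my.
have [h1 _] := HK x y xx yy.
have e u : `]0, 1]%classic u -> limit_integrand nu c x y u = limit_integrand nu 4^-1 x y u.
  rewrite /= in_itv /= => /andP[u0 u1]; have uy0 : 0 < u * y by rewrite mulr_gt0.
  by rewrite /limit_integrand (@meijerG20_indep R nu c 4^-1 (u * y) c0 q0 uy0).
have mi : measurable (`]0, 1]%classic : set RT) by exact: measurable_itv.
have ih := @integrableZl _ _ _ mu `]0, 1]%classic mi K _ (@integrable_exp_half_ln R).
have ci : cintegrable `]0, 1] (limit_integrand nu c x y).
  apply: (cintegrable_le (g := fun u => K * expR (- (ln u / 2))) mi (cmeasurable_limit_integrand nu c0 (ltW x0) y0) ih) => u Du.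
  rewrite (e u Du); move: Du; rewrite /= in_itv /= => /andP[u0 u1].
  apply: (le_trans (h1 u _)); first by rewrite u0.
  rewrite ler_wpM2l// ler_expR.
  have : ln u <= 0 by rewrite ln_le0.
  lra.
split; first exact: ci.
rewrite /limit_kernel (cintegral_oc_cc ci); apply: eq_cintegral => u Du; exact: e.
Qed.

Lemma grid_in01 (N n : nat) : (n < N)%N -> 0 < (n.+1%:R / N%:R : R) <= 1.
Proof.
move=> nN; have N0 : 0 < N%:R :> R by rewrite ltr0n (leq_ltn_trans _ nN).
by rewrite divr_gt0//= ler_pdivrMr// mul1r ler_nat.
Qed.

(** The difference of products is p (S - G20) + (p - G10) G20, with [scaled_Q_approx] for the first
    part and [scaled_P_approx] for the second; both carry the factor [cell_weight]. *)
Lemma summand_approx (nu : nat) (r e m M : R) : 0 < r -> r < 1 -> 0 <= e -> 0 < m -> 1 <= M ->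
  exists E : nat -> R, [/\ forall n, 0 <= E n, E n @[n --> \oo] --> (0 : R) &
    forall N n x y, (n < N)%N -> 0 < x <= M -> m <= y <= M ->
    cabs ((scaled_P nu e N n x * scaled_Q nu (1 - r) n (y / N%:R))%:C -
          limit_integrand nu 4^-1 x y (n.+1%:R / N%:R)) <= cell_weight N n * E n].
Proof.
move=> r0 r1 e0 m0 M1; have M0 : 0 <= M by lra.
have q0 : 0 < 4^-1 :> R by rewrite invr_gt0.
have [C [C0 HC]] := scaled_P_approx nu e0 M0.
have [K2 [K20 [HK2 _]]] := meijerG20_regular nu q0.
set Bm := expR (- (4^-1 * ln m)); have Bm0 : 0 <= Bm by exact: expR_ge0.
pose A1 := (expR M + C) * Bm; pose A2 := C * K2 * Bm.
have A10 : 0 <= A1 by rewrite mulr_ge0// addr_ge0// expR_ge0.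
have A20 : 0 <= A2 by rewrite !mulr_ge0.
(* As n + 1 <= N, the error C / N of the P side is at most C / (n + 1), so E depends on n alone, as
   the weighted Cesaro mean requires. *)
exists (fun n => A1 * mb_error nu r 4^-1 n + A2 * n.+1%:R^-1); split.
- move=> n; have h1 : 0 <= n.+1%:R^-1 :> R by rewrite invr_ge0.
  exact: (addr_ge0 (mulr_ge0 A10 (mb_error_ge0 _ _ _ _)) (mulr_ge0 A20 h1)).
- have h : A1 * mb_error nu r 4^-1 n + A2 * n.+1%:R^-1 @[n --> \oo] --> A1 * 0 + A2 * 0.
    apply: cvgD; apply: cvgM; try exact: cvg_cst; first exact: mb_error_cvg.
    exact: cvg_harmonic.
  by move: h; rewrite !mulr0 addr0.
move=> N n x y nN /andP[x0 xM] /andP[my yM].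
have y0 : 0 < y by exact: lt_le_trans my.
have N0' : 0 < N%:R :> R by rewrite ltr0n (leq_ltn_trans _ nN).
have xx : 0 <= x <= M by rewrite (ltW x0).
have /andP[un0 un1] := grid_in01 nN; set u := n.+1%:R / N%:R in un0 un1 *.
set p := scaled_P _ _ _ _ _; set S := scaled_Q _ _ _ _.
have -> : (p * S)%:C - limit_integrand nu 4^-1 x y u = p%:C * (S%:C - meijerG20 nu 4^-1 (u * y)) + (p - meijerG10 nu (u * x))%:C * meijerG20 nu 4^-1 (u * y).
  by rewrite /limit_integrand rmorphM rmorphB /=; ring.
have uy0 : 0 < u * y by rewrite mulr_gt0.
have ew : expR (- (4^-1 * ln (u * y))) <= cell_weight N n * Bm.
  rewrite /cell_weight /Bm -expRD ler_expR -/u lnM ?posrE//.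
  have : ln m <= ln y by rewrite ler_ln ?posrE.
  lra.
have b1 : cabs (S%:C - meijerG20 nu 4^-1 (u * y)) <= cell_weight N n * Bm * mb_error nu r 4^-1 n.
  have qy : 0 < y / N%:R by rewrite divr_gt0.
  have := scaled_Q_approx nu n r0 r1 q0 qy.
  have -> : n.+1%:R * (y / N%:R) = u * y by rewrite /u; ring.
  by move=> h; apply: (le_trans h); rewrite ler_wpM2r ?mb_error_ge0.
have b2 : cabs (meijerG20 nu 4^-1 (u * y)) <= K2 * (cell_weight N n * Bm).
  by apply: (le_trans (HK2 _ uy0)); rewrite ler_wpM2l.
have b3 := HC N n x nN xx; rewrite -/p -/u in b3.
have b4 : C / N%:R <= C * n.+1%:R^-1 by rewrite ler_wpM2l// lef_pV2 ?posrE// ler_nat.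
have ux0 : 0 <= u * x by rewrite mulr_ge0 ?ltW.
have uxM : u * x <= M by rewrite (le_trans _ xM)// ler_piMl// ltW.
have b5 : `|p| <= expR M + C.
  rewrite -[p](subrK (meijerG10 nu (u * x))) (le_trans (ler_normD _ _))// addrC; apply: lerD.
    by rewrite (le_trans (meijerG10_bound nu ux0))// ler_expR.
  by rewrite (le_trans b3)// ler_pdivrMr// ler_peMr// ler1n -(ltr0n R).
apply: (le_trans (cabsD _ _)).
rewrite (cabsM p%:C) (cabsM (p - _)%:C) !cabs_real.
have z1 := ler_pM (normr_ge0 _) (cabs_ge0 _) b5 b1.
have z2 := ler_pM (normr_ge0 _) (cabs_ge0 _) (le_trans b3 b4) b2.
apply: (le_trans (lerD z1 z2)).
apply: eq_ler; rewrite /A1 /A2; ring.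
Qed.

(** On a cell two bounds compete: regularity gives u^(-1/4) / (N u), useless near 0, and size gives
    u^(-1/4), not small in N. Their interpolation [exp_quarter_le] at N u gives N^(-1/4) u^(-1/2),
    small and integrable at once. *)
Lemma limit_integrand_cell_bound (nu : nat) (m M : R) : 0 < m -> 1 <= M ->
  exists K : R, 0 <= K /\ forall N n x y u, (n < N)%N -> 0 < x <= M -> m <= y <= M ->
  n%:R / N%:R < u <= n.+1%:R / N%:R ->
  cabs (limit_integrand nu 4^-1 x y u - limit_integrand nu 4^-1 x y (n.+1%:R / N%:R)) <=
  K * expR (- (ln N%:R / 4)) * expR (- (ln u / 2)).
Proof.
move=> m0 M1; have q0 : 0 < 4^-1 :> R by rewrite invr_gt0.
have [K [K0 HK]] := limit_integrand_regular nu q0 m0 M1; exists (2 * K); split; first by rewrite mulr_ge0.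
move=> N n x y u nN /andP[x0 xM] yy /andP[u0 uu].
have N0' : 0 < N%:R :> R by rewrite ltr0n (leq_ltn_trans _ nN).
have xx : 0 <= x <= M by rewrite (ltW x0).
have [g1 g2] := HK x y xx yy.
have /andP[un0 un1] := grid_in01 nN.
set u' := n.+1%:R / N%:R in uu un0 un1 *.
have u0' : 0 < u by apply: le_lt_trans u0; rewrite divr_ge0.
have u1 : u <= 1 by exact: le_trans un1.
have du : u' - u <= N%:R^-1.
  have : u' = n%:R / N%:R + N%:R^-1 by rewrite /u' -natr1 mulrDl mul1r.
  lra.
have X1' := g2 u u' u0' uu un1.
have uu01 : 0 < u <= 1 by rewrite u0'.
have k1 := g1 u uu01.
have uu01' : 0 < u' <= 1 by rewrite un0.
have k2 := g1 u' uu01'.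
clear g1 g2 HK.
set X := cabs (_ - _) in X1' *; pose w := expR (- (4^-1 * ln u)).
have w0 : 0 <= w by exact: expR_ge0.
have Nu0 : 0 < N%:R * u by rewrite mulr_gt0.
have Kw : 0 <= K * w by rewrite mulr_ge0.
have X1 : X <= 2 * (K * w) / (N%:R * u).
  have h1 : (u' - u) / u <= (N%:R * u)^-1 by rewrite invfM ler_wpM2r// invr_ge0 ltW.
  apply: (le_trans X1'); rewrite -/w.
  apply: (@le_trans _ _ (K * w / (N%:R * u))).
    by rewrite mulrAC ler_wpM2l.
  by rewrite ler_wpM2r ?invr_ge0 ?(ltW Nu0)//; lra.
have X2 : X <= 2 * (K * w).
  rewrite /X (le_trans (cabsD _ _))// cabsN.
  have k3 : K * expR (- (4^-1 * ln u')) <= K * w.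
    rewrite ler_wpM2l// /w ler_expR.
    have : ln u <= ln u' by rewrite ler_ln ?posrE.
    lra.
  by rewrite -/w in k1; lra.
apply: (le_trans (exp_quarter_le Nu0 (mulr_ge0 (ler0n _ 2) Kw) X1 X2)).
rewrite /w lnM ?posrE//; apply: eq_ler.
have -> : expR (- ((ln N%:R + ln u) / 4)) = expR (- (ln N%:R / 4)) * expR (- (ln u / 4)) by rewrite -expRD; congr expR; ring.
have -> : expR (- (ln u / 2)) = expR (- (4^-1 * ln u)) * expR (- (ln u / 4)) by rewrite -expRD; congr expR; field.
ring.
Qed.

Lemma limit_integrand_riemann (nu : nat) (c m M : R) : 0 < c -> 0 < m -> 1 <= M ->
  exists L : R, forall N x y, (0 < N)%N -> 0 < x <= M -> m <= y <= M ->
  cabs (limit_kernel nu c x y - (N%:R^-1)%:C * \sum_(n < N) limit_integrand nu 4^-1 x y (n.+1%:R / N%:R)) <=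
  L * expR (- (ln N%:R / 4)).
Proof.
move=> c0 m0 M1; have q0 : 0 < 4^-1 :> R by rewrite invr_gt0.
have [K [K0 HK]] := limit_integrand_cell_bound nu m0 M1.
exists (2 * K * \int[mu]_(u in `]0, 1]) expR (- (ln u / 2))) => N x y N0 xx yy.
rewrite (proj2 (limit_integrand_cintegrable nu c0 m0 M1 xx yy)).
have ci := proj1 (limit_integrand_cintegrable nu q0 m0 M1 xx yy).
have mi : measurable (`]0, 1]%classic : set RT) by exact: measurable_itv.
have ih := @integrableZl _ _ _ mu `]0, 1]%classic mi (K * expR (- (ln N%:R / 4))) _ (@integrable_exp_half_ln R).
have hb n u : (n < N)%N -> n%:R / N%:R < u <= n.+1%:R / N%:R ->
  cabs (limit_integrand nu 4^-1 x y u - limit_integrand nu 4^-1 x y (n.+1%:R / N%:R)) <=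
  K * expR (- (ln N%:R / 4)) * expR (- (ln u / 2)).
  by move=> nN hu; exact: HK nN xx yy hu.
apply: (le_trans (@riemann_sum_bound R _ (fun n => limit_integrand nu 4^-1 x y (n.+1%:R / N%:R)) (fun u => K * expR (- (ln N%:R / 4)) * expR (- (ln u / 2))) N N0 ci ih hb)).
rewrite (RintegralZl _ mi (@integrable_exp_half_ln R)).
apply: eq_ler; ring.
Qed.

End Assembly.

Theorem theorem3p9 (R : realType) (mu : R) (nu : nat) (c : R) (A : set R)
    (mu_gt0 : 0 < mu) (mu_lt1 : mu < 1) (c_gt0 : 0 < c)
    (A_compact : compact A) (A_pos : A `<=` [set x | 0 < x]) (eps : R)
    (eps_gt0 : 0 < eps) :
  \forall N \near \oo, forall x y : R, A x -> A y ->
    let b := N%:R * (alpha mu ^+ 2 - delta mu ^+ 2) in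
    `| (b^-1 * kernel_N mu nu N (x / b) (y / b))%:C - limit_kernel nu c x y |
      < eps%:C.
Proof.
have [m [M [m0 M1 HA]]] := compact_pos_bounds A_compact A_pos.
set D := alpha mu ^+ 2 - delta mu ^+ 2.
have a0 : 0 < alpha mu by rewrite divr_gt0 ?mulr_gt0 ?addr_gt0.
have d0 : 0 < delta mu by rewrite divr_gt0 ?mulr_gt0 ?subr_gt0.
have D0 : 0 < D.
  have -> : D = mu^-1 by rewrite /D /alpha /delta; field; rewrite gt_eqF.
  by rewrite invr_gt0.
pose e := delta mu ^+ 2 / D; pose r := delta mu ^+ 2 / alpha mu ^+ 2.
have e0 : 0 <= e by rewrite divr_ge0 ?sqr_ge0 ?ltW.
have r0 : 0 < r by rewrite divr_gt0 ?exprn_gt0.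
have r1 : r < 1 by rewrite ltr_pdivrMr ?exprn_gt0// mul1r -subr_gt0.
have rE : D / alpha mu ^+ 2 = 1 - r by rewrite /r mulrBl divff// gt_eqF// exprn_gt0.
have [E [E0 cE HE]] := summand_approx nu r0 r1 e0 m0 M1.
have [L HL] := limit_integrand_riemann nu c_gt0 m0 M1.
have cW := weighted_cesaro E0 cE.
have cT : L * expR (- (ln n%:R / 4)) @[n --> \oo] --> (0 : R).
  have h : L * expR (- (ln n%:R / 4)) @[n --> \oo] --> L * 0.
    by apply: cvgM; [exact: cvg_cst|exact: cvg_expR_ln_quarter].
  by move: h; rewrite mulr0.
have eps2 : 0 < eps / 2 by rewrite divr_gt0.
move/cvgrPdist_lt: cW => /(_ _ eps2) nW.
move/cvgrPdist_lt: cT => /(_ _ eps2) nT.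
near=> N.
move=> x y Ax Ay.
have N0 : (0 < N)%N by near: N; exact: nbhs_infty_gt.
have N0' : 0 < N%:R :> R by rewrite ltr0n.
have W1 : N%:R^-1 * \sum_(n < N) cell_weight N n * E n < eps / 2.
  have : `|0 - N%:R^-1 * \sum_(n < N) cell_weight N n * E n| < eps / 2 by near: N.
  by rewrite sub0r normrN; exact: le_lt_trans (ler_norm _).
have T1 : L * expR (- (ln N%:R / 4)) < eps / 2.
  have : `|0 - L * expR (- (ln N%:R / 4))| < eps / 2 by near: N.
  by rewrite sub0r normrN; exact: le_lt_trans (ler_norm _).
have /andP[mx xM] := HA x Ax; have yy := HA y Ay.
have x0 : 0 < x by exact: lt_le_trans mx.
have y0 : 0 < y by case/andP: yy => my _; exact: lt_le_trans my.
have xx : 0 < x <= M by rewrite x0.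
rewrite normC_cabs ltcR (kernel_N_scaled nu mu_gt0 mu_lt1 N0 x0 y0) -/D -/e rE.
(* The Riemann sum V separates the two errors: replacing the summands by the limiting integrand, and
   replacing the integral by a sum. *)
pose V := (N%:R^-1)%:C * \sum_(n < N) limit_integrand nu 4^-1 x y (n.+1%:R / N%:R).
pose Z := (N%:R^-1 * \sum_(n < N) scaled_P nu e N n x * scaled_Q nu (1 - r) n (y / N%:R))%:C.
have P1 : cabs (Z - V) <= N%:R^-1 * \sum_(n < N) cell_weight N n * E n.
  have iN : 0 <= N%:R^-1 :> R by rewrite invr_ge0 ltW.
  rewrite /Z /V rmorphM -mulrBr cabsM cabs_real (ger0_norm iN); apply: (ler_wpM2l iN).
  rewrite rmorph_sum -sumrB (le_trans (cabs_sum _ _))//.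
  by apply: ler_sum => n _; exact: (HE N n x y (ltn_ord n) xx yy).
have P2 : cabs (limit_kernel nu c x y - V) <= L * expR (- (ln N%:R / 4)) := HL N x y N0 xx yy.
rewrite -/Z (_ : Z - _ = (Z - V) + - (limit_kernel nu c x y - V)); last by ring.
by apply: (le_lt_trans (cabsD _ _)); rewrite cabsN; lra.
Unshelve. all: by end_near. Qed.
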